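(* Let $d\ge 1$ be fixed and let $m_n\to\infty$ and $B_n\to\infty$ as $n\to\infty$. Let $X_n\in\mathbb{R}^{n\times d}$, $y_n\in\mathbb{R}^n$ be deterministic, $\lambda_n>0$, and let $H_n,g_n,A_n,\beta_n$, the sketch rows $s_{n,i}$, compressed rows $(z_{n,i},u_{n,i})$, influence vectors $\psi_{n,i}$, sketched estimator $\widehat\beta_{n,m_n}$, and the error bounds $\widehat\epsilon_{n,m_n,B_n}(\alpha)$ (bootstrap with refitting) and $\widetilde\epsilon_{n,m_n,B_n}(\alpha)$ (linearized bootstrap) be as defined in the context. Assume: (i) as $n\to\infty$, $\lambda_n\to\lambda_\infty\ge 0$, $H_n\to H$, $g_n\to g$ (finite limits), and there is $c_0>0$ with $\lambda_{\min}(H_n+\lambda_n I_d)\ge c_0$ for all sufficiently large $n$; (ii) for every $n$, $s_{n,1},\dots,s_{n,m_n}$ are i.i.d. with $\mathbb{E}(s_{n,1}s_{n,1}^\top)=I_n$; $$\sup_n \mathbb{E}\Big[\|z_{n,1}z_{n,1}^\top-H_n\|_{\mathrm F}^4+\|z_{n,1}u_{n,1}-g_n\|_2^4\Big]<\infty;$$ and there is a finite matrix $\Omega\in\mathbb{R}^{d\times d}$ such that $\Omega_n:=\mathbb{E}(\psi_{n,1}\psi_{n,1}^\top)\to\Omega$; (iii) $\operatorname{rank}(\Omega)\ge1$. Then for every $\alpha\in(0,1)$, $$\mathbb{P}\{\|\widehat\beta_{n,m_n}-\beta_n\|_2\le\widehat\epsilon_{n,m_n,B_n}(\alpha)\}\to1-\alpha,\qquad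 \mathbb{P}\{\|\widehat\beta_{n,m_n}-\beta_n\|_2\le\widetilde\epsilon_{n,m_n,B_n}(\alpha)\}\to1-\alpha,$$ where $\mathbb{P}$ is the joint probability over the sketch and the bootstrap draws used to construct the error bound, and the sketched estimator and each error bound are computed from the same sketch.
   Context: All limits are along one sequence $n\to\infty$ with $d$ fixed. Define $H_n:=\frac1n X_n^\top X_n$, $g_n:=\frac1n X_n^\top y_n$, $A_n:=(H_n+\lambda_n I_d)^{-1}$, $\beta_n:=A_ng_n$ (the minimizer over $\beta\in\mathbb{R}^d$ of $\frac1n\|X_n\beta-y_n\|_2^2+\lambda_n\|\beta\|_2^2$). For random sketch rows $s_{n,1},\dots,s_{n,m}\in\mathbb{R}^n$ define $z_{n,i}:=n^{-1/2}X_n^\top s_{n,i}\in\mathbb{R}^d$, $u_{n,i}:=n^{-1/2}y_n^\top s_{n,i}\in\mathbb{R}$, $\widehat H_{n,m}:=\frac1m\sum_{i=1}^m z_{n,i}z_{n,i}^\top$, $\widehat g_{n,m}:=\frac1m\sum_{i=1}^m z_{n,i}u_{n,i}$, $\widehat A_{n,m}:=(\widehat H_{n,m}+\lambda_nI_d)^{-1}$, and the sketched estimator $\widehat\beta_{n,m}:=\widehat A_{n,m}\widehat g_{n,m}$. The influence vectors are $\psi_{n,i}:=A_n\{z_{n,i}(u_{n,i}-z_{n,i}^\top\beta_n)-\lambda_n\beta_n\}$, which have mean zero when the rows are isotropic. Bootstrap: conditionally on the sketch, draw $B$ independent weight vectors $w_b=(w_{b,1},\dots,w_{b,m})\sim\mathrm{Multinomial}(m;\frac1m,\dots,\frac1m)$,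 $b=1,\dots,B$, and set $\widehat H^*_{n,m,b}:=\frac1m\sum_i w_{b,i}z_{n,i}z_{n,i}^\top$, $\widehat g^*_{n,m,b}:=\frac1m\sum_i w_{b,i}z_{n,i}u_{n,i}$, $\widehat\beta^*_{n,m,b}:=(\widehat H^*_{n,m,b}+\lambda_nI_d)^{-1}\widehat g^*_{n,m,b}$, $e^*_{n,m,b}:=\|\widehat\beta^*_{n,m,b}-\widehat\beta_{n,m}\|_2$. The linearized bootstrap errors are $\widetilde e^*_{n,m,b}:=\|\widetilde\Delta^*_{n,m,b}\|_2$ with $$\widetilde\Delta^*_{n,m,b}:=\widehat A_{n,m}\big\{(\widehat g^*_{n,m,b}-\widehat g_{n,m})-(\widehat H^*_{n,m,b}-\widehat H_{n,m})\widehat\beta_{n,m}\big\}=\widehat A_{n,m}\frac1m\sum_{i=1}^m(w_{b,i}-1)z_{n,i}(u_{n,i}-z_{n,i}^\top\widehat\beta_{n,m}).$$ The error bounds are the empirical quantiles $$\widehat\epsilon_{n,m,B}(\alpha):=\inf\Big\{t\ge0:\tfrac1B\sum_{b=1}^B\mathbf{1}\{e^*_{n,m,b}\le t\}\ge1-\alpha\Big\},\qquad \widetilde\epsilon_{n,m,B}(\alpha):=\inf\Big\{t\ge0:\tfrac1B\sum_{b=1}^B\mathbf{1}\{\widetilde e^*_{n,m,b}\le t\}\ge1-\alpha\Big\}.$$ $\|\cdot\|_{\mathrm F}$ is the Frobenius norm and $\lambda_{\min}$ the smallest eigenvalue. *)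

(* Defs.v *)
(* MathComp / MathComp-Analysis. *)
From HB Require Import structures.
From mathcomp Require Import all_boot all_order all_algebra.
From mathcomp Require Import all_classical all_reals all_analysis.

Set Implicit Arguments.
Unset Strict Implicit.
Unset Printing Implicit Defensive.

Import Order.TTheory GRing.Theory Num.Theory.
Import numFieldNormedType.Exports.

Local Open Scope classical_set_scope.
Local Open Scope ring_scope.

Section linear_algebra.
Variable R : realType.

(* On a column vector this is the Euclidean norm; the library's `|M| on
   matrices is the max norm. *)
Definition frobenius p q (M : 'M[R]_(p, q)) : R :=
  Num.sqrt (\sum_i \sum_j M i j ^+ 2).

(* Only used on symmetric matrices of size d >= 1: there the set of real
   eigenvalues is nonempty and finite, and its infimum is its least element. *)
Definition lambda_min d (M : 'M[R]_d) : R := inf [set a | eigenvalue M a].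

End linear_algebra.

Section ridge.
Variables (R : realType) (n d : nat).
Implicit Types (X : 'M[R]_(n, d)) (y s : 'cV[R]_n) (lam : R).

Definition gramH X : 'M[R]_d := n%:R^-1 *: (X^T *m X).
Definition gramg X y : 'cV[R]_d := n%:R^-1 *: (X^T *m y).

Definition ridgeA X lam : 'M[R]_d := invmx (gramH X + lam%:M).
Definition ridge_beta X y lam : 'cV[R]_d := ridgeA X lam *m gramg X y.

Definition zvec X s : 'cV[R]_d := (Num.sqrt n%:R)^-1 *: (X^T *m s).
Definition uval y s : R := (Num.sqrt n%:R)^-1 * (y^T *m s) 0 0.

Definition influence X y lam s : 'cV[R]_d :=
  let beta := ridge_beta X y lam in
  ridgeA X lam *m
    ((uval y s - ((zvec X s)^T *m beta) 0 0) *: zvec X s - lam *: beta).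

End ridge.

Section sketch.
Variables (R : realType) (n d m : nat).
Implicit Types (X : 'M[R]_(n, d)) (y : 'cV[R]_n) (lam : R).
Implicit Types (S : 'I_m -> 'cV[R]_n) (w : 'I_m -> nat).

Definition sketchH X S : 'M[R]_d :=
  m%:R^-1 *: \sum_i (zvec X (S i) *m (zvec X (S i))^T).
Definition sketchg X y S : 'cV[R]_d :=
  m%:R^-1 *: \sum_i (uval y (S i) *: zvec X (S i)).
Definition sketchA X lam S : 'M[R]_d := invmx (sketchH X S + lam%:M).
Definition sketch_beta X y lam S : 'cV[R]_d :=
  sketchA X lam S *m sketchg X y S.

Definition bootH X S w : 'M[R]_d :=
  m%:R^-1 *: \sum_i ((w i)%:R *: (zvec X (S i) *m (zvec X (S i))^T)).
Definition bootg X y S w : 'cV[R]_d :=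
  m%:R^-1 *: \sum_i ((w i)%:R *: (uval y (S i) *: zvec X (S i))).
Definition boot_beta X y lam S w : 'cV[R]_d :=
  invmx (bootH X S w + lam%:M) *m bootg X y S w.

Definition boot_err X y lam S w : R :=
  frobenius (boot_beta X y lam S w - sketch_beta X y lam S).

Definition lin_boot_delta X y lam S w : 'cV[R]_d :=
  sketchA X lam S *m
    ((bootg X y S w - sketchg X y S)
     - (bootH X S w - sketchH X S) *m sketch_beta X y lam S).

Definition lin_boot_err X y lam S w : R :=
  frobenius (lin_boot_delta X y lam S w).

End sketch.

(* For B = 0 the set below is empty when alpha < 1, and inf set0 = 0. *)
Definition emp_quantile (R : realType) B (e : 'I_B -> R) (alpha : R) : R :=
  inf [set t : R | 0 <= t /\
                   1 - alpha <= B%:R^-1 * \sum_(b < B) (e b <= t)%R%:R].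

Section error_bounds.
Variables (R : realType) (n d m B : nat).
Variables (X : 'M[R]_(n, d)) (y : 'cV[R]_n) (lam : R).
Variables (S : 'I_m -> 'cV[R]_n) (w : 'I_B -> 'I_m -> nat) (alpha : R).

Definition boot_bound : R :=
  emp_quantile (fun b => boot_err X y lam S (w b)) alpha.

Definition lin_boot_bound : R :=
  emp_quantile (fun b => lin_boot_err X y lam S (w b)) alpha.

End error_bounds.

(* The carrier 'cV[R]_n with its Borel sigma-algebra. *)
Definition borel_cV (R : realType) (n : nat) :=
  g_sigma_algebraType (@open 'cV[R]_n).

Section probability.
Context {R : realType} {dT : measure_display} {T : measurableType dT}
  (P : probability T R).

Definition mutually_independent {I : finType} {d' : measure_display}
    {T' : measurableType d'} (Y : I -> {RV P >-> T'}) : Prop :=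
  forall (J : {set I}) (E : I -> set T'), (forall i, measurable (E i)) ->
    P (\bigcap_(i in [set` J]) (Y i @^-1` E i)) =
    (\prod_(i in J) P (Y i @^-1` E i))%E.

Definition identically_distributed {I : finType} {d' : measure_display}
    {T' : measurableType d'} (Y : I -> {RV P >-> T'}) : Prop :=
  forall (i j : I) (E : set T'), measurable E ->
    distribution P (Y i) E = distribution P (Y j) E.

Definition Emx p q (F : T -> 'M[R]_(p, q)) : 'M[\bar R]_(p, q) :=
  \matrix_(i, j) 'E_P[fun t => F t i j]%E.

Definition multinomial_pmf m (N : nat) (p : 'I_m -> R) (k : 'I_m -> nat) : R :=
  if (\sum_i k i == N)%N
  then N`!%:R * \prod_i (p i ^+ k i / (k i)`!%:R) else 0.

(* The regular conditional law of (w b)_b given sigma(S) is the B-fold product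
   of Multinomial(m; 1/m, ..., 1/m). As this law is discrete and does not
   depend on S, it is characterized by P(A, w = k) = P(A) * prod_b pmf (k b)
   for A in sigma(S). *)
Definition multinomial_draws_given {d' : measure_display}
    {T' : measurableType d'} m B (S : 'I_m -> {RV P >-> T'})
    (w : 'I_B -> 'I_m -> {RV P >-> nat}) : Prop :=
  forall (A : set T) (k : 'I_B -> 'I_m -> nat),
    g_sigma_preimage (fun i => S i : T -> T') A ->
    P (A `&` [set t | forall b i, w b i t = k b i]) =
    (P A * (\prod_(b < B)
              multinomial_pmf m (fun _ : 'I_m => m%:R^-1) (k b))%:E)%E.

End probability.

(* Main.v *)
(* The estimation error of an i.i.d. ridge problem is exactly Ahat times the mean
   of the scores z (u - z^T beta) - lam beta, so that sqrt m (betahat - beta) is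
   Ahat A^-1, close to the identity, applied to the normalized sum of the
   influence vectors. Write Omega as a finite sum of matrices l l^T. Lindeberg's
   replacement, applied to a smooth step function of the squared norm, compares
   this sum with the Rademacher sums m^(-1/2) sum_(i <= m) sum_l (+-l), uniformly
   over all populations with bounded fourth moments and influence covariance
   close to Omega. No limit law is needed: the distribution function of the
   squared norm of the Rademacher sum is a common reference, on the one hand for
   the sketch and, on the other hand, for the bootstrap, which is the same
   one-sample problem with the sketch as population (the multinomial weights are
   the counts of m uniform draws from the sketch) and which satisfies the same
   bounds for all sketches outside an event of small probability. As Omega is
   nonzero, some l is nonzero, and its signs alone spread the reference law out,
   since the binomial probabilities are at most m^(-1/2); hence the reference has
   points at which it is close to any given level, and is nearly continuous
   there. Chebyshev's inequality over the B conditionally independent draws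
   passes from the bootstrap law to its empirical quantile. *)

Require Import Defs.
From HB Require Import structures.
From mathcomp Require Import all_boot all_order all_algebra.
From mathcomp Require Import all_classical all_reals all_analysis.
From mathcomp Require Import measurable_realfun.
From mathcomp Require Import ring lra zify.

Set Implicit Arguments.
Unset Strict Implicit.
Unset Printing Implicit Defensive.

Import Order.TTheory GRing.Theory Num.Theory.
Import numFieldNormedType.Exports.

Local Open Scope classical_set_scope.
Local Open Scope ring_scope.

(** * Quadratic forms *)

Section squared_norm.
Variable R : realType.

(** The estimation error and the bootstrap quantile come from the same sketch, and their joint law
    is never studied. Instead, with high probability the random quantile is trapped between two
    deterministic thresholds [sqrt (t1 / m)] and [sqrt (t2 / m)], where the reference law has level
    slightly below and slightly above [1 - alpha]. These points move with [m] and need not converge;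
    they only have to stay bounded, which is why every comparison is uniform over thresholds
    [t <= K]. A smooth comparison is only valid up to a window [delta] around the threshold;
    anti-concentration of the reference at scale [delta] turns this window into a small additive
    error. Fourth moments serve twice: they dominate the cubic Taylor remainder, and they make the
    empirical covariance of the influence vectors converge in mean square. No law of large numbers
    is available for the fourth moments of the sketch itself, so these are only kept bounded, by
    Markov's inequality, and the constants of the bootstrap population depend on the tolerated
    probability of failure. *)

Lemma cauchy_schwarz (I : finType) (a b : I -> R) :
  (\sum_i a i * b i) ^+ 2 <= (\sum_i a i ^+ 2) * (\sum_i b i ^+ 2).
Proof.
rewrite expr2 !big_distrlr/=.
have -> : \sum_i \sum_j a i ^+ 2 * b j ^+ 2 =
   \sum_i \sum_j (a i ^+ 2 * b j ^+ 2 + a j ^+ 2 * b i ^+ 2) / 2.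
  have E : \sum_i \sum_j a j ^+ 2 * b i ^+ 2 = \sum_i \sum_j a i ^+ 2 * b j ^+ 2.
    by rewrite exchange_big.
  under [RHS]eq_bigr do (rewrite -mulr_suml big_split/=).
  rewrite -mulr_suml big_split/= E; lra.
apply: ler_sum => i _; apply: ler_sum => j _.
have := sqr_ge0 (a i * b j - a j * b i); nra.
Qed.

(** Squared Frobenius norm. Being polynomial in the entries it suits [nra] and measurability proofs;
    [nsqD_le] stands in for the triangle inequality, at the cost of factors 2. *)
Definition nsq p q (M : 'M[R]_(p, q)) : R := \sum_i \sum_j M i j ^+ 2.

Lemma nsq_ge0 p q (M : 'M[R]_(p, q)) : 0 <= nsq M.
Proof. by apply: sumr_ge0 => i _; apply: sumr_ge0 => j _; exact: sqr_ge0. Qed.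

Lemma frobenius_ge0 p q (M : 'M[R]_(p, q)) : 0 <= frobenius M.
Proof. exact: sqrtr_ge0. Qed.

Lemma frobenius_sqr p q (M : 'M[R]_(p, q)) : frobenius M ^+ 2 = nsq M.
Proof. by rewrite sqr_sqrtr// nsq_ge0. Qed.

Lemma nsq0 p q : nsq (0 : 'M[R]_(p, q)) = 0.
Proof.
by rewrite /nsq big1// => i _; rewrite big1// => j _; rewrite mxE expr0n.
Qed.

Lemma nsq_entry p q (M : 'M[R]_(p, q)) i j : M i j ^+ 2 <= nsq M.
Proof.
rewrite /nsq (bigD1 i)//= (bigD1 j)//= -addrA lerDl addr_ge0//.
  by apply: sumr_ge0 => *; exact: sqr_ge0.
by apply: sumr_ge0 => *; apply: sumr_ge0 => *; exact: sqr_ge0.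
Qed.

Lemma nsq_eq0 p q (M : 'M[R]_(p, q)) : nsq M = 0 -> M = 0.
Proof.
move=> M0; apply/matrixP => i j; rewrite mxE; apply/eqP.
rewrite -sqrf_eq0 eq_le sqr_ge0 andbT -M0; exact: nsq_entry.
Qed.

Lemma nsqZ p q a (M : 'M[R]_(p, q)) : nsq (a *: M) = a ^+ 2 * nsq M.
Proof.
rewrite /nsq mulr_sumr; apply: eq_bigr => i _; rewrite mulr_sumr.
by apply: eq_bigr => j _; rewrite mxE exprMn.
Qed.

Lemma nsqN p q (M : 'M[R]_(p, q)) : nsq (- M) = nsq M.
Proof. by rewrite -scaleN1r nsqZ sqrrN expr1n mul1r. Qed.

Lemma nsqD_le p q (M N : 'M[R]_(p, q)) : nsq (M + N) <= 2 * nsq M + 2 * nsq N.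
Proof.
rewrite /nsq !mulr_sumr -big_split/=; apply: ler_sum => i _.
rewrite !mulr_sumr -big_split/=; apply: ler_sum => j _; rewrite mxE.
have := sqr_ge0 (M i j - N i j); nra.
Qed.

Lemma nsqB_le p q (M N : 'M[R]_(p, q)) : nsq (M - N) <= 2 * nsq M + 2 * nsq N.
Proof. by rewrite (le_trans (nsqD_le _ _))// nsqN. Qed.

Lemma nsqC p q (M N : 'M[R]_(p, q)) : nsq (M - N) = nsq (N - M).
Proof. by rewrite -nsqN opprB. Qed.

Lemma nsqM p q r (M : 'M[R]_(p, q)) (N : 'M[R]_(q, r)) :
  nsq (M *m N) <= nsq M * nsq N.
Proof.
rewrite /nsq mulr_suml; apply: ler_sum => i _.
rewrite [X in _ * X]exchange_big/= mulr_sumr; apply: ler_sum => j _.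
by rewrite mxE; exact: cauchy_schwarz.
Qed.

Lemma nsq1 n : nsq (1%:M : 'M[R]_n) = n%:R.
Proof.
rewrite /nsq (eq_bigr (fun=> 1)) ?sumr_const ?card_ord// => i _.
rewrite (bigD1 i)//= mxE eqxx expr1n big1 ?addr0// => j ji.
by rewrite mxE eq_sym (negbTE ji) expr0n.
Qed.

Lemma nsq_col p q (M : 'M[R]_(p, q)) : nsq M = \sum_j nsq (col j M).
Proof.
rewrite /nsq exchange_big/=; apply: eq_bigr => j _.
by apply: eq_bigr => i _; rewrite big_ord1 mxE.
Qed.

Lemma nsq_cV p (x : 'cV[R]_p) : nsq x = (x^T *m x) 0 0.
Proof.
by rewrite mxE; apply: eq_bigr => i _; rewrite big_ord1 mxE expr2.
Qed.

Lemma nsq_cVE p (x : 'cV[R]_p) : nsq x = \sum_i x i 0 ^+ 2.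
Proof. by apply: eq_bigr => i _; rewrite big_ord1. Qed.

Lemma nsq_scalar (M : 'M[R]_1) : nsq M = M 0 0 ^+ 2.
Proof. by rewrite /nsq !big_ord1. Qed.

Lemma nsq_tr p q (M : 'M[R]_(p, q)) : nsq M^T = nsq M.
Proof.
rewrite /nsq exchange_big/=.
by apply: eq_bigr => i _; apply: eq_bigr => j _; rewrite mxE.
Qed.

End squared_norm.

Section psd.
Variable R : realType.

Definition qf d (M : 'M[R]_d) (x y : 'cV[R]_d) : R := (x^T *m M *m y) 0 0.

Definition psd d (M : 'M[R]_d) : Prop :=
  M^T = M /\ forall x, 0 <= qf M x x.

Section qf.
Variable d : nat.
Implicit Types (M N : 'M[R]_d) (x y z : 'cV[R]_d).

Lemma qfDl M x y z : qf M (x + y) z = qf M x z + qf M y z.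
Proof. by rewrite /qf linearD/= !mulmxDl mxE. Qed.

Lemma qfDr M x y z : qf M x (y + z) = qf M x y + qf M x z.
Proof. by rewrite /qf mulmxDr mxE. Qed.

Lemma qfZl M a x y : qf M (a *: x) y = a * qf M x y.
Proof. by rewrite /qf linearZ/= -!scalemxAl mxE. Qed.

Lemma qfZr M a x y : qf M x (a *: y) = a * qf M x y.
Proof. by rewrite /qf -!scalemxAr mxE. Qed.

Lemma qfDm M N x y : qf (M + N) x y = qf M x y + qf N x y.
Proof. by rewrite /qf mulmxDr mulmxDl mxE. Qed.

Lemma qf_scalar a x : qf a%:M x x = a * nsq x.
Proof. by rewrite /qf mul_mx_scalar -scalemxAl mxE nsq_cV. Qed.

Lemma qfBs M a x : qf (M - a%:M) x x = qf M x x - a * nsq x.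
Proof. by rewrite qfDm -raddfN/= qf_scalar mulNr. Qed.

Lemma qf_sym M x y : M^T = M -> qf M x y = qf M y x.
Proof.
move=> sM; rewrite /qf (_ : x^T *m M *m y = (y^T *m M *m x)^T) ?mxE//.
by rewrite !trmx_mul trmxK sM mulmxA.
Qed.

Lemma qf_delta M i j : qf M (delta_mx i 0) (delta_mx j 0) = M i j.
Proof. by rewrite /qf trmx_delta -rowE -colE !mxE. Qed.

Lemma qf_deltar M x j : qf M (delta_mx j 0) x = (M *m x) j 0.
Proof. by rewrite /qf trmx_delta -rowE -row_mul mxE. Qed.

Lemma qf_outer (l x : 'cV[R]_d) : qf (l *m l^T) x x = (x^T *m l) 0 0 ^+ 2.
Proof.
rewrite /qf mulmxA -mulmxA [l^T *m x](_ : _ = (x^T *m l)^T); last first.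
  by rewrite trmx_mul trmxK.
by rewrite mxE big_ord1 [X in _ * X]mxE expr2.
Qed.

Lemma sqr_dot_le (x y : 'cV[R]_d) : (x^T *m y) 0 0 ^+ 2 <= nsq x * nsq y.
Proof. by rewrite -nsq_scalar -(nsq_tr x) nsqM. Qed.

Lemma qf_le M x : `|qf M x x| <= (1 + nsq M) * nsq x.
Proof.
have := sqr_dot_le x (M *m x).
rewrite mulmxA -/(qf M x x) => h.
have h2 := nsqM M x; have h3 := nsq_ge0 x; have h4 := nsq_ge0 M.
have h5 : qf M x x ^+ 2 <= ((1 + nsq M) * nsq x) ^+ 2.
  apply: (le_trans h); apply: (@le_trans _ _ (nsq x * (nsq M * nsq x))).
    exact: ler_wpM2l.
  rewrite exprMn; have : 0 <= nsq x ^+ 2 by exact: sqr_ge0.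
  nra.
rewrite -(ler_pXn2r (n := 2))// ?nnegrE// ?real_normK ?num_real//.
by rewrite mulr_ge0// addr_ge0.
Qed.

(** Discriminant of the nonnegative quadratic polynomial [a |-> qf M (x + a y) (x + a y)]. If
    [qf M y y] vanishes, the polynomial is affine and its slope must be zero. *)
Lemma psd_cs M x y : psd M -> qf M x y ^+ 2 <= qf M x x * qf M y y.
Proof.
move=> [sM pM].
have q a : 0 <= qf M x x + 2 * a * qf M x y + a ^+ 2 * qf M y y.
  have := pM (x + a *: y).
  by rewrite qfDl !qfDr !qfZl !qfZr (qf_sym y x sM) => h; apply: le_trans h _; lra.
have yy := pM y; have xx := pM x.
have [y0|yn0] := eqVneq (qf M y y) 0.
  rewrite y0 in q *; rewrite mulr0.
  have [->|n0] := eqVneq (qf M x y) 0; first by rewrite expr0n.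
  (* At this [a] the affine function takes the value -1. *)
  have := q (- (1 + qf M x x) / (2 * qf M x y)).
  rewrite (_ : 2 * _ * _ = - (1 + qf M x x)); first by lra.
  by field.
have yp : 0 < qf M y y by rewrite lt_def yn0.
have := q (- qf M x y / qf M y y).
have -> : qf M x x + 2 * (- qf M x y / qf M y y) * qf M x y +
  (- qf M x y / qf M y y) ^+ 2 * qf M y y =
  (qf M x x * qf M y y - qf M x y ^+ 2) / qf M y y by field.
by rewrite pmulr_lge0 ?invr_gt0// subr_ge0.
Qed.

Lemma unitmx_inj M : (forall x, M *m x = 0 -> x = 0) -> M \in unitmx.
Proof.
move=> inj; rewrite unitmxE unitfE; apply/negP => /eqP det0.
have : \det M^T == 0 by rewrite det_tr det0.
move=> /det0P[v v0 vM]; move/negP: v0; apply.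
rewrite -(trmxK v) (inj v^T) ?linear0//.
by rewrite -[M]trmxK -trmx_mul vM linear0.
Qed.

Lemma psd_addr_unit M a : psd M -> 0 < a -> M + a%:M \in unitmx.
Proof.
move=> [_ pM] a0; apply: unitmx_inj => x h.
have : qf (M + a%:M) x x = 0 by rewrite /qf -mulmxA h mulmx0 mxE.
rewrite qfDm qf_scalar => e; apply: nsq_eq0.
have := pM x; have := nsq_ge0 x; nra.
Qed.

Lemma psd_ge_nsq M c x : psd (M - c%:M) -> 0 < c -> c ^+ 2 * nsq x <= nsq (M *m x).
Proof.
move=> [_ pM] c0; have := pM x; rewrite qfBs subr_ge0 => h.
have h2 : (c * nsq x) ^+ 2 <= nsq x * nsq (M *m x).
  apply: le_trans (sqr_dot_le x (M *m x)); rewrite mulmxA -/(qf M x x).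
  by rewrite ler_sqr// nnegrE ?(le_trans _ h)// mulr_ge0 ?nsq_ge0// ltW.
have [x0|xn0] := eqVneq (nsq x) 0; first by rewrite x0 mulr0 nsq_ge0.
rewrite -(ler_pM2l (_ : 0 < nsq x)) ?lt_def ?xn0 ?nsq_ge0//.
by apply: le_trans h2; rewrite exprMn; lra.
Qed.

(** The lower bound [c |x| <= |M x|], applied to the columns of the inverse, whose images are the
    columns of the identity, sums to [c^2 nsq (invmx M) <= nsq 1 = d]. *)
Lemma nsq_invmx_le M c : psd (M - c%:M) -> 0 < c ->
  M \in unitmx /\ nsq (invmx M) <= d%:R / c ^+ 2.
Proof.
move=> pM c0.
have uM : M \in unitmx.
  apply: unitmx_inj => x Mx0; have := psd_ge_nsq x pM c0.
  rewrite Mx0 nsq0 => h; apply: nsq_eq0; apply/eqP.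
  rewrite eq_le nsq_ge0 andbT; have := exprn_gt0 2 c0; nra.
split => //; rewrite ler_pdivlMr ?exprn_gt0// mulrC.
rewrite -nsq1 -(mulmxV uM) !nsq_col mulr_sumr; apply: ler_sum => j _.
by rewrite !colE -mulmxA; exact: psd_ge_nsq.
Qed.

Lemma symBs M a : M^T = M -> (M - a%:M)^T = M - a%:M.
Proof. by move=> sM; rewrite linearB/= sM tr_scalar_mx. Qed.

(* An invertible positive semidefinite matrix is bounded below: the square
   of |Mx|^2 = qf M x (Mx) is at most qf M x x * qf M (Mx) (Mx). *)
Lemma psd_unit_sub M : psd M -> M \in unitmx -> exists2 e, 0 < e & psd (M - e%:M).
Proof.
move=> pM uM; have [sM qM] := pM.
have a0 := nsq_ge0 M; have b0 := nsq_ge0 (invmx M).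
have ab0 : 0 < (1 + nsq M) * (1 + nsq (invmx M)) by apply: mulr_gt0; lra.
(* The factor with [M] compares [nsq (M x)] with [qf M x x], the factor with the inverse compares
   [nsq x] with [nsq (M x)]; the added 1 keeps both positive. *)
exists (((1 + nsq M) * (1 + nsq (invmx M)))^-1); first by rewrite invr_gt0.
split; first exact: symBs.
move=> x; rewrite qfBs subr_ge0 mulrC ler_pdivrMr//.
have e1 : qf M x (M *m x) = nsq (M *m x) by rewrite nsq_cV trmx_mul sM.
have := psd_cs x (M *m x) pM; rewrite e1.
have := qf_le M (M *m x); have := ler_norm (qf M (M *m x) (M *m x)).
have := qM x.
have : nsq x <= nsq (invmx M) * nsq (M *m x).
  by rewrite -[x in X in X <= _](mulKmx uM) nsqM.
have := nsq_ge0 (M *m x).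
set u := nsq (M *m x); set q := qf M x x; set r := qf M _ _.
move=> u0 hx q0 h1 h2 h3.
have u2 : u ^+ 2 <= q * ((1 + nsq M) * u).
  by apply: (le_trans h3); apply: ler_wpM2l => //; exact: le_trans h1 h2.
have u3 : u <= q * (1 + nsq M).
  have [->|un0] := eqVneq u 0; first by apply: mulr_ge0 => //; lra.
  by rewrite -(ler_pM2r (_ : 0 < u)) ?lt_def ?un0//; lra.
apply: (le_trans hx); apply: (@le_trans _ _ (nsq (invmx M) * (q * (1 + nsq M)))).
  exact: ler_wpM2l.
have : 0 <= q * (1 + nsq M) by apply: mulr_ge0 => //; lra.
nra.
Qed.

End qf.

(* The supremum of the s such that M - s is positive semidefinite is an
   eigenvalue, hence at least lambda_min M. *)
Lemma lambda_min_psd d (M : 'M[R]_d) c : (0 < d)%N -> M^T = M ->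
  c <= lambda_min M -> psd (M - c%:M).
Proof.
move=> d0 sM cM.
pose E := [set s | psd (M - s%:M)].
have E0 : E !=set0.
  exists (- (1 + nsq M)); split; first exact: symBs.
  move=> x; rewrite qfBs; have := qf_le M x; have := ler_norm (- qf M x x).
  by rewrite normrN; lra.
have Eub : has_ubound E.
  (* A diagonal entry bounds the admissible shifts from above; here [0 < d] enters. *)
  exists (M (Ordinal d0) (Ordinal d0)) => s [_ /(_ (delta_mx (Ordinal d0) 0))].
  rewrite qfBs qf_delta subr_ge0 nsq_cVE (bigD1 (Ordinal d0))//= mxE !eqxx.
  by rewrite big1 ?addr0 ?expr1n ?mulr1// => i /negbTE ii; rewrite mxE ii/= expr0n.
have pS : psd (M - (sup E)%:M).
  split; first exact: symBs.
  move=> x; rewrite qfBs subr_ge0.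
  have [/nsq_eq0 ->|x0] := eqVneq (nsq x) 0.
    by rewrite nsq0 mulr0 /qf mulmx0 mxE.
  have xp : 0 < nsq x by rewrite lt_def x0 nsq_ge0.
  rewrite -ler_pdivlMr//; apply: ge_sup => // s [_ /(_ x)].
  by rewrite qfBs subr_ge0 ler_pdivlMr.
have nu : M - (sup E)%:M \notin unitmx.
  apply/negP => uM; have [e e0 [_ he]] := psd_unit_sub pS uM.
  have /(ub_le_sup Eub) : E (sup E + e).
    split; first exact: symBs.
    by move=> x; have := he x; rewrite !qfBs; lra.
  lra.
have ev : eigenvalue M (sup E).
  move: nu; rewrite unitmxE unitfE negbK => /det0P[v v0 vM].
  apply/eigenvalueP; exists v => //.
  by move: vM; rewrite mulmxBr mul_mx_scalar => /eqP; rewrite subr_eq0 => /eqP.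
have cS : c <= sup E.
  (* [ge_inf] asks for a lower bound of the eigenvalues: [sup E] is one, by the Rayleigh quotient of
     an eigenvector. *)
  apply: (le_trans cM); apply: ge_inf => //; exists (sup E) => a /eigenvalueP[v va v0].
  have [_ /(_ v^T)] := pS; rewrite qfBs subr_ge0 /qf trmxK va -scalemxAl mxE.
  rewrite (_ : (v *m v^T) 0 0 = nsq v^T); last by rewrite nsq_cV trmxK.
  rewrite ler_pM2r// lt_def nsq_ge0 andbT; apply/eqP => /nsq_eq0 vT0.
  by move/eqP: v0; apply; rewrite -[v]trmxK vT0 linear0.
split; first exact: symBs.
move=> x; have [_ /(_ x)] := pS; rewrite !qfBs; have := nsq_ge0 x; nra.
Qed.

(** One Cholesky step: [l] is column [k] over the square root of the pivot. Cauchy-Schwarz keeps the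
    remainder semidefinite and makes the whole row vanish with the pivot, in which case [l = 0] will
    do. Rows already cleared stay zero, so the step can be iterated over [k]. *)
Lemma psd_peel d (M : 'M[R]_d) k : psd M -> exists l : 'cV[R]_d,
  [/\ psd (M - l *m l^T), (forall j, (M - l *m l^T) k j = 0) &
      forall i, (forall j, M i j = 0) -> forall j, (M - l *m l^T) i j = 0].
Proof.
move=> pM; have [sM qM] := pM.
have Mkk : 0 <= M k k by rewrite -qf_delta.
have sM' i j : M i j = M j i by rewrite -{1}sM mxE.
have cs j : M k j ^+ 2 <= M k k * M j j by rewrite -!qf_delta; exact: psd_cs.
have [k0|kn0] := eqVneq (M k k) 0.
  exists 0; rewrite mul0mx subr0; split => // j.
  by have := cs j; rewrite k0 mul0r => h; apply/eqP; rewrite -sqrf_eq0 eq_le h sqr_ge0.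
have kp : 0 < M k k by rewrite lt_def kn0.
have sq : Num.sqrt (M k k) ^+ 2 = M k k by rewrite sqr_sqrtr.
have sn0 : Num.sqrt (M k k) != 0 by rewrite sqrtr_eq0 -ltNge.
exists ((Num.sqrt (M k k))^-1 *: col k M).
have out i j : ((Num.sqrt (M k k))^-1 *: col k M *m
    ((Num.sqrt (M k k))^-1 *: col k M)^T) i j = M i k * M k j / M k k.
  rewrite !mxE big_ord1 !mxE (sM' j k) -[in RHS]sq; field.
  by [].
split.
- split.
    by rewrite linearB/= sM trmx_mul trmxK.
  move=> x; rewrite qfDm; have := psd_cs (delta_mx k 0) x pM.
  rewrite qf_delta qf_deltar => h.
  have -> : qf (- ((Num.sqrt (M k k))^-1 *: col k M *m
      ((Num.sqrt (M k k))^-1 *: col k M)^T)) x x = - ((M *m x) k 0 ^+ 2 / M k k).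
    rewrite /qf mulmxN mulNmx mxE -/(qf _ _ _) qf_outer -scalemxAr mxE.
    have -> : (x^T *m col k M) 0 0 = (M *m x) k 0.
      by rewrite !mxE; apply: eq_bigr => i _; rewrite !mxE sM' mulrC.
    by congr (- _); rewrite exprMn exprVn sq mulrC.
  by rewrite subr_ge0 ler_pdivrMr// mulrC.
- by move=> j; rewrite mxE [X in _ + X]mxE out; field.
- move=> i i0 j; rewrite mxE [X in _ + X]mxE out i0 i0; ring.
Qed.

Lemma psd_sum_outer d (M : 'M[R]_d) : psd M ->
  exists ls : seq 'cV[R]_d, M = \sum_(l <- ls) l *m l^T.
Proof.
move=> pM.
have H k : (k <= d)%N -> exists ls : seq 'cV[R]_d,
    psd (M - \sum_(l <- ls) l *m l^T) /\
    forall i : 'I_d, (i < k)%N -> forall j, (M - \sum_(l <- ls) l *m l^T) i j = 0.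
  elim: k => [|k IH] kd; first by exists [::]; rewrite big_nil subr0.
  have [ls [p h]] := IH (ltnW kd).
  have [l [p' hk h']] := psd_peel (Ordinal kd) p.
  exists (l :: ls).
  have -> : M - \sum_(j <- l :: ls) j *m j^T = M - \sum_(l <- ls) l *m l^T - l *m l^T.
    by rewrite big_cons opprD addrCA addrC.
  split => // i; rewrite ltnS leq_eqVlt => /orP[/eqP ik|ik] j.
    by rewrite (_ : i = Ordinal kd) ?hk//; exact: val_inj.
  by apply: h' => ?; exact: h.
have [ls [_ h]] := H d (leqnn d).
exists ls; apply/eqP; rewrite -subr_eq0; apply/eqP/matrixP => i j.
by rewrite h// mxE.
Qed.

End psd.

(** * Rademacher sums *)

Section central_binomial.

Lemma bin_double_mid k j : ('C(k.*2, j) <= 'C(k.*2, k))%N.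
Proof.
have H i : ('C(k.*2, k + i) <= 'C(k.*2, k))%N.
  elim: i => [|i IH]; first by rewrite addn0.
  apply: leq_trans IH; rewrite addnS.
  have := mul_bin_left k.*2 (k + i) => h.
  rewrite -(leq_pmul2l (ltn0Sn (k + i))) h leq_mul2r; apply/orP; right.
  by lia.
have [kj|jk] := leqP k j; first by rewrite -(subnKC kj).
have jk2 : (j <= k.*2)%N by lia.
rewrite -bin_sub// (_ : k.*2 - j = k + (k - j))%N//; lia.
Qed.

(** The factor [2k + 1] lets the induction close: consecutive central coefficients have ratio
    [2 (2k + 1) / (k + 1)], and [(2k + 1) (2k + 3) <= (2k + 2)^2]. *)
Lemma central_bin_sqr_le k : ('C(k.*2, k) ^ 2 * k.*2.+1 <= 16 ^ k)%N.
Proof.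
elim: k => [|k IH]; first by rewrite bin0.
have h1 := mul_bin_diag k.*2.+2 k.
have h3 := mul_bin_diag k.*2.+1 k.
have h4 : ('C(k.*2.+1, k.+1) = 'C(k.*2.+1, k))%N.
  by rewrite -bin_sub; [congr 'C(_, _); lia|lia].
have e : (k.+1 * 'C(k.+1.*2, k.+1) = k.*2.+1.*2 * 'C(k.*2, k))%N.
  rewrite doubleS -h1 /= -h4; rewrite /= in h3; lia.
rewrite -(leq_pmul2l (_ : 0 < k.+1 ^ 2)%N) ?expn_gt0// mulnA -expnMn e.
rewrite expnMn [(16 ^ _)%N]expnS.
have h6 : (k.*2.+1.*2 ^ 2 * k.+1.*2.+1 <= k.+1 ^ 2 * 16 * k.*2.+1)%N.
  by rewrite !expnS !expn0; nia.
have := leq_mul (leqnn ('C(k.*2, k) ^ 2)%N) h6.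
have := leq_mul (leqnn (k.+1 ^ 2 * 16)%N) IH.
lia.
Qed.

(** As a probability, [C(m, j) / 2^m <= 1 / sqrt m]. For [m = 2k + 1], Pascal's rule bounds the
    coefficient by twice the central one of [2k]; this is where the even bound with [2k + 1] is used
    in full. *)
Lemma bin_sqr_le m j : ('C(m, j) ^ 2 * m <= 4 ^ m)%N.
Proof.
have H k i : ('C(k.*2, i) ^ 2 * k.*2.+1 <= 16 ^ k)%N.
  apply: leq_trans (central_bin_sqr_le k); rewrite leq_mul2r; apply/orP; right.
  by rewrite leq_exp2r// bin_double_mid.
have e4 k : (4 ^ k.*2 = 16 ^ k)%N by rewrite -mul2n expnM.
rewrite -(odd_double_half m); case: (odd m) => /=.
  rewrite add1n [(4 ^ _.+1)%N]expnS e4.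
  case: j => [|j].
    by rewrite bin0 exp1n mul1n; have := H m./2 0%N; rewrite bin0 exp1n mul1n; lia.
  rewrite binS.
  have a := bin_double_mid m./2 j; have b := bin_double_mid m./2 j.+1.
  have c := central_bin_sqr_le m./2.
  apply: (@leq_trans ((2 * 'C(m./2.*2, m./2)) ^ 2 * m./2.*2.+1)).
    by rewrite leq_mul2r leq_exp2r//; apply/orP; right; lia.
  by rewrite expnMn -mulnA leq_mul2l c.
rewrite add0n e4.
apply: leq_trans (H m./2 j); rewrite leq_mul2l; apply/orP; right; exact: leqnSn.
Qed.

End central_binomial.

Section rademacher.
Variables (R : realType) (d : nat).
Implicit Types (ls : seq 'cV[R]_d) (g h : 'cV[R]_d -> R) (x l : 'cV[R]_d).

(* Expectation of g at x plus the sum of the vectors of ls with independent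
   uniform signs. *)
Fixpoint rad ls g x : R :=
  if ls is l :: ls' then (rad ls' g (x + l) + rad ls' g (x - l)) / 2 else g x.

Lemma rad_le ls g h x : (forall y, g y <= h y) -> rad ls g x <= rad ls h x.
Proof.
move=> gh; elim: ls x => [//|l ls IH] x /=.
by have := IH (x + l); have := IH (x - l); lra.
Qed.

Lemma eq_rad ls g h x : g =1 h -> rad ls g x = rad ls h x.
Proof. by move=> gh; elim: ls x => [//|l ls IH] x /=; rewrite !IH. Qed.

Lemma rad_cst ls c x : rad ls (fun=> c) x = c.
Proof. by elim: ls x => [//|l ls IH] x /=; rewrite !IH; field. Qed.

Lemma radD ls g h x : rad ls (fun y => g y + h y) x = rad ls g x + rad ls h x.
Proof. by elim: ls x => [//|l ls IH] x /=; rewrite !IH; field. Qed.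

Lemma radZ ls a g x : rad ls (fun y => a * g y) x = a * rad ls g x.
Proof. by elim: ls x => [//|l ls IH] x /=; rewrite !IH; field. Qed.

Lemma rad_cat ls1 ls2 g x : rad (ls1 ++ ls2) g x = rad ls1 (rad ls2 g) x.
Proof. by elim: ls1 x => [//|l ls IH] x /=; rewrite !IH. Qed.

Lemma rad_rem ls l g x : l \in ls -> rad ls g x = rad (l :: rem l ls) g x.
Proof.
elim: ls x => [//|k ls IH] x; rewrite inE; have [->|lk] := eqVneq l k.
  by move=> _; rewrite /= eqxx.
move=> /= lin; rewrite eq_sym (negbTE lk) !IH//=.
rewrite (addrAC x k l) (addrAC x l (- k)) (addrAC x k (- l)) (addrAC x (- k) (- l)).
ring.
Qed.

Lemma rad_perm ls1 ls2 g x : perm_eq ls1 ls2 -> rad ls1 g x = rad ls2 g x.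
Proof.
elim: ls1 ls2 x => [|l ls IH] ls2 x.
  by rewrite perm_sym => /perm_nilP ->.
move=> p; have lin : l \in ls2 by rewrite -(perm_mem p) mem_head.
rewrite (rad_rem g x lin) /= !(IH (rem l ls2))//.
all: by rewrite -(perm_cons l) (permPl p) perm_to_rem.
Qed.

Lemma nsqDcV x l : nsq (x + l) = nsq x + 2 * (x^T *m l) 0 0 + nsq l.
Proof.
rewrite !nsq_cVE mxE mulr_sumr -!big_split/=; apply: eq_bigr => i _.
rewrite !mxE; ring.
Qed.

Lemma nsq_parallelogram x l : nsq (x + l) + nsq (x - l) = 2 * nsq x + 2 * nsq l.
Proof.
have e : (x^T *m - l) 0 0 = - (x^T *m l) 0 0 by rewrite mulmxN mxE.
by rewrite !nsqDcV nsqN e; ring.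
 Qed.

Lemma rad_nsq ls x : rad ls (@nsq R d 1) x = nsq x + \sum_(l <- ls) nsq l.
Proof.
elim: ls x => [|l ls IH] x /=; first by rewrite big_nil addr0.
by rewrite !IH big_cons; have := nsq_parallelogram x l; lra.
Qed.

(** With [j] plus signs among [m] the walk stands at [x + (2j - m) l]; the induction is Pascal's
    rule. *)
Lemma rad_nseq m l g x : rad (nseq m l) g x =
  (\sum_(j < m.+1) 'C(m, j)%:R * g (x - m%:R *: l + (2 * j%:R) *: l)) / 2 ^+ m.
Proof.
elim: m x => [|m IH] x.
  by rewrite big_ord1 /= scale0r subr0 mulr0 scale0r addr0 bin0 mul1r expr0 divr1.
pose F j := g (x - m.+1%:R *: l + (2 * j%:R) *: l).
rewrite [LHS]/= !IH.
rewrite (eq_bigr (fun j : 'I_m.+1 => 'C(m, j)%:R * F j.+1)); last first.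
  move=> j _; rewrite /F; congr (_ * g _); apply/matrixP => a b; rewrite !mxE.
  by rewrite -!natr1; ring.
rewrite [X in (_ + X / _) / _](eq_bigr (fun j : 'I_m.+1 => 'C(m, j)%:R * F j)); last first.
  move=> j _; rewrite /F; congr (_ * g _); apply/matrixP => a b; rewrite !mxE.
  by rewrite -!natr1; ring.
rewrite [in RHS]big_ord_recl bin0 /=.
rewrite [in RHS](eq_bigr (fun j : 'I_m.+1 => 'C(m, j.+1)%:R * F j.+1 + 'C(m, j)%:R * F j.+1)); last first.
  by move=> j _; rewrite (_ : bump 0 j = j.+1)// binS natrD mulrDl.
rewrite big_split/=.
have -> : \sum_(j < m.+1) 'C(m, j)%:R * F j = F 0%N + \sum_(j < m.+1) 'C(m, j.+1)%:R * F j.+1.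
  rewrite [in RHS]big_ord_recr/= bin_small// mul0r addr0 big_ord_recl bin0 mul1r.
  by congr (_ + _).
rewrite -/(F 0%N) exprS; field.
by rewrite expf_neq0.
Qed.

Lemma card_le_diam n (A : {set 'I_n}) (D : nat) :
  (forall i j, i \in A -> j \in A -> (i <= j)%N -> (j - i <= D)%N) ->
  (#|A| <= D.+1)%N.
Proof.
move=> AD; have [->|[i0 iA]] := set_0Vmem A; first by rewrite cards0.
case: (@arg_minnP _ i0 (mem A) (fun i => i : nat) iA) => i iA' imin.
rewrite cardE -(size_map val) -[D.+1](size_iota i).
apply: uniq_leq_size; first by rewrite (map_inj_uniq val_inj) enum_uniq.
move=> k /mapP[j]; rewrite mem_enum => jA ->; rewrite mem_iota.
by have := imin _ jA; have := AD _ _ iA' jA (imin _ jA); rewrite /=; lia.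
Qed.

(** Along a line the squared norm is a parabola, with vertex at [- b]. On either side of the vertex
    two values differ by at least [nsq l] times the squared distance of the indices, so the indices
    landing in the annulus lie within [D] of one another; the two sides give the factor 2. *)
Lemma card_annulus n x l (t delta : R) (D : nat) : 0 < nsq l ->
  delta <= nsq l * D%:R ^+ 2 ->
  (#|[set j : 'I_n | (t < nsq (x + j%:R *: l) <= t + delta)%R]%SET| <= 2 * D.+1)%N.
Proof.
move=> l0 dD; set b := (x^T *m l) 0 0 / nsq l.
have e (s : R) : nsq (x + s *: l) = nsq l * (s + b) ^+ 2 + (nsq x - nsq l * b ^+ 2).
  have e1 : (x^T *m (s *: l)) 0 0 = s * (x^T *m l) 0 0 by rewrite -scalemxAr mxE.
  rewrite nsqDcV nsqZ e1 /b; field.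
  by rewrite gt_eqF.
pose A1 := [set j : 'I_n | (t < nsq (x + j%:R *: l) <= t + delta) && (0 <= j%:R + b)]%SET.
pose A2 := [set j : 'I_n | (t < nsq (x + j%:R *: l) <= t + delta) && (j%:R + b < 0)]%SET.
have -> : [set j : 'I_n | t < nsq (x + j%:R *: l) <= t + delta]%SET = A1 :|: A2.
  by apply/setP => j; rewrite !inE -andb_orr; case: (leP 0 (j%:R + b)); rewrite /= ?andbT.
apply: (leq_trans (leq_card_setU _ _)); rewrite mul2n -addnn.
have key (i j : 'I_n) : (i <= j)%N ->
   nsq l * (j%:R - i%:R) ^+ 2 < delta -> (j - i <= D)%N.
  move=> ij h; have : nsq l * (j - i)%:R ^+ 2 < nsq l * D%:R ^+ 2.
    by rewrite natrB//; apply: lt_le_trans h dD.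
  by rewrite ltr_pM2l// ltr_sqr ?nnegrE// ltr_nat => /ltnW.
apply: leq_add; apply: card_le_diam => i j; rewrite !inE !e => /andP[/andP[i1 i2] i3] /andP[/andP[j1 j2] j3] ij.
- apply: key => //; have ijR : (i%:R : R) <= j%:R by rewrite ler_nat.
  have : (j%:R - i%:R) ^+ 2 <= (j%:R + b) ^+ 2 - (i%:R + b) ^+ 2 by nra.
  nra.
- apply: key => //; have ijR : (i%:R : R) <= j%:R by rewrite ler_nat.
  have : (j%:R - i%:R) ^+ 2 <= (i%:R + b) ^+ 2 - (j%:R + b) ^+ 2 by nra.
  nra.
Qed.

Lemma rad_annulus_le m l x t delta : (0 < m)%N -> 0 < nsq l -> 0 <= delta ->
  rad (nseq m ((Num.sqrt m%:R)^-1 *: l)) (fun y => (t < nsq y <= t + delta)%R%:R) x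
  <= Num.sqrt (delta / nsq l) + 4 / Num.sqrt m%:R.
Proof.
move=> m0 l0 d0; set c := (Num.sqrt m%:R)^-1.
have sm : 0 < Num.sqrt (m%:R : R) by rewrite sqrtr_gt0 ltr0n.
have smm : Num.sqrt (m%:R : R) ^+ 2 = m%:R by rewrite sqr_sqrtr.
have c0 : 0 < c by rewrite invr_gt0.
(* [r] steps of the walk, each of length [2 |l| / sqrt m], cover [sqrt delta]. The annulus then
   contains at most [2 (r + 2)] positions, each of probability at most [1 / sqrt m]. *)
pose r := Num.sqrt (delta / nsq l) * Num.sqrt m%:R / 2.
have r0 : 0 <= r by rewrite /r !mulr_ge0// ?sqrtr_ge0// invr_ge0.
pose D := (Num.truncn r).+1.
have rD : r <= D%:R by rewrite ltW// truncnS_gt.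
have Dr : D%:R <= r + 1 by rewrite /D -natr1 lerD2r truncn_le.
have cnt : (#|[set j : 'I_m.+1 | (t < nsq (x - m%:R *: (c *: l) + j%:R *: (2%:R *: (c *: l)))
     <= t + delta)%R]%SET| <= 2 * D.+1)%N.
  apply: card_annulus; first by rewrite !nsqZ !mulr_gt0// exprn_gt0.
  apply: (@le_trans _ _ (nsq (2%:R *: (c *: l)) * r ^+ 2)); last first.
    by apply: ler_wpM2l; [exact: nsq_ge0|rewrite ler_sqr ?nnegrE].
  rewrite !nsqZ /r !exprMn sqr_sqrtr; last by rewrite divr_ge0// ltW.
  rewrite smm /c exprVn smm le_eqVlt.
  apply/orP; left; apply/eqP; field.
  by rewrite (gt_eqF l0) pnatr_eq0 -lt0n m0.
rewrite rad_nseq.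
have b1 (j : nat) : 'C(m, j)%:R / 2 ^+ m <= (Num.sqrt (m%:R : R))^-1.
  rewrite ler_pdivrMr ?exprn_gt0// mulrC ler_pdivlMr//.
  rewrite -ler_sqr ?nnegrE ?mulr_ge0 ?exprn_ge0 ?(ltW sm)// exprMn smm.
  by rewrite -exprM mulnC exprM -!natrX -natrM ler_nat bin_sqr_le.
apply: (@le_trans _ _ (\sum_(j < m.+1)
   (Num.sqrt (m%:R : R))^-1 * (t < nsq (x - m%:R *: (c *: l) + j%:R *: (2%:R *: (c *: l)))
     <= t + delta)%R%:R)).
  rewrite mulr_suml; apply: ler_sum => j _.
  rewrite mulrAC; apply: ler_pM => //.
  by rewrite [j%:R *: (2 *: _)]scalerA (mulrC j%:R).
rewrite -mulr_sumr -natr_sum.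
rewrite (_ : (\sum_(i < m.+1) _)%N = #|[set j : 'I_m.+1 | (t < nsq (x - m%:R *: (c *: l) +
    j%:R *: (2%:R *: (c *: l))) <= t + delta)%R]%SET|); last first.
  by rewrite -sum1dep_card [RHS]big_mkcond /=; apply: eq_bigr => i _;
    set b := (_ < _ <= _); case: b.
rewrite mulrC.
apply: (@le_trans _ _ ((2 * (r + 2)) / Num.sqrt m%:R)).
  apply: ler_wpM2r; first by rewrite ltW.
  apply: (@le_trans _ _ (2 * D.+1)%:R); first by rewrite ler_nat.
  by rewrite natrM -natr1 ler_pM2l//; lra.
rewrite le_eqVlt; apply/orP; left; apply/eqP; rewrite /r /c; field.
by rewrite gt_eqF.
Qed.

(* The m-fold normalized sum of random sign combinations of ls; its law
   approximates the centered Gaussian with covariance sum_l l l^T. *)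
Definition radseq ls m := flatten (nseq m (map ( *:%R (Num.sqrt m%:R)^-1) ls)).

Definition radF ls m t : R := rad (radseq ls m) (fun y => (nsq y <= t)%R%:R) 0.

Lemma radF_le ls m s t : s <= t -> radF ls m s <= radF ls m t.
Proof.
move=> st; apply: rad_le => y; rewrite ler_nat.
by case: (leP (nsq y) s) => // h; rewrite (le_trans h st).
Qed.

Lemma radF_lt0 ls m t : t < 0 -> radF ls m t = 0.
Proof.
move=> t0; rewrite -[RHS](rad_cst (radseq ls m) 0 0); apply: eq_rad => y.
by rewrite leNgt (lt_le_trans t0)// nsq_ge0.
Qed.

Lemma perm_flatten_nseq (T : eqType) (l : T) (s : seq T) m : l \in s ->
  perm_eq (flatten (nseq m s)) (flatten (nseq m (rem l s)) ++ nseq m l).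
Proof.
move=> lin; elim: m => [//|m IH] /=.
apply/permP => a; rewrite !count_cat.
have /permP -> := perm_to_rem lin; have /permP -> := IH.
by rewrite count_cat /=; lia.
Qed.

(** Sums are invariant under permutation, so the signs of the copies of [l] may be drawn last. They
    form a walk from an arbitrary starting point, and the bound of [rad_annulus_le] does not depend
    on that point. *)
Lemma radF_anti ls l m t delta : (0 < m)%N -> l \in ls -> l != 0 -> 0 <= delta ->
  radF ls m (t + delta) - radF ls m t <= Num.sqrt (delta / nsq l) + 4 / Num.sqrt m%:R.
Proof.
move=> m0 lin l0 d0.
have nl : 0 < nsq l.
  by rewrite lt_def nsq_ge0 andbT; apply: contra_neq l0; exact: nsq_eq0.
have -> : radF ls m (t + delta) - radF ls m t =
   rad (radseq ls m) (fun y => (t < nsq y <= t + delta)%R%:R) 0.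
  apply/eqP; rewrite subr_eq -radD; apply/eqP; apply: eq_rad => y.
  case: (leP (nsq y) t) => [h|h]; rewrite /= ?add0r ?addr0//.
  by rewrite (le_trans h)// lerDl.
have lin' : (Num.sqrt m%:R)^-1 *: l \in map ( *:%R (Num.sqrt m%:R)^-1) ls by apply: map_f.
rewrite (rad_perm _ _ (perm_flatten_nseq m lin')) rad_cat.
apply: le_trans (rad_le _ _ (fun y => rad_annulus_le y t m0 nl d0)) _.
by rewrite rad_cst.
Qed.

(** Markov's inequality: by the parallelogram identity the mean of the squared norm is the same for
    all [m]. *)
Lemma radF_tail ls m t : (0 < m)%N -> 0 < t ->
  1 - (\sum_(l <- ls) nsq l) / t <= radF ls m t.
Proof.
move=> m0 t0.
have -> : \sum_(l <- ls) nsq l = rad (radseq ls m) (@nsq R d 1) 0.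
  rewrite rad_nsq nsq0 add0r /radseq big_flatten big_nseq/=.
  rewrite iter_addr_0 big_map [in RHS](eq_bigr (fun l => m%:R^-1 * nsq l)).
    by rewrite -mulr_sumr -[RHS]mulr_natl mulrA mulfV ?mul1r// pnatr_eq0 -lt0n.
  by move=> l _; rewrite nsqZ exprVn sqr_sqrtr.
rewrite -(rad_cst (radseq ls m) 1 0) mulrC -mulNr -radZ -radD.
apply: rad_le => y; case: (leP (nsq y) t) => h /=.
  by rewrite mulNr gerBl mulr_ge0 ?nsq_ge0// invr_ge0 ltW.
by rewrite mulNr subr_le0 mulrC ler_pdivlMr// mul1r ltW.
Qed.

(** Walk along the grid of mesh [delta]: each step raises the distribution function by at most
    [eta], so the first grid point where it reaches [p] does not overshoot [p + eta]. Only the point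
    [t] depends on [m]; [K], [delta] and [M] are fixed beforehand. *)
Lemma radF_quantile ls l p eta : l \in ls -> l != 0 -> 0 < p < 1 -> 0 < eta ->
  exists K delta : R, exists M : nat,
    [/\ 0 < K, 0 < delta, (0 < M)%N,
     (forall m t, (M <= m)%N -> radF ls m (t + delta) <= radF ls m t + eta) &
     (forall m, (M <= m)%N -> exists t, [/\ 0 <= t, t <= K & p <= radF ls m t <= p + eta])].
Proof.
move=> lin l0 /andP[p0 p1] e0.
have nl : 0 < nsq l.
  by rewrite lt_def nsq_ge0 andbT; apply: contra_neq l0; exact: nsq_eq0.
(* This makes the first term of [radF_anti] equal to [eta / 2]; the choice of [M] brings the second
   one, [4 / sqrt m], below [eta / 2]. *)
pose delta := nsq l * (eta / 2) ^+ 2.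
have d0 : 0 < delta by rewrite mulr_gt0// exprn_gt0// divr_gt0.
pose M := (Num.truncn ((8 / eta) ^+ 2)).+1.
have anti m t : (M <= m)%N -> radF ls m (t + delta) <= radF ls m t + eta.
  move=> Mm; have m0 : (0 < m)%N by apply: leq_trans Mm.
  have := radF_anti t m0 lin l0 (ltW d0).
  rewrite {3}/delta mulrAC mulfV ?gt_eqF// mul1r sqrtr_sqr ger0_norm; last by rewrite divr_ge0// ltW.
  have : 4 / Num.sqrt m%:R <= eta / 2.
    have sm : 0 < Num.sqrt (m%:R : R) by rewrite sqrtr_gt0 ltr0n.
    rewrite ler_pdivrMr//.
    have : 8 / eta <= Num.sqrt m%:R.
      rewrite -(ler_sqr) ?nnegrE ?divr_ge0 ?sqrtr_ge0 ?(ltW e0)// sqr_sqrtr//.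
      by rewrite (le_trans (ltW (truncnS_gt _)))// ler_nat.
    by rewrite ler_pdivrMr//; lra.
  lra.
pose s := \sum_(l <- ls) nsq l.
have s0 : 0 <= s by apply: sumr_ge0 => *; exact: nsq_ge0.
(* After so many grid steps [radF_tail] guarantees the level [p], for every [m]. *)
pose J := (Num.truncn (s / ((1 - p) * delta))).+1.
have J0 : 0 < J%:R * delta by rewrite mulr_gt0// ltr0n.
exists (J%:R * delta), delta, M; split => // m Mm.
have m0 : (0 < m)%N by apply: leq_trans Mm.
have hJ : p <= radF ls m (J%:R * delta).
  apply: le_trans (radF_tail ls m0 J0); rewrite -/s.
  have : s / (J%:R * delta) <= 1 - p.
    rewrite ler_pdivrMr//; have := ltW (truncnS_gt (s / ((1 - p) * delta))).
    rewrite -/J ler_pdivrMr ?mulr_gt0 ?subr_gt0//; lra.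
  lra.
have ex : exists j, p <= radF ls m (j%:R * delta) by exists J.
case: (ex_minnP ex) => j hj jmin.
exists (j%:R * delta); split.
- by rewrite mulr_ge0// ltW.
- by rewrite ler_pM2r// ler_nat jmin.
rewrite hj /=; case: j hj jmin => [|j] hj jmin.
  (* At the origin of the grid the preceding point is [- delta], where the distribution function is
     0. *)
  have := anti m (- delta) Mm; rewrite mul0r addNr (@radF_lt0 _ _ (- delta)) ?oppr_lt0//.
  lra.
have : radF ls m (j%:R * delta) < p.
  by rewrite ltNge; apply/negP => /jmin; rewrite ltnn.
have := anti m (j%:R * delta) Mm; rewrite -natr1 mulrDl mul1r; lra.
Qed.

End rademacher.

(** * Smooth indicators of balls *)

Section spline.
Variable R : realType.
Implicit Types x h r : R.

Definition pospart x : R := Num.max x 0.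

Lemma pospart_ge0 x : 0 <= pospart x.
Proof. by rewrite /pospart le_max lexx orbT. Qed.

Lemma pospartE x : 0 <= x -> pospart x = x.
Proof. by move=> x0; rewrite /pospart max_l. Qed.

Lemma pospart0 x : x <= 0 -> pospart x = 0.
Proof. by move=> x0; rewrite /pospart max_r. Qed.

(** The second derivative of this cube is Lipschitz across 0. When [x] and [x + h] have opposite
    signs, the remainder is controlled by the cube of an overshoot no longer than [|h|]. *)
Lemma pospart_cube x h :
  `|pospart (x + h) ^+ 3 - (pospart x ^+ 3 + 3 * pospart x ^+ 2 * h
     + 3 * pospart x * h ^+ 2)| <= `|h| ^+ 3.
Proof.
rewrite -normrX; have [x0|/ltW x0] := leP 0 x; have [y0|/ltW y0] := leP 0 (x + h).
- rewrite !pospartE//.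
  by rewrite (_ : _ - _ = h ^+ 3)//; ring.
- rewrite (pospartE x0) (pospart0 y0).
  rewrite (_ : _ - _ = (- (x + h)) ^+ 3 - (- h) ^+ 3); last by ring.
  have : (- (x + h)) ^+ 3 <= (- h) ^+ 3 by rewrite lerXn2r ?nnegrE//; lra.
  have : 0 <= (- (x + h)) ^+ 3 by rewrite exprn_ge0//; lra.
  rewrite [X in _ -> _ -> _ <= X](_ : _ = `|(- h) ^+ 3|); last by rewrite !normrX normrN.
  move=> a b; rewrite (ler0_norm (x := _ - _)) ?subr_le0//.
  by rewrite ger0_norm; lra.
- rewrite (pospart0 x0) (pospartE y0).
  rewrite (_ : _ - _ = (x + h) ^+ 3); last by ring.
  have h0 : 0 <= h by lra.
  by rewrite !ger0_norm ?exprn_ge0// lerXn2r ?nnegrE//; lra.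
- rewrite (pospart0 x0) (pospart0 y0).
  by rewrite (_ : _ - _ = 0) ?normr0//; ring.
Qed.

(* One minus the distribution function of the cubic B-spline on [0, 3]: a
   smooth step from 1 to 0. *)
Definition step r : R :=
  1 - (pospart r ^+ 3 - 3 * pospart (r - 1) ^+ 3
       + 3 * pospart (r - 2) ^+ 3 - pospart (r - 3) ^+ 3) / 6.

Definition step1 r : R :=
  - (pospart r ^+ 2 - 3 * pospart (r - 1) ^+ 2
       + 3 * pospart (r - 2) ^+ 2 - pospart (r - 3) ^+ 2) / 2.

(* Half of the second derivative of step. *)
Definition step2 r : R :=
  - (pospart r - 3 * pospart (r - 1)
       + 3 * pospart (r - 2) - pospart (r - 3)) / 2.

Lemma step_taylor r h :
  `|step (r + h) - (step r + step1 r * h + step2 r * h ^+ 2)| <= 2 * `|h| ^+ 3.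
Proof.
have := pospart_cube r h; have := pospart_cube (r - 1) h.
have := pospart_cube (r - 2) h; have := pospart_cube (r - 3) h.
rewrite !(addrAC r _ h) !ler_norml /step /step1 /step2.
have : 0 <= `|h| ^+ 3 by rewrite exprn_ge0.
move=> h0 /andP[a1 b1] /andP[a2 b2] /andP[a3 b3] /andP[a4 b4].
apply/andP; split; lra.
Qed.

Lemma step_cases r : r <= 0 \/ 0 <= r <= 1 \/ 1 <= r <= 2 \/ 2 <= r <= 3 \/ 3 <= r.
Proof. lra. Qed.

Lemma step_le0 r : r <= 0 -> step r = 1.
Proof. by move=> r0; rewrite /step !pospart0; lra. Qed.

Lemma step_ge3 r : 3 <= r -> [/\ step r = 0, step1 r = 0 & step2 r = 0].
Proof.
by move=> r3; rewrite /step /step1 /step2 !pospartE; try lra; split; field.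
Qed.

(** Between two knots the spline is a single cubic; a shifted variable in [0, 1] makes the bounds
    linear in its powers. The constant 10 is generous. *)
Lemma step_bounds r : [/\ 0 <= step r <= 1, `|step1 r| <= 10 & `|step2 r| <= 10].
Proof.
rewrite !ler_norml.
have [r0|[/andP[r0 r1]|[/andP[r1 r2]|[/andP[r2 r3]|r3]]]] := step_cases r.
- by rewrite step_le0// /step1 /step2 !pospart0; try lra; split; lra.
- rewrite /step /step1 /step2 pospartE; last lra.
  rewrite !pospart0; try lra.
  have h2 : r ^+ 2 <= 1 by rewrite exprn_ile1.
  have h3 : r ^+ 3 <= 1 by rewrite exprn_ile1.
  have h20 : 0 <= r ^+ 2 by rewrite exprn_ge0.
  have h30 : 0 <= r ^+ 3 by rewrite exprn_ge0.
  by split; apply/andP; split; lra.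
- rewrite /step /step1 /step2 (@pospartE r); last lra.
  rewrite (@pospartE (r - 1)); last lra.
  rewrite !pospart0; try lra.
  have [s [s0 s1 rs]] : exists s, [/\ 0 <= s, s <= 1 & r = s + 1].
    by exists (r - 1); split; lra.
  rewrite rs addrK.
  have h2 : s ^+ 2 <= 1 by rewrite exprn_ile1.
  have h3 : s ^+ 3 <= s ^+ 2 by rewrite exprSr ler_piMr// exprn_ge0.
  have h22 : s ^+ 2 <= s by rewrite expr2 ler_piMr.
  have h30 : 0 <= s ^+ 3 by rewrite exprn_ge0.
  (* The product is [1 - 3 s^2 + 2 s^3]; its sign bounds the middle cubic [1 + 3 s + 3 s^2 - 2 s^3]
     by 5, hence by 6. *)
  have h32 : 0 <= (1 - s) ^+ 2 * (1 + 2 * s) by rewrite mulr_ge0 ?sqr_ge0//; lra.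
  by split; apply/andP; split; lra.
- rewrite /step /step1 /step2 (@pospartE r); last lra.
  rewrite (@pospartE (r - 1)); last lra.
  rewrite (@pospartE (r - 2)); last lra.
  rewrite !pospart0; try lra.
  have [s [s0 s1 rs]] : exists s, [/\ 0 <= s, s <= 1 & r = 3 - s].
    by exists (3 - r); split; lra.
  rewrite rs.
  have h2 : s ^+ 2 <= 1 by rewrite exprn_ile1.
  have h3 : s ^+ 3 <= 1 by rewrite exprn_ile1.
  have h20 : 0 <= s ^+ 2 by rewrite exprn_ge0.
  have h30 : 0 <= s ^+ 3 by rewrite exprn_ge0.
  by split; apply/andP; split; lra.
- by have [-> -> ->] := step_ge3 r3; split; lra.
Qed.

End spline.

Section taylor_class.
Variables (R : realType) (d : nat).
Implicit Types (g : 'cV[R]_d -> R) (x v : 'cV[R]_d).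

Definition coord_measurable dT (T : measurableType dT) (S : T -> 'cV[R]_d) : Prop :=
  forall k, measurable_fun [set: T] (fun t => S t k 0).

(** Borel measurability through composition: no sigma-algebra on column vectors has to be fixed, and
    the notion also applies to vectors measurable for a coarser sigma-algebra, such as that of the
    first summands. *)
Definition coord_borel g : Prop :=
  forall dT (T : measurableType dT) (S : T -> 'cV[R]_d),
    coord_measurable S -> measurable_fun [set: T] (g \o S).

(** The test functions of the replacement argument. The coefficients [a] and [b] are existential
    rather than derivatives of [g]: averages of shifted coefficients then serve for the average of
    shifted functions. *)
Definition taylor2 (K : R) g : Prop :=
  exists (a : 'I_d -> 'cV[R]_d -> R) (b : 'I_d -> 'I_d -> 'cV[R]_d -> R),
    [/\ [/\ coord_borel g, forall k, coord_borel (a k) & forall k l, coord_borel (b k l)],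
        [/\ forall x, `|g x| <= K, forall k x, `|a k x| <= K &
            forall k l x, `|b k l x| <= K] &
        forall x v, `|g (x + v) - (g x + \sum_k a k x * v k 0
           + \sum_k \sum_l b k l x * (v k 0 * v l 0))| <= K * frobenius v ^+ 3].

Lemma coord_measurable_shift dT (T : measurableType dT) (S : T -> 'cV[R]_d) l :
  coord_measurable S -> coord_measurable (fun t => S t + l).
Proof.
move=> mS k; apply: (eq_measurable_fun (fun t => S t k 0 + l k 0)).
  by move=> t _; rewrite mxE.
by apply: measurable_funD => //; exact: measurable_cst.
Qed.

Lemma coord_borel_avg g l : coord_borel g ->
  coord_borel (fun x => (g (x + l) + g (x - l)) / 2).
Proof.
move=> mg dT T S mS; apply: measurable_funM; last exact: measurable_cst.
apply: measurable_funD.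
  exact: (mg _ _ _ (coord_measurable_shift l mS)).
exact: (mg _ _ _ (coord_measurable_shift (- l) mS)).
Qed.

Lemma taylor2_avg K g l : taylor2 K g ->
  taylor2 K (fun x => (g (x + l) + g (x - l)) / 2).
Proof.
have nrm (p q : R) : `|p| <= K -> `|q| <= K -> `|(p + q) / 2| <= K.
  move=> p1 q1; rewrite normrM (ger0_norm (x := 2^-1)) ?invr_ge0//.
  by have := ler_normD p q; lra.
move=> [a [b [[mg ma mb] [bg ba bb] tay]]].
exists (fun k x => (a k (x + l) + a k (x - l)) / 2),
  (fun k j x => (b k j (x + l) + b k j (x - l)) / 2); split.
- by split=> *; apply: coord_borel_avg.
- by split=> *; apply: nrm.
move=> x v.
have e1 : \sum_k (a k (x + l) + a k (x - l)) / 2 * v k 0 =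
  (\sum_k a k (x + l) * v k 0 + \sum_k a k (x - l) * v k 0) / 2.
  by rewrite -big_split/= mulr_suml; apply: eq_bigr => k _; field.
have e2 : \sum_k \sum_j (b k j (x + l) + b k j (x - l)) / 2 * (v k 0 * v j 0) =
  (\sum_k \sum_j b k j (x + l) * (v k 0 * v j 0) +
   \sum_k \sum_j b k j (x - l) * (v k 0 * v j 0)) / 2.
  rewrite -big_split/= mulr_suml; apply: eq_bigr => k _.
  by rewrite -big_split/= mulr_suml; apply: eq_bigr => j _; field.
have := tay (x + l) v; have := tay (x - l) v.
rewrite e1 e2 (addrAC x v l) (addrAC x v (- l)) !ler_norml.
by move=> /andP[p1 p2] /andP[p3 p4]; apply/andP; split; lra.
Qed.

(** The constant stays [K], so a function already averaged over later signs is as good a test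
    function as the original one, however many signs there are. *)
Lemma taylor2_rad K g ls : taylor2 K g -> taylor2 K (rad ls g).
Proof. by move=> tg; elim: ls => [//|l ls IH]; exact: taylor2_avg. Qed.

Lemma measurable_pospart dT (T : measurableType dT) (f : T -> R) :
  measurable_fun [set: T] f -> measurable_fun [set: T] (fun t => pospart (f t)).
Proof. by move=> mf; apply: measurable_maxr => //; exact: measurable_cst. Qed.

Lemma measurable_step dT (T : measurableType dT) (f : T -> R) :
  measurable_fun [set: T] f ->
  [/\ measurable_fun [set: T] (fun t => step (f t)),
      measurable_fun [set: T] (fun t => step1 (f t)) &
      measurable_fun [set: T] (fun t => step2 (f t))].
Proof.
move=> mf.
have m c : measurable_fun [set: T] (fun t => pospart (f t - c)).
  by apply: measurable_pospart; apply: measurable_funB => //; exact: measurable_cst.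
have m0 := measurable_pospart mf.
have mX k c : measurable_fun [set: T] (fun t => pospart (f t - c) ^+ k).
  exact: measurable_funX.
have mX0 k : measurable_fun [set: T] (fun t => pospart (f t) ^+ k) by exact: measurable_funX.
have m3 (u : T -> R) : measurable_fun [set: T] u -> measurable_fun [set: T] (fun t => 3 * u t).
  by move=> mu; apply: measurable_funM => //; exact: measurable_cst.
have comb (u0 u1 u2 u3 : T -> R) c : measurable_fun [set: T] u0 -> measurable_fun [set: T] u1 ->
    measurable_fun [set: T] u2 -> measurable_fun [set: T] u3 ->
    measurable_fun [set: T] (fun t => (u0 t - 3 * u1 t + 3 * u2 t - u3 t) * c).
  move=> v0 /m3 v1 /m3 v2 v3; apply: measurable_funM; last exact: measurable_cst.
  apply: measurable_funB v3; apply: measurable_funD v2; exact: measurable_funB.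
have mN (u : T -> R) c : measurable_fun [set: T] (fun t => u t * c) ->
    measurable_fun [set: T] (fun t => - u t * c).
  by move=> mu; under eq_fun do rewrite mulNr; exact: measurableT_comp.
split.
- by apply: measurable_funB; [exact: measurable_cst|apply: comb].
- by apply: mN; apply: comb.
- by apply: mN; apply: comb.
Qed.

Lemma coord_borel_nsq : coord_borel (@nsq R d 1).
Proof.
move=> dT T S mS; apply: (eq_measurable_fun (fun t => \sum_i S t i 0 ^+ 2)).
  by move=> t _; rewrite /= nsq_cVE.
by apply: measurable_sum => i; apply: measurable_funX.
Qed.

(** It lies between the indicators of the balls [nsq x <= t] and [nsq x <= t + 3 delta], 3 being the
    width of the spline. *)
Definition ball_step (t delta : R) x : R := step ((nsq x - t) / delta).

Lemma abs_dot_le x v : `|(x^T *m v) 0 0| <= frobenius x * frobenius v.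
Proof.
rewrite -ler_sqr ?nnegrE ?mulr_ge0 ?frobenius_ge0// exprMn !frobenius_sqr.
by rewrite real_normK ?num_real// sqr_dot_le.
Qed.

Lemma entry_le_frobenius x k : `|x k 0| <= frobenius x.
Proof.
rewrite -ler_sqr ?nnegrE ?frobenius_ge0// frobenius_sqr real_normK ?num_real//.
exact: nsq_entry.
Qed.

Lemma ball_step_ge t delta x : 0 < delta -> (nsq x <= t)%R%:R <= ball_step t delta x.
Proof.
move=> d0; rewrite /ball_step; case: (leP (nsq x) t) => h /=.
  by rewrite step_le0// pmulr_lle0 ?invr_gt0// subr_le0.
by have [/andP[]] := step_bounds ((nsq x - t) / delta).
Qed.

Lemma ball_step_le t delta x : 0 < delta ->
  ball_step t delta x <= (nsq x <= t + 3 * delta)%R%:R.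
Proof.
move=> d0; rewrite /ball_step; case: (leP (nsq x) (t + 3 * delta)) => h /=.
  by have [/andP[]] := step_bounds ((nsq x - t) / delta).
have [-> _ _] : [/\ step ((nsq x - t) / delta) = 0, step1 ((nsq x - t) / delta) = 0 &
    step2 ((nsq x - t) / delta) = 0].
  by apply: step_ge3; rewrite ler_pdivlMr//; lra.
by [].
Qed.

(** The gradient of [nsq] is unbounded, but the derivatives of [step] vanish beyond 3, so that all
    coefficients live in one ball, the same for every [t <= K]. This uniformity admits thresholds
    that move with [m]. *)
Lemma taylor2_ball_step (K delta : R) : 0 <= K -> 0 < delta ->
  exists2 C, 0 <= C & forall t, t <= K -> taylor2 C (ball_step t delta).
Proof.
(* [M^2 >= K + 3 delta], so the step has reached 0 outside radius [M]. Below, [N = M + 1] leaves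
   room for increments shorter than 1, [L] bounds [|h| / rho] for such increments inside radius [N],
   and [C] adds up the bounds of all the cases. *)
move=> K0 d0; pose M := K + 3 * delta + 1.
have M1 : 1 <= M by rewrite /M; lra.
have MM : K + 3 * delta <= M ^+ 2 by rewrite /M; nra.
pose D := delta^-1.
have D0 : 0 < D by rewrite invr_gt0.
pose N := M + 1.
pose L := (2 * N + 1) * D.
have N0 : 0 < N by rewrite /N; lra.
have MN : M <= N by rewrite /N lerDl.
have L0 : 0 < L by rewrite mulr_gt0//; lra.
pose C := 1 + 10 * L + 40 * (N * D) ^+ 2 + 2 * L ^+ 3 + 10 * (4 * N + 1) * D ^+ 2.
have q0 : 0 <= (N * D) ^+ 2 by rewrite exprn_ge0// mulr_ge0// ltW.
have q1 : 0 <= L ^+ 3 by rewrite exprn_ge0// ltW.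
have q2 : 0 <= (4 * N + 1) * D ^+ 2 by rewrite mulr_ge0// ?exprn_ge0 ?(ltW D0)//; lra.
have C0 : 1 <= C by rewrite /C; lra.
exists C; first by lra.
move=> t tK.
pose r x := (nsq x - t) / delta.
have frN x : step1 (r x) != 0 \/ step2 (r x) != 0 -> frobenius x <= M.
  move=> h; rewrite leNgt; apply/negP => Mx.
  have [_ s1 s2] : [/\ step (r x) = 0, step1 (r x) = 0 & step2 (r x) = 0].
    apply: step_ge3; rewrite /r ler_pdivlMr// -frobenius_sqr.
    have : M ^+ 2 < frobenius x ^+ 2 by rewrite ltr_sqr ?nnegrE ?frobenius_ge0//; lra.
    lra.
  by rewrite s1 s2 !eqxx in h; case: h.
have b1 x : `|step1 (r x)| <= 10 by have [] := step_bounds (r x).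
have b2 x : `|step2 (r x)| <= 10 by have [] := step_bounds (r x).
have s1M x (y B : R) : (frobenius x <= M -> `|y| <= B) -> 0 <= B ->
    `|step1 (r x) * y| <= 10 * B.
  move=> hy B0; have [->|n0] := eqVneq (step1 (r x)) 0.
    by rewrite mul0r normr0; lra.
  by rewrite normrM ler_pM// hy// frN//; left.
have s2M x (y B : R) : (frobenius x <= M -> `|y| <= B) -> 0 <= B ->
    `|step2 (r x) * y| <= 10 * B.
  move=> hy B0; have [->|n0] := eqVneq (step2 (r x)) 0.
    by rewrite mul0r normr0; lra.
  by rewrite normrM ler_pM// hy// frN//; right.
exists (fun k x => step1 (r x) * (2 * x k 0 * D)),
  (fun k l x => step1 (r x) * ((k == l)%:R * D) + step2 (r x) * (4 * (x k 0 * x l 0) * D ^+ 2)).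
split.
- have mr dT (T : measurableType dT) (S : T -> 'cV[R]_d) : coord_measurable S ->
      measurable_fun [set: T] (fun y => r (S y)).
    move=> mS; apply: measurable_funM; last exact: measurable_cst.
    by apply: measurable_funB; [exact: coord_borel_nsq|exact: measurable_cst].
  split.
  + by move=> dT T S mS; have [] := measurable_step (mr _ _ _ mS).
  + move=> k dT T S mS; have [_ m1 _] := measurable_step (mr _ _ _ mS).
    apply: measurable_funM => //.
    by repeat (apply: measurable_funM => //; try exact: measurable_cst).
  + move=> k l dT T S mS; have [_ m1 m2] := measurable_step (mr _ _ _ mS).
    apply: measurable_funD; apply: measurable_funM => //; try exact: measurable_cst.
    by repeat (apply: measurable_funM => //; try exact: measurable_cst).
- split.
  + move=> x; have [/andP[s0 s1] _ _] := step_bounds (r x).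
    by rewrite /ball_step -/(r x) ger0_norm//; lra.
  + move=> k x; apply: (@le_trans _ _ (10 * (2 * N * D))).
      apply: s1M => [xM|]; last by rewrite !mulr_ge0// ltW.
      rewrite !normrM (ger0_norm (ltW D0)) (ger0_norm (x := 2))//.
      rewrite ler_pM2r// ler_pM2l//; have := entry_le_frobenius x k.
      by rewrite /N; lra.
    by rewrite /C /L; nra.
  + move=> k l x; apply: (le_trans (ler_normD _ _)).
    apply: (@le_trans _ _ (10 * D + 10 * (4 * (N * D) ^+ 2))); last first.
      by rewrite /C /L; nra.
    apply: lerD.
      apply: s1M => [_|]; last exact: ltW.
      by case: (k == l); rewrite ?mul1r ?mul0r ?normr0 ?ger0_norm ?(ltW D0).
    apply: s2M => [xM|]; last by rewrite mulr_ge0.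
    rewrite (_ : 4 * (N * D) ^+ 2 = 4 * (N * N) * D ^+ 2); last by ring.
    rewrite normrM (ger0_norm (exprn_ge0 2 (ltW D0))).
    rewrite ler_pM2r ?exprn_gt0// !normrM (ger0_norm (x := 4))// ler_pM2l//.
    have h1 := entry_le_frobenius x k; have h2 := entry_le_frobenius x l.
    by apply: ler_pM => //; [exact: le_trans h1 (le_trans xM MN)|exact: le_trans h2 (le_trans xM MN)].
move=> x v; pose rho := frobenius v; pose y := (x^T *m v) 0 0.
have rho0 : 0 <= rho by exact: frobenius_ge0.
have rho30 : 0 <= rho ^+ 3 by exact: exprn_ge0.
have nv : nsq v = rho ^+ 2 by rewrite frobenius_sqr.
pose h := (2 * y + nsq v) * D.
have rxv : r (x + v) = r x + h by rewrite /r /h nsqDcV -/y /D; ring.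
have e1 : \sum_k step1 (r x) * (2 * x k 0 * D) * v k 0 = step1 (r x) * (2 * y * D).
  rewrite /y mxE mulr_sumr mulr_suml mulr_sumr; apply: eq_bigr => k _.
  by rewrite mxE; ring.
have e2 : \sum_k \sum_l (step1 (r x) * ((k == l)%:R * D) +
     step2 (r x) * (4 * (x k 0 * x l 0) * D ^+ 2)) * (v k 0 * v l 0) =
   step1 (r x) * (nsq v * D) + step2 (r x) * (2 * y * D) ^+ 2.
  under eq_bigr do (under eq_bigr do rewrite mulrDl; rewrite big_split/=).
  rewrite big_split/=; congr (_ + _).
    rewrite nsq_cVE mulr_suml mulr_sumr; apply: eq_bigr => k _.
    rewrite (bigD1 k)//= eqxx big1 => [|l lk]; last first.
      by rewrite eq_sym (negbTE lk) mul0r mulr0 mul0r.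
    by rewrite addr0 /=; ring.
  have -> : (2 * y * D) ^+ 2 = 4 * D ^+ 2 * (y * y) by ring.
  rewrite /y mxE big_distrlr/= mulr_sumr mulr_sumr; apply: eq_bigr => k _.
  by rewrite !mulr_sumr; apply: eq_bigr => l _; rewrite !mxE; ring.
rewrite e1 e2 /ball_step -/(r x) -/(r (x + v)) rxv.
have -> : step (r x) + step1 (r x) * (2 * y * D) +
   (step1 (r x) * (nsq v * D) + step2 (r x) * (2 * y * D) ^+ 2) =
   step (r x) + step1 (r x) * h + step2 (r x) * (2 * y * D) ^+ 2 by rewrite /h; ring.
have yle : `|y| <= frobenius x * rho by exact: abs_dot_le.
have hle B : frobenius x <= B -> 0 <= B -> `|h| <= (2 * B * rho + rho ^+ 2) * D.
  move=> xB B0; rewrite /h normrM (ger0_norm (ltW D0)) ler_pM2r//.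
  apply: (le_trans (ler_normD _ _)); rewrite nv normrM.
  rewrite (ger0_norm (x := 2))// (ger0_norm (x := rho ^+ 2)) ?exprn_ge0//.
  have : frobenius x * rho <= B * rho by exact: ler_wpM2r.
  lra.
(* Long increments: no expansion is used, since each term by itself is at most a multiple of
   [rho^3]. *)
have [rho1|rho1] := leP 1 rho.
  have r2 : rho <= rho ^+ 2 by rewrite expr2 ler_peMr.
  have r3 : rho ^+ 2 <= rho ^+ 3 by rewrite [rho ^+ 3]exprSr ler_peMr// exprn_ge0.
  have r30 : 1 <= rho ^+ 3 by exact: exprn_ege1.
  have A1 : `|step (r x + h) - step (r x)| <= 1.
    have [/andP[s0 s1] _ _] := step_bounds (r x).
    have [/andP[s0' s1'] _ _] := step_bounds (r x + h).
    by rewrite ler_norml; clear - d s0 s1 s0' s1'; apply/andP; split; lra.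
  have A2 : `|step1 (r x) * h| <= 10 * (L * rho ^+ 3).
    apply: s1M => [xM|]; last by rewrite mulr_ge0 ?(ltW L0) ?exprn_ge0.
    apply: (le_trans (hle N (le_trans xM MN) (ltW N0))).
    rewrite (_ : L * rho ^+ 3 = (2 * N + 1) * rho ^+ 3 * D); last by rewrite /L; ring.
    by rewrite ler_pM2r//; clear - d r3 N0 rho1 r2; nra.
  have A3 : `|step2 (r x) * (2 * y * D) ^+ 2| <= 10 * (4 * (N * D) ^+ 2 * rho ^+ 3).
    apply: s2M => [xM|]; last by rewrite mulr_ge0// mulr_ge0.
    rewrite normrX !normrM (ger0_norm (ltW D0)) (ger0_norm (x := 2))//.
    rewrite !exprMn.
    have y2 : `|y| ^+ 2 <= N ^+ 2 * rho ^+ 3.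
      apply: (@le_trans _ _ ((N * rho) ^+ 2)).
        rewrite ler_sqr ?nnegrE ?mulr_ge0 ?(ltW N0)//.
        by apply: (le_trans yle); apply: ler_wpM2r => //; exact: le_trans xM MN.
      by rewrite exprMn ler_pM2l// exprn_gt0.
    have D20 : 0 <= D ^+ 2 by rewrite exprn_ge0// ltW.
    have : `|y| ^+ 2 * D ^+ 2 <= N ^+ 2 * rho ^+ 3 * D ^+ 2 by exact: ler_wpM2r.
    lra.
  rewrite (_ : _ - _ = (step (r x + h) - step (r x)) - step1 (r x) * h
     - step2 (r x) * (2 * y * D) ^+ 2); last by ring.
  apply: (le_trans (ler_normB _ _)); apply: (le_trans (lerD (ler_normB _ _) (lexx _))).
  rewrite -/rho /C.
  have : 0 <= L ^+ 3 * rho ^+ 3 by rewrite mulr_ge0.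
  have : 0 <= (4 * N + 1) * D ^+ 2 * rho ^+ 3 by rewrite mulr_ge0.
  lra.
(* Short increments starting outside radius [N]: both [x] and [x + v] lie where the step is 0, and
   every term vanishes. *)
have [xN|xN] := leP (frobenius x) N; last first.
  have big : M ^+ 2 <= nsq (x + v).
    apply: (@le_trans _ _ ((frobenius x - rho) ^+ 2)).
      by rewrite ler_sqr ?nnegrE; rewrite /N in xN; clear - d xN rho1 M1; lra.
    rewrite nsqDcV -/y -frobenius_sqr nv sqrrB.
    by have := yle; rewrite ler_norml => /andP[y1 _]; clear - d y1; lra.
  have [-> _ _] : [/\ step (r x + h) = 0, step1 (r x + h) = 0 & step2 (r x + h) = 0].
    by apply: step_ge3; rewrite -rxv /r ler_pdivlMr//; clear - d big MM tK; lra.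
  have [-> -> ->] : [/\ step (r x) = 0, step1 (r x) = 0 & step2 (r x) = 0].
    apply: step_ge3; rewrite /r ler_pdivlMr// -frobenius_sqr.
    have : M ^+ 2 < frobenius x ^+ 2.
      by rewrite ltr_sqr ?nnegrE ?frobenius_ge0//; [exact: le_lt_trans MN xN|exact: le_trans M1].
    by clear - d MM tK; lra.
  rewrite !mul0r !addr0 subr0 normr0; by apply: mulr_ge0 => //; exact: le_trans C0.
have hL : `|h| <= L * rho.
  apply: (le_trans (hle N xN (ltW N0))).
  rewrite (_ : L * rho = (2 * N + 1) * rho * D); last by rewrite /L; ring.
  by rewrite ler_pM2r//; clear - d rho0 rho1; nra.
(* Expand [step] at [h], then trade [h^2] for [(2 y D)^2]: the difference is [nsq v] times a term of
   order [rho], hence again cubic. *)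
rewrite (_ : _ - _ = (step (r x + h) - (step (r x) + step1 (r x) * h + step2 (r x) * h ^+ 2))
   + step2 (r x) * (nsq v * D * (4 * y * D + nsq v * D))); last by rewrite /h; ring.
apply: (le_trans (ler_normD _ _)).
have T1 : 2 * `|h| ^+ 3 <= 2 * L ^+ 3 * rho ^+ 3.
  rewrite -mulrA ler_pM2l// -exprMn; apply: lerXn2r => //; rewrite nnegrE//.
  by apply: mulr_ge0 => //; exact: ltW.
have T2 : `|step2 (r x) * (nsq v * D * (4 * y * D + nsq v * D))| <=
   10 * ((4 * N + 1) * D ^+ 2 * rho ^+ 3).
  apply: s2M => [_|]; last by rewrite mulr_ge0// exprn_ge0.
  rewrite -mulrDl !normrM (ger0_norm (ltW D0)) (ger0_norm (nsq_ge0 v)) nv.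
  have : `|4 * y + rho ^+ 2| <= (4 * N + 1) * rho.
    apply: (le_trans (ler_normD _ _)).
    rewrite normrM (ger0_norm (x := 4))// (ger0_norm (x := rho ^+ 2)) ?exprn_ge0//.
    have : frobenius x * rho <= N * rho by exact: ler_wpM2r.
    by clear - d yle rho0 rho1; nra.
  move=> h4; rewrite (_ : (4 * N + 1) * D ^+ 2 * rho ^+ 3 =
    (rho ^+ 2 * D) * ((4 * N + 1) * rho * D)); last by ring.
  have rD : 0 <= rho ^+ 2 * D by apply: mulr_ge0; [exact: exprn_ge0|exact: ltW].
  by apply: ler_wpM2l => //; rewrite ler_pM2r.
have := step_taylor (r x) h.
rewrite -/rho /C.
have : 0 <= L * rho ^+ 3 by apply: mulr_ge0 => //; exact: ltW.
have : 0 <= (N * D) ^+ 2 * rho ^+ 3 by apply: mulr_ge0.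
move: T1 T2 rho30; clear; lra.
Qed.

End taylor_class.

(** * Expectation and independence *)

Section expectation.
Context d (T : measurableType d) (R : realType) (P : probability T R).
Implicit Types (f g : T -> R) (b c : T -> bool).

Definition intg f : Prop := P.-integrable [set: T] (EFin \o f).
Definition Ex f : R := \int[P]_t f t.
(** Events are boolean functions, so that inclusions and unions become pointwise inequalities
    between integrands. *)
Definition Pr b : R := Ex (fun t => (b t)%:R).

Lemma intg_meas f : intg f -> measurable_fun [set: T] f.
Proof. by move=> /measurable_int /measurable_EFinP. Qed.

Lemma intg_cst k : intg (fun=> k).
Proof. exact: finite_measure_integrable_cst. Qed.

Lemma eq_intg f g : f =1 g -> intg f -> intg g.
Proof. by move=> /funext ->. Qed.

Lemma eq_Ex f g : f =1 g -> Ex f = Ex g.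
Proof. by move=> /funext ->. Qed.

Lemma intgD f g : intg f -> intg g -> intg (fun t => f t + g t).
Proof. by move=> If Ig; exact: (integrableD measurableT If Ig). Qed.

Lemma intgZ k f : intg f -> intg (fun t => k * f t).
Proof. by move=> If; exact: (integrableZl measurableT k If). Qed.

Lemma intgN f : intg f -> intg (fun t => - f t).
Proof. by move=> /(intgZ (-1)); apply: eq_intg => t; rewrite mulN1r. Qed.

Lemma intgB f g : intg f -> intg g -> intg (fun t => f t - g t).
Proof. by move=> If /intgN; exact: intgD. Qed.

Lemma intg_sum (I : Type) (s : seq I) (F : I -> T -> R) :
  (forall i, intg (F i)) -> intg (fun t => \sum_(i <- s) F i t).
Proof.
move=> IF; elim: s => [|i s IH].
  by apply: eq_intg (intg_cst 0) => t; rewrite big_nil.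
by apply: eq_intg (intgD (IF i) IH) => t; rewrite big_cons.
Qed.

Lemma intg_le f g : measurable_fun [set: T] f -> intg g ->
  (forall t, `|f t| <= g t) -> intg f.
Proof.
move=> mf Ig fg; apply: le_integrable Ig => //; first exact/measurable_EFinP.
move=> t _ /=; rewrite lee_fin (le_trans (fg t))//; exact: ler_norm.
Qed.

Lemma intg_bounded f k : measurable_fun [set: T] f -> (forall t, `|f t| <= k) -> intg f.
Proof. by move=> mf fk; apply: intg_le (intg_cst k) _. Qed.

Lemma Ex_cst k : Ex (fun=> k) = k.
Proof.
rewrite /Ex Rintegral_cst//.
by apply: (etrans (congr1 (fun z => k * fine z) (probability_setT P))); exact: mulr1.
Qed.

Lemma ExD f g : intg f -> intg g -> Ex (fun t => f t + g t) = Ex f + Ex g.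
Proof. by move=> If Ig; exact: RintegralD. Qed.

Lemma ExZ k f : intg f -> Ex (fun t => k * f t) = k * Ex f.
Proof. by move=> If; exact: RintegralZl. Qed.

Lemma ExB f g : intg f -> intg g -> Ex (fun t => f t - g t) = Ex f - Ex g.
Proof. by move=> If Ig; exact: RintegralB. Qed.

Lemma Ex_sum (I : Type) (s : seq I) (F : I -> T -> R) :
  (forall i, intg (F i)) ->
  Ex (fun t => \sum_(i <- s) F i t) = \sum_(i <- s) Ex (F i).
Proof.
move=> IF; elim: s => [|i s IH].
  by rewrite big_nil -[RHS](Ex_cst 0); apply: eq_Ex => t; rewrite big_nil.
rewrite big_cons -IH -ExD//; last exact: intg_sum.
by apply: eq_Ex => t; rewrite big_cons.
Qed.

Lemma Ex_le f g : intg f -> intg g -> (forall t, f t <= g t) -> Ex f <= Ex g.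
Proof. by move=> If Ig fg; apply: le_Rintegral. Qed.

Lemma Ex_ge0 f : (forall t, 0 <= f t) -> 0 <= Ex f.
Proof. by move=> f0; apply: Rintegral_ge0. Qed.

Lemma Ex_norm f k : intg f -> (forall t, `|f t| <= k) -> `|Ex f| <= k.
Proof.
move=> If fk; rewrite -(Ex_cst k) ler_norml; apply/andP; split.
  rewrite -[- _]mulN1r -ExZ; last exact: intg_cst.
  apply: Ex_le => // [|t]; first exact/intgZ/intg_cst.
  by have := fk t; rewrite ler_norml mulN1r => /andP[].
apply: Ex_le => // [|t]; first exact: intg_cst.
exact: le_trans (ler_norm _) (fk t).
Qed.

Lemma measurable_boolR b : measurable_fun [set: T] b ->
  measurable_fun [set: T] (fun t => (b t)%:R : R).
Proof. by move=> mb; apply: (measurableT_comp (f := fun c : bool => c%:R : R)). Qed.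

Lemma intg_bool b : measurable_fun [set: T] b -> intg (fun t => (b t)%:R).
Proof.
move=> mb; apply: (@intg_bounded _ 1); first exact: measurable_boolR.
by move=> t; case: (b t); rewrite ?normr1 ?normr0.
Qed.

Lemma measurable_set_bool b : measurable_fun [set: T] b -> measurable [set t | b t].
Proof.
move=> mb; have := mb measurableT [set true] I; rewrite setTI.
by congr measurable; apply/seteqP; split => t /=.
Qed.

Lemma PrE b : measurable_fun [set: T] b -> P [set t | b t] = (Pr b)%:E.
Proof.
move=> mb; have mA := measurable_set_bool mb.
rewrite /Pr /Ex /Rintegral (eq_integral (fun t => (\1_[set t | b t] t)%:E)); last first.
  move=> t _; rewrite indicE (_ : (t \in [set t | b t]) = b t)//.
  by apply/idP/idP; rewrite inE.
by rewrite integral_indic// setIT fineK// fin_num_measure.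
Qed.

Lemma Pr_markov b f a : measurable_fun [set: T] b -> intg f -> 0 < a ->
  (forall t, 0 <= f t) -> (forall t, b t -> a <= f t) -> Pr b <= Ex f / a.
Proof.
move=> mb If a0 f0 bf; rewrite ler_pdivlMr// mulrC -ExZ; last exact: intg_bool.
apply: Ex_le => // [|t]; first exact/intgZ/intg_bool.
by have := bf t; have := f0 t; case: (b t) => /= ft; rewrite ?mulr1 ?mulr0// => ->.
Qed.

Lemma Ex_Pr_le f b : intg f -> measurable_fun [set: T] b ->
  (forall t, f t <= (b t)%:R) -> Ex f <= Pr b.
Proof. by move=> If mb fb; apply: Ex_le => //; exact: intg_bool. Qed.

Lemma Pr_or3 b b1 b2 : measurable_fun [set: T] b -> measurable_fun [set: T] b1 ->
  measurable_fun [set: T] b2 -> (forall t, b t -> b1 t || b2 t) -> Pr b <= Pr b1 + Pr b2.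
Proof.
move=> mb m1 m2 h; rewrite /Pr -ExD; [|exact: intg_bool..].
apply: Ex_le => [||t]; [exact: intg_bool|by apply: intgD; exact: intg_bool|].
rewrite -natrD ler_nat; have := h t.
by case: (b t) => // /(_ isT); case: (b1 t); case: (b2 t).
Qed.

Definition indep2 (X Y : T -> R) : Prop :=
  forall A B : set R, measurable A -> measurable B ->
    P (X @^-1` A `&` Y @^-1` B) = (P (X @^-1` A) * P (Y @^-1` B))%E.

Lemma indep2_comp (X Y : T -> R) (u v : R -> R) : measurable_fun [set: R] u ->
  measurable_fun [set: R] v -> indep2 X Y -> indep2 (u \o X) (v \o Y).
Proof.
move=> mu mv XY A B mA mB; apply: (XY (u @^-1` A) (v @^-1` B)).
  by rewrite -[_ @^-1` _]setTI; exact: mu.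
by rewrite -[_ @^-1` _]setTI; exact: mv.
Qed.

(** By independence the joint law agrees with the product of the marginals on rectangles, hence
    everywhere; Tonelli's theorem then factors the integral. The absolute values make this the
    integrability criterion for the product as well. *)
Lemma ge0_integralM_indep (X Y : T -> R) : measurable_fun [set: T] X ->
  measurable_fun [set: T] Y -> indep2 X Y ->
  (\int[P]_t `|X t * Y t|%:E = (\int[P]_t `|X t|%:E) * (\int[P]_t `|Y t|%:E))%E.
Proof.
move=> mX mY XY.
pose X' : {RV P >-> R} := HB.pack X (isMeasurableFun.Build _ _ _ _ X mX).
pose Y' : {RV P >-> R} := HB.pack Y (isMeasurableFun.Build _ _ _ _ Y mY).
have mZ : measurable_fun [set: T] (fun t => (X t, Y t)) by exact: measurable_fun_pair.
pose Z' : {mfun T >-> (R * R)%type} :=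
  HB.pack (fun t => (X t, Y t)) (isMeasurableFun.Build _ _ _ _ _ mZ).
pose h (z : R * R) : \bar R := `|z.1 * z.2|%:E.
have mh : measurable_fun [set: (R * R)%type] h.
  apply/measurable_EFinP; apply: measurableT_comp => //.
  by apply: measurable_funM; [exact: measurable_fst|exact: measurable_snd].
have h0 z : (0 <= h z)%E by rewrite lee_fin.
transitivity (\int[distribution P Z']_z h z)%E.
  by rewrite (ge0_integral_distribution (P := P)).
transitivity (\int[distribution P X' \x distribution P Y']_z h z)%E.
  apply: eq_measure_integral => A mA _; apply/esym.
  apply: (product_measure_unique (m1 := distribution P X') (m2 := distribution P Y')
    (m' := distribution P Z')); last exact: mA.
  by move=> B C mB mC; exact: XY.
rewrite fubini_tonelli1//.
transitivity (\int[distribution P X']_x (`|x|%:E * \int[distribution P Y']_y `|y|%:E))%E.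
  apply: eq_integral => x _; rewrite /fubini_F /h /=.
  under eq_integral do rewrite normrM EFinM.
  by rewrite ge0_integralZl_EFin//; apply/measurable_EFinP.
rewrite (ge0_integral_distribution (P := P)); last 2 first.
- by apply: emeasurable_funM; [exact/measurable_EFinP|exact: measurable_cst].
- by move=> y; rewrite mule_ge0// integral_ge0.
transitivity (\int[P]_x ((\int[distribution P Y']_y `|y|%:E) * `|X x|%:E))%E.
  by apply: eq_integral => x _; rewrite /= muleC.
rewrite ge0_integralZl//.
- rewrite [LHS]muleC; congr (_ * _)%E.
  rewrite (ge0_integral_distribution (P := P))//.
  exact/measurable_EFinP.
- by apply/measurable_EFinP; exact: measurableT_comp.
- by apply: integral_ge0 => y _; rewrite lee_fin.
Qed.

Lemma intgM_indep X Y : indep2 X Y -> intg X -> intg Y -> intg (fun t => X t * Y t).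
Proof.
move=> XY IX IY; have mX := intg_meas IX; have mY := intg_meas IY.
apply/integrableP; split.
  by apply/measurable_EFinP; exact: measurable_funM.
rewrite [ltLHS](ge0_integralM_indep mX mY XY).
move/integrableP: IX => [_ IX]; move/integrableP: IY => [_ IY].
by apply: lte_mul_pinfty => //; [exact: integral_ge0|rewrite ge0_fin_numE// integral_ge0].
Qed.

Lemma ge0_ExM_indep X Y : indep2 X Y -> intg X -> intg Y ->
  (forall t, 0 <= X t) -> (forall t, 0 <= Y t) ->
  Ex (fun t => X t * Y t) = Ex X * Ex Y.
Proof.
move=> XY IX IY X0 Y0; have := ge0_integralM_indep (intg_meas IX) (intg_meas IY) XY.
rewrite (eq_integral (fun t => (X t * Y t)%:E)); last first.
  by move=> t _; rewrite ger0_norm// mulr_ge0.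
rewrite (eq_integral (fun t => (X t)%:E) (fun t => `|X t|%:E)); last first.
  by move=> t _; rewrite ger0_norm.
rewrite (eq_integral (fun t => (Y t)%:E) (fun t => `|Y t|%:E)); last first.
  by move=> t _; rewrite ger0_norm.
rewrite /Ex /Rintegral => ->; rewrite fineM//; exact: integrable_fin_num.
Qed.

(** Positive and negative parts are functions of one variable each, so all four products remain
    independent and fall under the nonnegative case. *)
Lemma ExM_indep X Y : indep2 X Y -> intg X -> intg Y ->
  Ex (fun t => X t * Y t) = Ex X * Ex Y.
Proof.
move=> XY IX IY.
have mp : measurable_fun [set: R] (@pospart R) by apply: measurable_pospart.
have mn : measurable_fun [set: R] (fun x => pospart (- x) : R).
  by apply: measurable_pospart; exact: oppr_measurable.
have split (x : R) : x = pospart x - pospart (- x).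
  have [x0|/ltW x0] := leP 0 x.
    by rewrite pospartE// pospart0 ?subr0// oppr_le0.
  by rewrite pospart0// pospartE ?sub0r ?opprK// oppr_ge0.
have Ip Z : intg Z -> intg (fun t => pospart (Z t)).
  move=> IZ; apply: (intg_le (g := fun t => `|Z t|)) => [||t].
  - exact: measurable_pospart (intg_meas IZ).
  - exact: integrable_norm IZ.
  rewrite ger0_norm ?pospart_ge0//; have [z0|/ltW z0] := leP 0 (Z t).
    by rewrite pospartE// ler_norm.
  by rewrite pospart0.
have In Z : intg Z -> intg (fun t => pospart (- Z t)) by move=> /intgN /Ip.
have pp := indep2_comp mp mp XY; have pn := indep2_comp mp mn XY.
have np := indep2_comp mn mp XY; have nn := indep2_comp mn mn XY.
have EX : Ex X = Ex (fun t => pospart (X t)) - Ex (fun t => pospart (- X t)).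
  by rewrite -ExB; [apply: eq_Ex => t; exact: split|exact: Ip|exact: In].
have EY : Ex Y = Ex (fun t => pospart (Y t)) - Ex (fun t => pospart (- Y t)).
  by rewrite -ExB; [apply: eq_Ex => t; exact: split|exact: Ip|exact: In].
have M U V : indep2 U V -> intg U -> intg V -> (forall t, 0 <= U t) -> (forall t, 0 <= V t) ->
  intg (fun t => U t * V t) /\ Ex (fun t => U t * V t) = Ex U * Ex V.
  by move=> *; split; [exact: intgM_indep|exact: ge0_ExM_indep].
have [I1 E1] := M _ _ pp (Ip _ IX) (Ip _ IY) (fun=> pospart_ge0 _) (fun=> pospart_ge0 _).
have [I2 E2] := M _ _ pn (Ip _ IX) (In _ IY) (fun=> pospart_ge0 _) (fun=> pospart_ge0 _).
have [I3 E3] := M _ _ np (In _ IX) (Ip _ IY) (fun=> pospart_ge0 _) (fun=> pospart_ge0 _).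
have [I4 E4] := M _ _ nn (In _ IX) (In _ IY) (fun=> pospart_ge0 _) (fun=> pospart_ge0 _).
rewrite (eq_Ex (g := fun t => (pospart (X t) * pospart (Y t) - pospart (X t) * pospart (- Y t))
   - (pospart (- X t) * pospart (Y t) - pospart (- X t) * pospart (- Y t)))); last first.
  by move=> t; rewrite {1}(split (X t)) {1}(split (Y t)); ring.
rewrite (ExB (intgB I1 I2) (intgB I3 I4)) (ExB I1 I2) (ExB I3 I4).
rewrite /comp in E1 E2 E3 E4; rewrite E1 E2 E3 E4 EX EY; ring.
Qed.

End expectation.

Section independence.
Context d (T : measurableType d) (R : realType) (P : probability T R).
Context d' (T' : measurableType d') (m : nat).
Variable s : 'I_m -> T -> T'.
Hypothesis ms : forall i, measurable_fun [set: T] (s i).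

Definition indep_family : Prop :=
  forall (J : {set 'I_m}) (E : 'I_m -> set T'), (forall i, measurable (E i)) ->
    P (\bigcap_(i in [set` J]) (s i @^-1` E i)) =
    (\prod_(i in J) P (s i @^-1` E i))%E.

Definition prefix (j : nat) : {set 'I_m} := [set i : 'I_m | (i < j)%N]%SET.

(** Cylinders over the first [j] variables, a pi-system. A set [E i] is given for every index, so
    that two cylinders intersect index by index. *)
Definition prefix_rect (j : nat) : set (set T) :=
  [set A | exists E : 'I_m -> set T', (forall i, measurable (E i)) /\
     A = \bigcap_(i in [set` prefix j]) (s i @^-1` E i)].

Lemma mpre i E : measurable E -> measurable (s i @^-1` E).
Proof. by move=> mE; rewrite -[_ @^-1` _]setTI; exact: ms. Qed.

Lemma prefix_rect_measurable j : prefix_rect j `<=` measurable.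
Proof.
move=> _ [E [mE ->]]; apply: fin_bigcap_measurable => [|i _].
  exact: finite_finset.
exact: mpre.
Qed.

Lemma prefix_rect_sigma_measurable j A : <<s prefix_rect j >> A -> measurable A.
Proof.
apply: smallest_sub; last exact: prefix_rect_measurable.
exact: sigma_algebra_measurable.
Qed.

Lemma prefix_rect_setI j : setI_closed (prefix_rect j).
Proof.
move=> _ _ [E [mE ->]] [F [mF ->]].
exists (fun i => E i `&` F i); split; first by move=> i; exact: measurableI.
by rewrite -bigcapI.
Qed.

Lemma prefix_rectT j : prefix_rect j [set: T].
Proof.
exists (fun=> setT); split => //.
by apply/seteqP; split.
Qed.

Definition prefixType j := g_sigma_algebraType (prefix_rect j).

Lemma measurable_prefix j (i : 'I_m) : (i < j)%N ->
  measurable_fun [set: prefixType j] (s i : prefixType j -> T').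
Proof.
move=> ij _ E mE; rewrite setTI; apply: sub_sigma_algebra.
exists (fun k => if k == i then E else setT); split.
  by move=> k; case: ifP.
apply/seteqP; split => [t Et k _ /=|t /(_ i)/=].
  by case: ifP => // /eqP ->.
by rewrite eqxx; apply; rewrite /= inE.
Qed.

Lemma measurable_prefixW j d2 (U : measurableType d2) (f : T -> U) :
  measurable_fun [set: prefixType j] (f : prefixType j -> U) -> measurable_fun [set: T] f.
Proof.
move=> mf _ A mA; have := mf measurableT A mA; exact: prefix_rect_sigma_measurable.
Qed.

Hypothesis si : indep_family.

(** Let [D] be the event that [s j] lies in [F]. The measures [A |-> P (A and D)] and
    [A |-> P D * P A] agree on the pi-system of cylinders, hence on the sigma-algebra it
    generates. *)
Lemma prefix_indep (j : 'I_m) A F : <<s prefix_rect j >> A -> measurable F ->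
  P (A `&` s j @^-1` F) = (P A * P (s j @^-1` F))%E.
Proof.
move=> sA mF; have mD := mpre j mF.
have fD : P (s j @^-1` F) \is a fin_num by exact: fin_num_measure.
pose r : {nonneg R} := NngNum (fine_ge0 (measure_ge0 P (s j @^-1` F))).
suff : mrestr P mD A = mscale r P A.
  by rewrite /mrestr /= /mscale /= fineK// muleC.
apply: (@g_sigma_algebra_measure_unique _ R T (prefix_rect j)
  (@prefix_rect_measurable j) (fun=> setT) (fun=> prefix_rectT j) _
  (mrestr P mD) (mscale r P) (@prefix_rect_setI j)) => //.
- by apply/seteqP; split => // t _; exists 0%N.
- move=> _ [E [mE ->]]; rewrite /mrestr /= /mscale /= fineK// muleC.

  (* A cylinder intersected with [D] is a rectangle over the indices up to and including [j], to
     which the joint independence applies. *)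
  pose E' := fun i => if i == j then F else E i.
  have mE' i : measurable (E' i) by rewrite /E'; case: ifP.
  have ne i : i \in prefix j -> (i == j) = false.
    by rewrite inE => ij; apply/negbTE; rewrite neq_ltn ij.
  transitivity (P (\bigcap_(i in [set` (j |: prefix j)%SET]) (s i @^-1` E' i))).
    congr (P _).
    apply/seteqP; split => [t [h1 h2] i /=|t h].
      rewrite !inE => /orP[/eqP ->|ij]; first by rewrite /E' eqxx.
      by rewrite /E' ne ?inE//; apply: h1; rewrite /= inE.
    split=> [i /= ip|].
      by have := h i; rewrite /= /E' ne//; apply; rewrite !inE in ip *; rewrite ip orbT.
    by have := h j; rewrite /= /E' eqxx; apply; rewrite !inE eqxx.
  rewrite (si _ mE) si// big_setU1/=; last by rewrite inE ltnn.
  rewrite {1}/E' eqxx [LHS]muleC; congr (_ * _)%E.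
  by apply: eq_bigr => i /ne h; rewrite /E' h.
- by move=> _; rewrite /= /mrestr setTI; apply: le_lt_trans (probability_le1 _ _) _; rewrite ?ltry.
Qed.

Lemma prefix_indep2 (j : 'I_m) (X : T -> R) (k : T' -> R) :
  measurable_fun [set: prefixType j] (X : prefixType j -> R) ->
  measurable_fun [set: T'] k -> indep2 P X (k \o s j).
Proof.
move=> mX mk A B mA mB; apply: (@prefix_indep j (X @^-1` A) (k @^-1` B)).
  by have := mX measurableT A mA; rewrite setTI.
by have := mk measurableT B mB; rewrite setTI.
Qed.

Lemma pair_indep2 (i j : 'I_m) (k k' : T' -> R) : (i < j)%N ->
  measurable_fun [set: T'] k -> measurable_fun [set: T'] k' ->
  indep2 P (k \o s i) (k' \o s j).
Proof.
move=> ij mk mk'; apply: prefix_indep2 => //.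
by apply: measurableT_comp => //; exact: measurable_prefix.
Qed.

(** After centring, the square is a double sum whose off-diagonal terms have mean 0. The mean square
    form is kept because it can be summed over the entries of a matrix before Markov's inequality is
    applied. *)
Lemma wlln (k : T' -> R) (mu C : R) : (0 < m)%N -> measurable_fun [set: T'] k ->
  (forall i, intg P (fun t => k (s i t) ^+ 2)) ->
  (forall i, Ex P (fun t => k (s i t)) = mu) ->
  (forall i, Ex P (fun t => (k (s i t) - mu) ^+ 2) <= C) ->
  intg P (fun t => (m%:R^-1 * (\sum_i k (s i t)) - mu) ^+ 2) /\
  Ex P (fun t => (m%:R^-1 * (\sum_i k (s i t)) - mu) ^+ 2) <= C / m%:R.
Proof.
move=> m0 mk I2 Emu EC.
pose K x := k x - mu.
have mK : measurable_fun [set: T'] K.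
  by apply: measurable_funB => //; exact: measurable_cst.
have mks i : measurable_fun [set: T] (fun t => k (s i t)) by exact: measurableT_comp.
have I1 i : intg P (fun t => k (s i t)).
  apply: (intg_le (g := fun t => 1 + k (s i t) ^+ 2)) => // [|t].
    by apply: intgD => //; exact: intg_cst.
  rewrite ler_norml; have := sqr_ge0 (k (s i t) - 1); have := sqr_ge0 (k (s i t) + 1); nra.
have IK i : intg P (fun t => K (s i t)) by apply: intgB => //; exact: intg_cst.
have EK i : Ex P (fun t => K (s i t)) = 0.
  by rewrite ExB ?Emu ?Ex_cst ?subrr//; exact: intg_cst.
have IKK i j : intg P (fun t => K (s i t) * K (s j t)).
  have [->|ij] := eqVneq i j.
    apply: eq_intg (intgD (I2 j) (intgD (intgZ (- 2 * mu) (I1 j)) (intg_cst P (mu ^+ 2)))) => t.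
    rewrite /K; ring.
  have [ij'|ij'] : (i < j)%N \/ (j < i)%N by apply/orP; rewrite -neq_ltn.
    exact: (intgM_indep (pair_indep2 ij' mK mK) (IK i) (IK j)).
  apply: eq_intg (intgM_indep (pair_indep2 ij' mK mK) (IK j) (IK i)) => t.
  by rewrite mulrC.
have EKK i j : i != j -> Ex P (fun t => K (s i t) * K (s j t)) = 0.
  move=> ij; have [ij'|ij'] : (i < j)%N \/ (j < i)%N by apply/orP; rewrite -neq_ltn.
    by rewrite -(mul0r (Ex P (fun t => K (s j t)))) -(EK i);
      exact: (ExM_indep (pair_indep2 ij' mK mK) (IK i) (IK j)).
  rewrite (eq_Ex _ (g := fun t => K (s j t) * K (s i t))); last by move=> t; rewrite mulrC.
  by rewrite -(mul0r (Ex P (fun t => K (s i t)))) -(EK j);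
    exact: (ExM_indep (pair_indep2 ij' mK mK) (IK j) (IK i)).
have mn0 : (m%:R : R) != 0 by rewrite pnatr_eq0 -lt0n.
have e t : (m%:R^-1 * (\sum_i k (s i t)) - mu) ^+ 2 =
   m%:R^-1 ^+ 2 * \sum_i \sum_j K (s i t) * K (s j t).
  rewrite -big_distrlr/= -expr2 -exprMn; congr (_ ^+ 2).
  by rewrite /K sumrB sumr_const card_ord mulrBr -[mu *+ m]mulr_natl mulrA mulVf ?mul1r.
have IS : intg P (fun t => m%:R^-1 ^+ 2 * \sum_i \sum_j K (s i t) * K (s j t)).
  by apply: intgZ; apply: intg_sum => i; exact: intg_sum.
split; first by apply: eq_intg IS => t; rewrite e.
rewrite (eq_Ex _ e) ExZ; last by apply: intg_sum => i; exact: intg_sum.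
rewrite Ex_sum; last by move=> i; exact: intg_sum.
rewrite (eq_bigr (fun i => Ex P (fun t => (k (s i t) - mu) ^+ 2))); last first.
  move=> i _; rewrite Ex_sum// (bigD1 i)//= big1 ?addr0; last first.
    by move=> j ji; rewrite EKK// eq_sym.
  by apply: eq_Ex => t; rewrite expr2.
have : \sum_i Ex P (fun t => (k (s i t) - mu) ^+ 2) <= m%:R * C.
  by apply: (le_trans (ler_sum _ (fun i _ => EC i))); rewrite sumr_const card_ord mulr_natl.
move=> h; apply: (@le_trans _ _ (m%:R^-1 ^+ 2 * (m%:R * C))).
  by apply: ler_wpM2l => //; exact: sqr_ge0.
rewrite le_eqVlt; apply/orP; left; apply/eqP; field.
by [].
Qed.

End independence.

(** * Lindeberg's replacement *)

Section rademacher_taylor.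
Variables (R : realType) (d : nat).
Implicit Types (x v l : 'cV[R]_d) (ls : seq 'cV[R]_d) (g : 'cV[R]_d -> R).

Lemma frobeniusD x v : frobenius (x + v) <= frobenius x + frobenius v.
Proof.
rewrite -ler_sqr ?nnegrE ?addr_ge0 ?frobenius_ge0// frobenius_sqr nsqDcV sqrrD.
rewrite !frobenius_sqr; have := abs_dot_le x v; have := ler_norm ((x^T *m v) 0 0).
by rewrite -mulr_natl; lra.
Qed.

Lemma frobeniusN x : frobenius (- x) = frobenius x.
Proof. by rewrite /frobenius -/(nsq (- x)) nsqN. Qed.

Lemma frobeniusZ (c : R) x : 0 <= c -> frobenius (c *: x) = c * frobenius x.
Proof.
move=> c0; rewrite /frobenius -/(nsq (c *: x)) nsqZ sqrtrM ?sqr_ge0// sqrtr_sqr.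
by rewrite ger0_norm.
Qed.

Lemma rad_shift ls g x v : rad ls g (x + v) = rad ls (fun y => g (x + y)) v.
Proof. by elim: ls v => [//|l ls IH] v /=; rewrite -!IH !addrA. Qed.

Lemma rad_frobenius3 ls v :
  rad ls (fun y => frobenius y ^+ 3) v <= (frobenius v + \sum_(l <- ls) frobenius l) ^+ 3.
Proof.
elim: ls v => [|l ls IH] v /=; first by rewrite big_nil addr0.
rewrite big_cons; set s := \sum_(j <- ls) _ in IH *.
have s0 : 0 <= s by apply: sumr_ge0 => *; exact: frobenius_ge0.
have h w : frobenius w <= frobenius v + frobenius l ->
    rad ls (fun y => frobenius y ^+ 3) w <= (frobenius v + (frobenius l + s)) ^+ 3.
  move=> hw; apply: (le_trans (IH w)); rewrite addrA.
  have w0 := frobenius_ge0 w.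
  by apply: lerXn2r; rewrite ?nnegrE ?addr_ge0 ?frobenius_ge0// lerD2r.
have := h _ (frobeniusD v l); have := h (v - l).
rewrite -(frobeniusN l) => /(_ (frobeniusD v (- l))); lra.
Qed.

Definition bilin (b : 'I_d -> 'I_d -> R) (v w : 'cV[R]_d) : R :=
  \sum_k \sum_l b k l * (v k 0 * w l 0).

(** Averaging over a sign cancels its linear and cross terms, so only the diagonal terms
    [bilin b l l] are added, without remainder. *)
Lemma rad_quadratic ls (a : 'I_d -> R) (b : 'I_d -> 'I_d -> R) (g0 : R) v :
  rad ls (fun v => g0 + \sum_k a k * v k 0 + bilin b v v) v =
  g0 + \sum_k a k * v k 0 + bilin b v v + \sum_(l <- ls) bilin b l l.
Proof.
elim: ls v => [|l ls IH] v /=; first by rewrite big_nil addr0.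
rewrite !IH big_cons.
have e1 : (\sum_k a k * (v + l) k 0) + (\sum_k a k * (v - l) k 0) =
   2 * \sum_k a k * v k 0.
  by rewrite -big_split/= mulr_sumr; apply: eq_bigr => k _; rewrite !mxE; ring.
have e2 : bilin b (v + l) (v + l) + bilin b (v - l) (v - l) =
   2 * bilin b v v + 2 * bilin b l l.
  rewrite /bilin -big_split/= !mulr_sumr -big_split/=; apply: eq_bigr => k _.
  rewrite -big_split/= !mulr_sumr -big_split/=; apply: eq_bigr => j _.
  by rewrite !mxE; ring.
lra.
Qed.

Lemma rad_taylor ls g (K : R) x (a : 'I_d -> R) (b : 'I_d -> 'I_d -> R) : 0 <= K ->
  (forall v, `|g (x + v) - (g x + \sum_k a k * v k 0 + bilin b v v)| <= K * frobenius v ^+ 3) ->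
  `|rad ls g x - (g x + \sum_(l <- ls) bilin b l l)| <= K * (\sum_(l <- ls) frobenius l) ^+ 3.
Proof.
move=> K0 h.
have e : g x + \sum_(l <- ls) bilin b l l =
    rad ls (fun v => g x + \sum_k a k * v k 0 + bilin b v v) 0.
  rewrite rad_quadratic.
  have -> : \sum_k a k * (0 : 'cV[R]_d) k 0 = 0 by apply: big1 => k _; rewrite mxE mulr0.
  have -> : bilin b 0 0 = 0.
    by apply: big1 => k _; apply: big1 => l _; rewrite !mxE mul0r mulr0.
  by rewrite !addr0.
have f0 : frobenius (0 : 'cV[R]_d) = 0 by rewrite /frobenius -/(nsq 0) nsq0 sqrtr0.
have : rad ls (fun v => K * frobenius v ^+ 3) 0 <= K * (\sum_(l <- ls) frobenius l) ^+ 3.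
  by rewrite radZ; apply: ler_wpM2l => //; have := rad_frobenius3 ls 0; rewrite f0 add0r.
rewrite e -[x in rad ls g x]addr0 rad_shift => h3.
set q := (fun v => g x + _ + _) in h *.
have A : rad ls q 0 <= rad ls (fun v => g (x + v)) 0 + rad ls (fun v => K * frobenius v ^+ 3) 0.
  rewrite -radD; apply: rad_le => v.
  by have := h v; rewrite ler_norml => /andP[h1 h2]; rewrite /q; lra.
have B : rad ls (fun v => g (x + v)) 0 <= rad ls q 0 + rad ls (fun v => K * frobenius v ^+ 3) 0.
  rewrite -radD; apply: rad_le => v.
  by have := h v; rewrite ler_norml => /andP[h1 h2]; rewrite /q; lra.
by rewrite ler_norml; apply/andP; split; lra.
Qed.

End rademacher_taylor.

Section lindeberg.
Context dT (T : measurableType dT) (R : realType) (P : probability T R).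
Context d' (T' : measurableType d') (m d : nat) (m0 : (0 < m)%N).
Variable s : 'I_m -> T -> T'.
Hypothesis ms : forall i, measurable_fun [set: T] (s i).
Hypothesis si : indep_family P s.
Variable psi : T' -> 'cV[R]_d.
Hypothesis mpsi : coord_measurable psi.
Variables (C4 kappa : R) (ls : seq 'cV[R]_d).
Hypothesis I4 : forall i, intg P (fun t => nsq (psi (s i t)) ^+ 2).
Hypothesis E4 : forall i, Ex P (fun t => nsq (psi (s i t)) ^+ 2) <= C4.
Hypothesis E1 : forall i k, Ex P (fun t => psi (s i t) k 0) = 0.
Hypothesis E2 : forall i k l,
  `|Ex P (fun t => psi (s i t) k 0 * psi (s i t) l 0) - (\sum_(v <- ls) v *m v^T) k l| <= kappa.

Let c : R := (Num.sqrt m%:R)^-1.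

(** Partial sums are scaled by the full [m]: this is the part of a hybrid sum that still consists of
    original summands. *)
Definition psum j t : 'cV[R]_d := c *: \sum_(i in prefix m j) psi (s i t).

Let c0 : 0 < c.
Proof. by rewrite invr_gt0 sqrtr_gt0 ltr0n. Qed.

Let cc : c ^+ 2 = m%:R^-1.
Proof. by rewrite exprVn sqr_sqrtr. Qed.

Let mpsis i k : measurable_fun [set: T] (fun t => psi (s i t) k 0).
Proof. exact: (measurableT_comp (mpsi k) (ms i)). Qed.

Let nsq_le (x : R) : 0 <= x -> x <= 1 + x ^+ 2.
Proof. by move=> x0; have := sqr_ge0 (x - 1); nra. Qed.

Lemma intg_psi i k : intg P (fun t => psi (s i t) k 0).
Proof.
apply: (intg_le (g := fun t => 2 + nsq (psi (s i t)) ^+ 2)) => // [|t].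
  by apply: intgD => //; exact: intg_cst.
have h := nsq_entry (psi (s i t)) k 0; have h0 := nsq_ge0 (psi (s i t)).
have h1 := nsq_le h0.
have := sqr_ge0 (psi (s i t) k 0 - 1); have := sqr_ge0 (psi (s i t) k 0 + 1).
by rewrite ler_norml => ? ?; apply/andP; split; nra.
Qed.

Lemma intg_psi2 i k l : intg P (fun t => psi (s i t) k 0 * psi (s i t) l 0).
Proof.
apply: (intg_le (g := fun t => 1 + nsq (psi (s i t)) ^+ 2)) => [||t].
- exact: measurable_funM.
- by apply: intgD => //; exact: intg_cst.
have h := nsq_entry (psi (s i t)) k 0; have h' := nsq_entry (psi (s i t)) l 0.
have h0 := nsq_ge0 (psi (s i t)); have h1 := nsq_le h0.
have := sqr_ge0 (psi (s i t) k 0 - psi (s i t) l 0).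
have := sqr_ge0 (psi (s i t) k 0 + psi (s i t) l 0).
by rewrite ler_norml => ? ?; apply/andP; split; nra.
Qed.

Lemma psumS (j : 'I_m) t : psum j.+1 t = psum j t + c *: psi (s j t).
Proof.
rewrite /psum -scalerDr; congr (_ *: _).
have -> : prefix m j.+1 = (j |: prefix m j)%SET.
  by apply/setP => i; rewrite !inE ltnS leq_eqVlt.
by rewrite big_setU1/=; [rewrite addrC|rewrite inE ltnn].
Qed.

Lemma psum_prefix j : @coord_measurable R d _ (prefixType s j) (psum j).
Proof.
move=> k.
have -> : (fun t => psum j t k 0) = (fun t => c * \sum_(i in prefix m j) psi (s i t) k 0).
  by apply/funext => t; rewrite /psum mxE summxE.
apply: measurable_funM; first exact: measurable_cst.
have -> : (fun t => \sum_(i in prefix m j) psi (s i t) k 0) =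
    (fun t => \sum_i (i \in prefix m j)%:R * psi (s i t) k 0).
  apply/funext => t; rewrite big_mkcond; apply: eq_bigr => i _.
  by case: ifP; rewrite ?mul1r ?mul0r.
apply: measurable_sum => i /=; have [ij|_] := boolP (i \in prefix m j).
  apply: measurable_funM; first exact: measurable_cst.
  apply: (measurableT_comp (mpsi k)); apply: measurable_prefix => //.
  by rewrite inE in ij.
have -> : (fun t => false%:R * psi (s i t) k 0) = (fun=> 0).
  by apply/funext => t; rewrite mul0r.
exact: measurable_cst.
Qed.

Lemma coord_measurable_psum j : coord_measurable (psum j).
Proof. by move=> k; apply: (measurable_prefixW ms (j := j)); exact: psum_prefix. Qed.

(** Both sides are expanded to second order around [S = psum j], which is independent of summand
    [j]. The linear terms have mean zero, the quadratic ones differ through the covariance only, by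
    [kappa] per entry, and the two remainders carry [c ^+ 3]. *)
Lemma lindeberg_step (j : 'I_m) g K : 0 <= K -> taylor2 K g ->
  `|Ex P (fun t => g (psum j.+1 t)) -
    Ex P (fun t => rad (map ( *:%R c) ls) g (psum j t))| <=
  K * (c ^+ 2 * (d%:R ^+ 2 * kappa) +
       c ^+ 3 * (1 + C4 + (\sum_(l <- ls) frobenius l) ^+ 3)).
Proof.
move=> K0 tg; have tr := taylor2_rad (map ( *:%R c) ls) tg.
have [a [b [[mg ma mb] [bg ba bb] tay]]] := tg.
have [a' [b' [[mg' _ _] [bg' _ _] _]]] := tr.
pose S := psum j; pose Y t := psi (s j t).
have mS := @coord_measurable_psum j; have pS := @psum_prefix j.
have IgS : intg P (fun t => g (S t)) by apply: intg_bounded (fun t => bg _); exact: mg.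
have IgS' : intg P (fun t => g (psum j.+1 t)).
  by apply: intg_bounded (fun t => bg _); apply: mg; exact: coord_measurable_psum.
have IrS : intg P (fun t => rad (map ( *:%R c) ls) g (S t)).
  by apply: intg_bounded (fun t => bg' _); exact: mg'.
have IbS k l : intg P (fun t => b k l (S t)).
  by apply: intg_bounded (fun t => bb k l _); exact: mb.
have IaS k : intg P (fun t => a k (S t)).
  by apply: intg_bounded (fun t => ba k _); exact: ma.
have ind1 k : indep2 P (fun t => a k (S t)) (fun t => Y t k 0).
  apply: (prefix_indep2 ms si (X := fun t => a k (S t)) (k := fun x => psi x k 0)) => //.
  exact: (ma k).
have ind2 k l : indep2 P (fun t => b k l (S t)) (fun t => Y t k 0 * Y t l 0).
  apply: (prefix_indep2 ms si (X := fun t => b k l (S t))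
    (k := fun x => psi x k 0 * psi x l 0)).
    exact: (mb k l).
  exact: measurable_funM.
have Ia k : intg P (fun t => a k (S t) * Y t k 0).
  exact: intgM_indep (ind1 k) (IaS k) (intg_psi j k).
have Ib k l : intg P (fun t => b k l (S t) * (Y t k 0 * Y t l 0)).
  exact: intgM_indep (ind2 k l) (IbS k l) (intg_psi2 j k l).
(* [Q] expands the original summand; [Rm] below is its counterpart for the signs, with the linear
   term averaged out. *)
pose Q t := g (S t) + c * \sum_k a k (S t) * Y t k 0 +
  c ^+ 2 * \sum_k \sum_l b k l (S t) * (Y t k 0 * Y t l 0).
have Ia' : intg P (fun t => c * \sum_k a k (S t) * Y t k 0).
  by apply: intgZ; exact: intg_sum.
have Ib' : intg P (fun t => c ^+ 2 * \sum_k \sum_l b k l (S t) * (Y t k 0 * Y t l 0)).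
  by apply: intgZ; apply: intg_sum => k; exact: intg_sum.
have IQ : intg P Q by apply: intgD => //; exact: intgD.
have EQ : Ex P Q = Ex P (fun t => g (S t)) + c ^+ 2 *
    \sum_k \sum_l Ex P (fun t => b k l (S t)) * Ex P (fun t => Y t k 0 * Y t l 0).
  rewrite (ExD (intgD IgS Ia') Ib') (ExD IgS Ia'); congr (_ + _).
    rewrite ExZ; last exact: intg_sum.
    rewrite Ex_sum// big1 ?mulr0 ?addr0// => k _.
    by rewrite (ExM_indep (ind1 k) (IaS k) (intg_psi j k)) E1 mulr0.
  rewrite ExZ; last by apply: intg_sum => k; exact: intg_sum.
  rewrite Ex_sum; last by move=> k; exact: intg_sum.
  congr (_ * _); apply: eq_bigr => k _; rewrite Ex_sum//; apply: eq_bigr => l _.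
  by rewrite (ExM_indep (ind2 k l) (IbS k l) (intg_psi2 j k l)).
pose Rm t := g (S t) + c ^+ 2 * \sum_k \sum_l b k l (S t) * (\sum_(v <- ls) v *m v^T) k l.
have IB : intg P (fun t => \sum_k \sum_l b k l (S t) * (\sum_(v <- ls) v *m v^T) k l).
  apply: intg_sum => k; apply: intg_sum => l.
  by apply: eq_intg (intgZ ((\sum_(v <- ls) v *m v^T) k l) (IbS k l)) => t; rewrite mulrC.
have IR : intg P Rm by apply: intgD => //; exact: intgZ.
have ER : Ex P Rm = Ex P (fun t => g (S t)) + c ^+ 2 *
    \sum_k \sum_l Ex P (fun t => b k l (S t)) * (\sum_(v <- ls) v *m v^T) k l.
  rewrite (ExD IgS (intgZ _ IB)) ExZ// Ex_sum; last first.
    move=> k; apply: intg_sum => l.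
    by apply: eq_intg (intgZ ((\sum_(v <- ls) v *m v^T) k l) (IbS k l)) => t; rewrite mulrC.
  congr (_ + _ * _); apply: eq_bigr => k _; rewrite Ex_sum; last first.
    by move=> l; apply: eq_intg (intgZ ((\sum_(v <- ls) v *m v^T) k l) (IbS k l)) => t; rewrite mulrC.
  apply: eq_bigr => l _; rewrite mulrC -ExZ//; apply: eq_Ex => t; exact: mulrC.
have c30 : 0 <= c ^+ 3 by rewrite exprn_ge0// ltW.
have d1 : `|Ex P (fun t => g (psum j.+1 t)) - Ex P Q| <= K * c ^+ 3 * (1 + C4).
  have pt t : `|g (psum j.+1 t) - Q t| <= K * c ^+ 3 * (1 + nsq (Y t) ^+ 2).
    have := tay (S t) (c *: Y t); rewrite psumS -/S -/(Y t).
    have -> : \sum_k a k (S t) * (c *: Y t) k 0 = c * \sum_k a k (S t) * Y t k 0.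
      by rewrite mulr_sumr; apply: eq_bigr => k _; rewrite mxE; ring.
    have -> : \sum_k \sum_l b k l (S t) * ((c *: Y t) k 0 * (c *: Y t) l 0) =
       c ^+ 2 * \sum_k \sum_l b k l (S t) * (Y t k 0 * Y t l 0).
      rewrite mulr_sumr; apply: eq_bigr => k _; rewrite mulr_sumr; apply: eq_bigr => l _.
      by rewrite !mxE; ring.
    move=> /le_trans; apply; rewrite frobeniusZ ?(ltW c0)// exprMn mulrA.
    apply: ler_wpM2l; first exact: mulr_ge0.
    (* [|Y|^3 <= 1 + |Y|^4], by comparing [|Y|] with 1; the bound on fourth moments thus controls
       the remainder. *)
    have f0 := frobenius_ge0 (Y t).
    rewrite -frobenius_sqr -exprM.
    have [f1|f1] := leP (frobenius (Y t)) 1.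
      by have := exprn_ile1 3 f0 f1; have := exprn_ge0 (2 * 2) f0; lra.
    have : frobenius (Y t) ^+ 3 <= frobenius (Y t) ^+ (2 * 2).
      by rewrite (@ler_weXn2l _ _ (ltW f1)).
    by lra.
  have Ip : intg P (fun t => K * c ^+ 3 * (1 + nsq (Y t) ^+ 2)).
    by apply: intgZ; apply: intgD; [exact: intg_cst|exact: I4].
  have EP : Ex P (fun t => K * c ^+ 3 * (1 + nsq (Y t) ^+ 2)) <= K * c ^+ 3 * (1 + C4).
    rewrite ExZ; last by apply: intgD; [exact: intg_cst|exact: I4].
    rewrite ExD; [|exact: intg_cst|exact: I4].
    by rewrite Ex_cst; apply: ler_wpM2l; [exact: mulr_ge0|rewrite lerD2l; exact: E4].
  rewrite -ExB// ler_norml; apply/andP; split.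
    rewrite lerNl; apply: le_trans EP.
    rewrite -[- _]mulN1r -ExZ; last exact: intgB.
    apply: Ex_le => // [|t]; first by apply: intgZ; exact: intgB.
    by have := pt t; rewrite ler_norml mulN1r => /andP[h _]; lra.
  apply: le_trans EP; apply: Ex_le => // [|t]; first exact: intgB.
  exact: le_trans (ler_norm _) (pt t).
have d2 : `|Ex P (fun t => rad (map ( *:%R c) ls) g (S t)) - Ex P Rm| <=
    K * c ^+ 3 * (\sum_(l <- ls) frobenius l) ^+ 3.
  rewrite -ExB//; apply: Ex_norm; first exact: intgB.
  move=> t; have := @rad_taylor R d (map ( *:%R c) ls) g K (S t) (a^~ (S t))
    (fun k l => b k l (S t)) K0 (tay (S t)).
  have -> : \sum_(l <- map ( *:%R c) ls) frobenius l = c * \sum_(l <- ls) frobenius l.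
    by rewrite big_map mulr_sumr; apply: eq_bigr => l _; rewrite frobeniusZ// ltW.
  rewrite big_map exprMn mulrA.
  have -> : \sum_(l <- ls) bilin (fun k l0 => b k l0 (S t)) (c *: l) (c *: l) =
     c ^+ 2 * \sum_k \sum_l b k l (S t) * (\sum_(v <- ls) v *m v^T) k l.
    rewrite /bilin exchange_big/= mulr_sumr; apply: eq_bigr => k _.
    rewrite exchange_big/= mulr_sumr; apply: eq_bigr => l _.
    rewrite summxE !mulr_sumr; apply: eq_bigr => v _.
    by rewrite !mxE big_ord1 !mxE; ring.
  by [].
have d3 : `|Ex P Q - Ex P Rm| <= c ^+ 2 * (d%:R ^+ 2 * (K * kappa)).
  rewrite EQ ER opprD addrACA subrr add0r -mulrBr normrM (ger0_norm (sqr_ge0 _)).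
  apply: ler_wpM2l; first exact: sqr_ge0.
  rewrite -sumrB; apply: (le_trans (ler_norm_sum _ _ _)).
  have -> : d%:R ^+ 2 * (K * kappa) = \sum_(k < d) \sum_(l < d) K * kappa.
    by rewrite !sumr_const !card_ord -(mulr_natl (K * kappa)) -(mulr_natl (_ * (K * kappa))); ring.
  apply: ler_sum => k _; rewrite -sumrB; apply: (le_trans (ler_norm_sum _ _ _)).
  apply: ler_sum => l _; rewrite -mulrBr normrM; apply: ler_pM => //; last exact: E2.
  exact: Ex_norm.
have tri (x1 x2 q r e1 e2 e3 : R) : `|x1 - q| <= e1 -> `|x2 - r| <= e2 ->
    `|q - r| <= e3 -> `|x1 - x2| <= e1 + e2 + e3.
  move=> h1 h2 h3; rewrite (_ : x1 - x2 = (x1 - q) - (x2 - r) + (q - r)); last by ring.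
  apply: (le_trans (ler_normD _ _)); apply: lerD h3.
  by apply: (le_trans (ler_normB _ _)); exact: lerD.
apply: (le_trans (tri _ _ _ _ _ _ _ d1 d2 d3)); lra.
Qed.

(** The [m] replacements telescope, and [m c^2 = 1] leaves the covariance error of order 1 and a
    factor [c] in front of the moments. *)
Lemma lindeberg f K : 0 <= K -> taylor2 K f ->
  `|Ex P (fun t => f (psum m t)) - rad (radseq ls m) f 0| <=
  K * (d%:R ^+ 2 * kappa + c * (1 + C4 + (\sum_(l <- ls) frobenius l) ^+ 3)).
Proof.
move=> K0 tf.
set B := 1 + C4 + _.
(* Hybrid of [j] original summands and [m - j] blocks of signs, the signs being absorbed in the test
   function. *)
pose h j := Ex P (fun t => rad (flatten (nseq (m - j) (map ( *:%R c) ls))) f (psum j t)).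
have hm : h m = Ex P (fun t => f (psum m t)) by rewrite /h subnn.
have h0 : h 0%N = rad (radseq ls m) f 0.
  rewrite /h subn0 -[RHS](Ex_cst P); apply: eq_Ex => t.
  by rewrite /psum big_pred0 ?scaler0// => i; rewrite inE.
have st j : (j < m)%N -> `|h j.+1 - h j| <= K * (c ^+ 2 * (d%:R ^+ 2 * kappa) + c ^+ 3 * B).
  move=> jm; have := lindeberg_step (Ordinal jm) K0
    (taylor2_rad (flatten (nseq (m - j.+1) (map ( *:%R c) ls))) tf).
  rewrite /h (_ : (m - j = (m - j.+1).+1)%N); last by lia.
  rewrite [flatten (nseq _.+1 _)]/=.
  under [X in _ - X]eq_Ex do rewrite -rad_cat.
  by [].
have tot j : (j <= m)%N -> `|h j - h 0%N| <=
    j%:R * (K * (c ^+ 2 * (d%:R ^+ 2 * kappa) + c ^+ 3 * B)).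
  elim: j => [|j IH] jm; first by rewrite subrr normr0 mul0r.
  rewrite (_ : _ - _ = (h j.+1 - h j) + (h j - h 0%N)); last by ring.
  apply: (le_trans (ler_normD _ _)); rewrite -natr1 mulrDl mul1r addrC.
  by apply: lerD; [exact: IH (ltnW jm)|exact: st].
rewrite -hm -h0; apply: (le_trans (tot m (leqnn m))).
have e : m%:R * c ^+ 2 = 1 by rewrite cc mulfV// pnatr_eq0 -lt0n.
rewrite (_ : _ * (K * _) = K * ((m%:R * c ^+ 2) * (d%:R ^+ 2 * kappa) +
   (m%:R * c ^+ 2) * c * B)); last by ring.
by rewrite e !mul1r.
Qed.

End lindeberg.

(** * The ridge estimator of an i.i.d. sample *)

Section ridge_algebra.
Variables (R : realType) (d m : nat).
Implicit Types (z : 'I_m -> 'cV[R]_d) (u : 'I_m -> R) (beta S : 'cV[R]_d) (lam : R).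

Definition avgH z : 'M[R]_d := m%:R^-1 *: \sum_i (z i *m (z i)^T).
Definition avgg z u : 'cV[R]_d := m%:R^-1 *: \sum_i (u i *: z i).
Definition score lam beta (z : 'cV[R]_d) (u : R) : 'cV[R]_d :=
  (u - (z^T *m beta) 0 0) *: z - lam *: beta.
Definition ridge_est lam z u : 'cV[R]_d := invmx (avgH z + lam%:M) *m avgg z u.

Lemma outer_mulmx (x y b : 'cV[R]_d) : x *m y^T *m b = (y^T *m b) 0 0 *: x.
Proof.
rewrite -mulmxA [y^T *m b]mx11_scalar mul_mx_scalar.
by congr (_ *: _); rewrite [in RHS]mxE eqxx.
Qed.

Lemma psd_avgH z : psd (avgH z).
Proof.
split.
  rewrite /avgH linearZ/= linear_sum/=; congr (_ *: _); apply: eq_bigr => i _.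
  by rewrite trmx_mul trmxK.
move=> x; rewrite /avgH /qf -scalemxAr -scalemxAl mxE mulr_ge0 ?invr_ge0//.
rewrite mulmx_sumr mulmx_suml summxE; apply: sumr_ge0 => i _.
by rewrite -/(qf _ _ _) qf_outer sqr_ge0.
Qed.

Lemma avg_unit z lam : 0 < lam -> avgH z + lam%:M \in unitmx.
Proof. by move=> l0; apply: psd_addr_unit => //; exact: psd_avgH. Qed.

(** The residual of the normal equations at an arbitrary [beta]: later this is the population
    solution for the sketch, and the sketched solution for a resample. *)
Lemma mean_score z u lam beta : (0 < m)%N ->
  avgg z u - (avgH z + lam%:M) *m beta =
  m%:R^-1 *: \sum_i score lam beta (z i) (u i).
Proof.
move=> m0.
have e : \sum_i score lam beta (z i) (u i) =
    \sum_i u i *: z i - (\sum_i z i *m (z i)^T) *m beta - m%:R *: (lam *: beta).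
  rewrite (eq_bigr (fun i => u i *: z i - z i *m (z i)^T *m beta - lam *: beta)); last first.
    by move=> i _; rewrite outer_mulmx /score scalerBl.
  by rewrite !sumrB sumr_const card_ord scaler_nat mulmx_suml.
rewrite e /avgg /avgH mulmxDl -scalemxAl mul_scalar_mx !scalerBr opprD addrA.
by rewrite [_ *: (m%:R *: _)]scalerA mulVf ?scale1r// pnatr_eq0 -lt0n.
Qed.

Lemma ridge_est_sub z u lam beta : (0 < m)%N -> 0 < lam ->
  ridge_est lam z u - beta =
  invmx (avgH z + lam%:M) *m (m%:R^-1 *: \sum_i score lam beta (z i) (u i)).
Proof.
move=> m0 l0; rewrite -mean_score// mulmxBr mulmxA mulVmx ?mul1mx//.
exact: avg_unit.
Qed.

End ridge_algebra.

Section ridge_perturbation.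
Variables (R : realType) (d : nat).
Implicit Types (M N : 'M[R]_d) (S : 'cV[R]_d).

(** Resolvent identity [N^-1 = M^-1 + N^-1 (M - N) M^-1]. Since [4 C r <= 1], the last term has at
    most a quarter of the squared norm of [N^-1]; after the factor 2 of [nsqD_le] it is absorbed on
    the left. *)
Lemma invmx_perturb M N (C r : R) : M \in unitmx -> N \in unitmx ->
  nsq (invmx M) <= C -> nsq (N - M) <= r -> 4 * C * r <= 1 ->
  nsq (invmx N) <= 4 * C.
Proof.
move=> uM uN MC Nr Cr.
have e : invmx N = invmx M + invmx N *m (M - N) *m invmx M.
  by rewrite mulmxBr mulmxBl mulVmx// mul1mx -mulmxA mulmxV// mulmx1 addrC subrK.
have h1 := nsqD_le (invmx M) (invmx N *m (M - N) *m invmx M).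
rewrite -e in h1.
have h2 := nsqM (invmx N *m (M - N)) (invmx M).
have h3 := nsqM (invmx N) (M - N).
have a0 := nsq_ge0 (invmx N); have b0 := nsq_ge0 (invmx M); have c0 := nsq_ge0 (M - N).
rewrite nsqC in Nr.
have h4 : nsq (invmx N *m (M - N) *m invmx M) <= nsq (invmx N) * (r * C).
  apply: (le_trans h2); apply: (@le_trans _ _ (nsq (invmx N) * nsq (M - N) * nsq (invmx M))).
    exact: ler_wpM2r.
  by rewrite -mulrA; apply: ler_wpM2l => //; exact: ler_pM.
have : nsq (invmx N) * (r * C) <= nsq (invmx N) * 4^-1.
  by apply: ler_wpM2l => //; lra.
lra.
Qed.

Lemma perturb_sub M N (C r : R) S : M \in unitmx -> N \in unitmx ->
  nsq (invmx M) <= C -> nsq (N - M) <= r -> 4 * C * r <= 1 ->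
  nsq (invmx N *m (M *m S) - S) <= 4 * C * r * nsq S.
Proof.
move=> uM uN MC Nr Cr; have hN := invmx_perturb uM uN MC Nr Cr.
have -> : invmx N *m (M *m S) - S = invmx N *m ((M - N) *m S).
  by rewrite mulmxBl mulmxBr (mulmxA (invmx N) N) mulVmx// mul1mx.
apply: (le_trans (nsqM _ _)); rewrite -mulrA; apply: ler_pM => //; try exact: nsq_ge0.
apply: (le_trans (nsqM _ _)); apply: ler_wpM2r; first exact: nsq_ge0.
by rewrite nsqC.
Qed.

Lemma nsq_close (T S : 'cV[R]_d) (th : R) : 0 <= th -> th <= 1 ->
  nsq (T - S) <= th ^+ 2 * nsq S -> `|nsq T - nsq S| <= 3 * th * nsq S.
Proof.
move=> t0 t1 h.
have s0 := nsq_ge0 S.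
have fD : frobenius (T - S) <= th * frobenius S.
  rewrite -ler_sqr ?nnegrE ?mulr_ge0 ?frobenius_ge0// exprMn !frobenius_sqr//.
have e : nsq T = nsq S + 2 * (S^T *m (T - S)) 0 0 + nsq (T - S).
  by rewrite -nsqDcV addrC subrK.
have ad : `|(S^T *m (T - S)) 0 0| <= th * nsq S.
  apply: (le_trans (abs_dot_le _ _)); rewrite -frobenius_sqr expr2 mulrCA.
  by apply: ler_wpM2l => //; exact: frobenius_ge0.
have d0 := nsq_ge0 (T - S).
have h2 : th ^+ 2 * nsq S <= th * nsq S by apply: ler_wpM2r => //; nra.
by move: ad; rewrite e !ler_norml => /andP[a1 a2]; apply/andP; split; lra.
Qed.

(** The relative error [3 th] of [nsq_close] becomes absolute: as [th <= 1/6], [nsq T <= K] forces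
    [nsq S <= 2 K], and [6 th K <= delta]. *)
Lemma nsq_close_le (T S : 'cV[R]_d) (th K delta t : R) :
  0 <= th -> th <= 6^-1 -> 0 <= K -> 6 * th * K <= delta -> t <= K ->
  nsq (T - S) <= th ^+ 2 * nsq S ->
  (nsq T <= t -> nsq S <= t + delta) /\ (nsq S <= t - delta -> nsq T <= t).
Proof.
move=> t0 t6 K0 tK tle h; have := nsq_close t0 _ h; rewrite ler_norml.
have s0 := nsq_ge0 S.
have -> : th <= 1 by lra.
move=> /(_ isT)/andP[h1 h2]; split => hT.
  have : nsq S <= 2 * K by nra.
  nra.
have : nsq S <= K by nra.
nra.
Qed.

End ridge_perturbation.

Section one_sample.
Variable R : realType.

Lemma near_inv_sqrt (a e : R) : 0 <= a -> 0 < e ->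
  exists2 M : nat, (0 < M)%N & forall m, (M <= m)%N -> (Num.sqrt m%:R)^-1 * a <= e.
Proof.
move=> a0 e0; exists (Num.truncn ((a / e) ^+ 2)).+1 => // m Mm.
have m0 : (0 < m)%N by apply: leq_trans Mm.
have sm : 0 < Num.sqrt (m%:R : R) by rewrite sqrtr_gt0 ltr0n.
rewrite mulrC ler_pdivrMr// mulrC -ler_pdivrMr//.
rewrite -ler_sqr ?nnegrE ?divr_ge0 ?(ltW sm) ?(ltW e0)// sqr_sqrtr//.
by rewrite (le_trans (ltW (truncnS_gt _)))// ler_nat.
Qed.

Lemma near_inv (a e : R) : 0 <= a -> 0 < e ->
  exists2 M : nat, (0 < M)%N & forall m, (M <= m)%N -> a / m%:R <= e.
Proof.
move=> a0 e0; exists (Num.truncn (a / e)).+1 => // m Mm.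
have m0 : (0 < m)%N by apply: leq_trans Mm.
rewrite ler_pdivrMr ?ltr0n// mulrC -ler_pdivrMr//.
by rewrite (le_trans (ltW (truncnS_gt _)))// ler_nat.
Qed.

Section model.
Variables (d m : nat) (dT : measure_display) (T : measurableType dT) (P : probability T R).
Variables (d' : measure_display) (T' : measurableType d').
Variables (s : 'I_m -> T -> T') (z : T' -> 'cV[R]_d) (u : T' -> R).
Variables (H : 'M[R]_d) (g : 'cV[R]_d) (lam : R) (beta : 'cV[R]_d).
Variables (C kappa : R) (ls : seq 'cV[R]_d).

Definition infl (x : T') : 'cV[R]_d :=
  invmx (H + lam%:M) *m score lam beta (z x) (u x).

Definition dev4 (x : T') : R :=
  nsq (z x *m (z x)^T - H) ^+ 2 + nsq (u x *: z x - g) ^+ 2.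

(** What the sketch and the bootstrap population share. [H], [g] and [beta] are parameters because
    for the bootstrap they are the sketched quantities. A single [C] bounds everything on which the
    error terms depend, and the covariance matches [ls] up to [kappa] only, as neither population
    has covariance exactly equal to the limit. *)
Record ridge_model : Prop := RidgeModel {
  rm_s : forall i, measurable_fun [set: T] (s i);
  rm_indep : indep_family P s;
  rm_z : coord_measurable z;
  rm_u : measurable_fun [set: T'] u;
  rm_lam : 0 < lam;
  rm_unit : H + lam%:M \in unitmx;
  rm_A : nsq (invmx (H + lam%:M)) <= C;
  rm_beta : nsq beta <= C;
  rm_g : (H + lam%:M) *m beta = g;
  rm_EH : forall i k l, Ex P (fun t => z (s i t) k 0 * z (s i t) l 0) = H k l;
  rm_Eg : forall i k, Ex P (fun t => u (s i t) * z (s i t) k 0) = g k 0;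
  rm_I4 : forall i, intg P (fun t => dev4 (s i t));
  rm_E4 : forall i, Ex P (fun t => dev4 (s i t)) <= C;
  rm_cov : forall i k l, `|Ex P (fun t => infl (s i t) k 0 * infl (s i t) l 0)
     - (\sum_(v <- ls) v *m v^T) k l| <= kappa }.

Definition lin_stat t : 'cV[R]_d := (Num.sqrt m%:R)^-1 *: \sum_i infl (s i t).
Definition est_stat t : 'cV[R]_d := Num.sqrt m%:R *:
  (ridge_est lam (fun i => z (s i t)) (fun i => u (s i t)) - beta).

Hypothesis (m0 : (0 < m)%N) (model : ridge_model).

(** The normal equations [rm_g] express the score by the centred moments [u z - g] and [z z^T - H];
    hence its mean is zero and its fourth moment is controlled by [dev4]. *)
Lemma score_dev x : score lam beta (z x) (u x) =
  (u x *: z x - g) - (z x *m (z x)^T - H) *m beta.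
Proof.
have -> : g = H *m beta + lam *: beta by rewrite -(rm_g model) mulmxDl mul_scalar_mx.
rewrite /score mulmxBl outer_mulmx scalerBl; apply/matrixP => i j; rewrite !mxE; ring.
Qed.

Lemma dev4_ge0 x : 0 <= dev4 x.
Proof. by rewrite addr_ge0 ?sqr_ge0. Qed.

Let C0 : 0 <= C.
Proof. exact: le_trans (nsq_ge0 _) (rm_beta model). Qed.

Lemma infl4_le x : nsq (infl x) ^+ 2 <= 8 * C ^+ 2 * (1 + C ^+ 2) * dev4 x.
Proof.
have hA := rm_A model; have hb := rm_beta model.
have s0 := nsq_ge0 (score lam beta (z x) (u x)).
have h1 : nsq (infl x) <= C * nsq (score lam beta (z x) (u x)).
  by apply: (le_trans (nsqM _ _)); exact: ler_wpM2r.
rewrite score_dev in s0 h1.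
set D1 := u x *: z x - g in s0 h1 *; set D2 := z x *m (z x)^T - H in s0 h1 *.
have p1 := nsq_ge0 D1; have p2 := nsq_ge0 D2.
have h2 : nsq (D1 - D2 *m beta) <= 2 * nsq D1 + 2 * (nsq D2 * C).
  apply: (le_trans (nsqB_le _ _)); rewrite lerD2l ler_pM2l//.
  by apply: (le_trans (nsqM _ _)); exact: ler_wpM2l.
rewrite /dev4 -/D1 -/D2.
have q : 0 <= C * (2 * nsq D1 + 2 * (nsq D2 * C)).
  by apply: mulr_ge0 => //; apply: addr_ge0; apply: mulr_ge0 => //; exact: mulr_ge0.
have h3 : nsq (infl x) ^+ 2 <= (C * (2 * nsq D1 + 2 * (nsq D2 * C))) ^+ 2.
  rewrite ler_sqr ?nnegrE ?nsq_ge0//; apply: (le_trans h1).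
  by apply: ler_wpM2l.
apply: (le_trans h3); rewrite exprMn.
have C20 : 0 <= C ^+ 2 by exact: sqr_ge0.
have : (2 * nsq D1 + 2 * (nsq D2 * C)) ^+ 2 <=
    8 * (1 + C ^+ 2) * (nsq D2 ^+ 2 + nsq D1 ^+ 2).
  have := sqr_ge0 (nsq D1 - nsq D2 * C).
  have : 0 <= C ^+ 2 * nsq D1 ^+ 2 by apply: mulr_ge0 => //; exact: sqr_ge0.
  have : 0 <= nsq D2 ^+ 2 by exact: sqr_ge0.
  have -> : (2 * nsq D1 + 2 * (nsq D2 * C)) ^+ 2 = 8 * nsq D1 ^+ 2
     + 8 * C ^+ 2 * nsq D2 ^+ 2 - 4 * (nsq D1 - nsq D2 * C) ^+ 2 by ring.
  lra.
move=> /(ler_wpM2l C20); lra.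
Qed.

Lemma coord_measurable_mulmx dX (X : measurableType dX) (A : 'M[R]_d) (v : X -> 'cV[R]_d) :
  coord_measurable v -> coord_measurable (fun x => A *m v x).
Proof.
move=> mv k; have -> : (fun x => (A *m v x) k 0) = (fun x => \sum_j A k j * v x j 0).
  by apply/funext => x; rewrite mxE.
by apply: measurable_sum => j; apply: measurable_funM => //; exact: measurable_cst.
Qed.

Lemma measurable_dot dX (X : measurableType dX) (v : X -> 'cV[R]_d) (b : 'cV[R]_d) :
  coord_measurable v -> measurable_fun [set: X] (fun x => ((v x)^T *m b) 0 0).
Proof.
move=> mv; have -> : (fun x => ((v x)^T *m b) 0 0) = (fun x => \sum_j v x j 0 * b j 0).
  by apply/funext => x; rewrite mxE; apply: eq_bigr => j _; rewrite mxE.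
by apply: measurable_sum => j; apply: measurable_funM => //; exact: measurable_cst.
Qed.

Lemma coord_measurable_infl : coord_measurable infl.
Proof.
apply: coord_measurable_mulmx => k.
have -> : (fun x => score lam beta (z x) (u x) k 0) =
  (fun x => (u x - ((z x)^T *m beta) 0 0) * z x k 0 - lam * beta k 0).
  by apply/funext => x; rewrite !mxE.
apply: measurable_funB; last exact: measurable_cst.
apply: measurable_funM; last exact: rm_z model k.
by apply: measurable_funB; [exact: rm_u model|apply: measurable_dot; exact: rm_z model].
Qed.

Lemma intg_infl2 i k l : intg P (fun t => infl (s i t) k 0 * infl (s i t) l 0).
Proof.
have mi j : measurable_fun [set: T] (fun t => infl (s i t) j 0).
  exact: measurableT_comp (coord_measurable_infl j) (rm_s model i).
apply: (intg_le (g := fun t => 1 + 8 * C ^+ 2 * (1 + C ^+ 2) * dev4 (s i t))) => [||t].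
- exact: measurable_funM.
- by apply: intgD; [exact: intg_cst|apply: intgZ; exact: rm_I4 model i].
have h1 := infl4_le (s i t); have h2 := nsq_entry (infl (s i t)) k 0.
have h3 := nsq_entry (infl (s i t)) l 0; have h4 := nsq_ge0 (infl (s i t)).
have := sqr_ge0 (infl (s i t) k 0 - infl (s i t) l 0).
have := sqr_ge0 (infl (s i t) k 0 + infl (s i t) l 0).
have := sqr_ge0 (nsq (infl (s i t)) - 1).
by rewrite ler_norml => *; apply/andP; split; nra.
Qed.

Lemma intg_entry_dev i k l : intg P (fun t => (z (s i t) k 0 * z (s i t) l 0 - H k l) ^+ 2) /\
  Ex P (fun t => (z (s i t) k 0 * z (s i t) l 0 - H k l) ^+ 2) <= 1 + C.
Proof.
have mz k1 : measurable_fun [set: T] (fun t => z (s i t) k1 0).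
  exact: measurableT_comp (rm_z model k1) (rm_s model i).
have Ig : intg P (fun t => 1 + dev4 (s i t)).
  by apply: intgD; [exact: intg_cst|exact: rm_I4 model i].
have le t : (z (s i t) k 0 * z (s i t) l 0 - H k l) ^+ 2 <= 1 + dev4 (s i t).
  have := nsq_entry (z (s i t) *m (z (s i t))^T - H) k l.
  rewrite !mxE big_ord1 mxE => h; apply: (le_trans h).
  rewrite /dev4; have := sqr_ge0 (nsq (z (s i t) *m (z (s i t))^T - H) - 1).
  have := sqr_ge0 (nsq (u (s i t) *: z (s i t) - g)).
  have := nsq_ge0 (z (s i t) *m (z (s i t))^T - H); nra.
have I1 : intg P (fun t => (z (s i t) k 0 * z (s i t) l 0 - H k l) ^+ 2).
  apply: (intg_le (g := fun t => 1 + dev4 (s i t))) => // [|t]; last by rewrite ger0_norm ?sqr_ge0.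
  apply: measurable_funX; apply: measurable_funB; last exact: measurable_cst.
  exact: measurable_funM.
split => //; apply: (le_trans (Ex_le I1 Ig le)).
rewrite ExD; [|exact: intg_cst|exact: rm_I4 model i].
by rewrite Ex_cst lerD2l; exact: rm_E4 model i.
Qed.

Lemma avgH_dev : intg P (fun t => nsq (avgH (fun i => z (s i t)) - H)) /\
  Ex P (fun t => nsq (avgH (fun i => z (s i t)) - H)) <= d%:R ^+ 2 * (1 + C) / m%:R.
Proof.
have W k l := @wlln _ T R P _ T' m s (rm_s model) (rm_indep model)
  (fun x => z x k 0 * z x l 0) (H k l) (1 + C) m0
  (measurable_funM (rm_z model k) (rm_z model l)).
have I2 k l i : intg P (fun t => (z (s i t) k 0 * z (s i t) l 0) ^+ 2).
  have [I _] := intg_entry_dev i k l.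
  apply: (intg_le (g := fun t => 2 * (z (s i t) k 0 * z (s i t) l 0 - H k l) ^+ 2
     + 2 * H k l ^+ 2)) => [||t].
  - apply: measurable_funX; apply: measurable_funM.
      exact: measurableT_comp (rm_z model k) (rm_s model i).
    exact: measurableT_comp (rm_z model l) (rm_s model i).
  - by apply: intgD; [exact: intgZ|exact: intg_cst].
  rewrite ger0_norm ?sqr_ge0//.
  have := sqr_ge0 (z (s i t) k 0 * z (s i t) l 0 - 2 * H k l); nra.
have {}W k l := W k l (I2 k l) (fun i => rm_EH model i k l)
  (fun i => (intg_entry_dev i k l).2).
have e t : nsq (avgH (fun i => z (s i t)) - H) =
  \sum_k \sum_l (m%:R^-1 * (\sum_i z (s i t) k 0 * z (s i t) l 0) - H k l) ^+ 2.
  apply: eq_bigr => k _; apply: eq_bigr => l _; rewrite !mxE summxE.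
  congr ((_ * _ - _) ^+ 2); apply: eq_bigr => i _; by rewrite mxE big_ord1 mxE.
have I : intg P (fun t => \sum_k \sum_l
   (m%:R^-1 * (\sum_i z (s i t) k 0 * z (s i t) l 0) - H k l) ^+ 2).
  by apply: intg_sum => k; apply: intg_sum => l; have [] := W k l.
split; first by apply: eq_intg I => t; rewrite e.
rewrite (eq_Ex _ e) Ex_sum; last by move=> k; apply: intg_sum => l; have [] := W k l.
have -> : d%:R ^+ 2 * (1 + C) / m%:R = \sum_(k < d) \sum_(l < d) (1 + C) / m%:R.
  rewrite !sumr_const !card_ord -(mulr_natl ((1 + C) / m%:R)).
  by rewrite -(mulr_natl (_ * ((1 + C) / m%:R))); ring.
apply: ler_sum => k _; rewrite Ex_sum; last by move=> l; have [] := W k l.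
by apply: ler_sum => l _; have [] := W k l.
Qed.

Lemma infl_mean i k : Ex P (fun t => infl (s i t) k 0) = 0.
Proof.
have mz k1 : measurable_fun [set: T] (fun t => z (s i t) k1 0).
  exact: measurableT_comp (rm_z model k1) (rm_s model i).
have mu : measurable_fun [set: T] (fun t => u (s i t)).
  exact: measurableT_comp (rm_u model) (rm_s model i).
have I1 : intg P (fun t => 1 + dev4 (s i t)).
  by apply: intgD; [exact: intg_cst|exact: rm_I4 model i].
have ab (x y : R) : x ^+ 2 <= y -> `|x| <= 1 + y ^+ 2.
  move=> xy; rewrite ler_norml; have := sqr_ge0 (x - 1); have := sqr_ge0 (x + 1).
  by have := sqr_ge0 (y - 1) => *; apply/andP; split; nra.
have Iz k1 l : intg P (fun t => z (s i t) k1 0 * z (s i t) l 0 - H k1 l).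
  apply: (intg_le _ I1) => [|t].
    by apply: measurable_funB; [exact: measurable_funM|exact: measurable_cst].
  have := nsq_entry (z (s i t) *m (z (s i t))^T - H) k1 l.
  rewrite !mxE big_ord1 mxE => /ab h; apply: (le_trans h).
  by rewrite lerD2l /dev4 lerDl sqr_ge0.
have Iu k1 : intg P (fun t => u (s i t) * z (s i t) k1 0 - g k1 0).
  apply: (intg_le _ I1) => [|t].
    by apply: measurable_funB; [exact: measurable_funM|exact: measurable_cst].
  have := nsq_entry (u (s i t) *: z (s i t) - g) k1 0.
  rewrite !mxE => /ab h; apply: (le_trans h).
  by rewrite lerD2l /dev4 lerDr sqr_ge0.
have Ez k1 l : Ex P (fun t => z (s i t) k1 0 * z (s i t) l 0 - H k1 l) = 0.
  rewrite ExB; last exact: intg_cst.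
    by rewrite (rm_EH model) Ex_cst subrr.
  by apply: eq_intg (intgD (Iz k1 l) (intg_cst P (H k1 l))) => t; rewrite subrK.
have Eu k1 : Ex P (fun t => u (s i t) * z (s i t) k1 0 - g k1 0) = 0.
  rewrite ExB; last exact: intg_cst.
    by rewrite (rm_Eg model) Ex_cst subrr.
  by apply: eq_intg (intgD (Iu k1) (intg_cst P (g k1 0))) => t; rewrite subrK.
pose A := invmx (H + lam%:M).
have e t : infl (s i t) k 0 = \sum_j A k j *
   ((u (s i t) * z (s i t) j 0 - g j 0) - \sum_l beta l 0 * (z (s i t) j 0 * z (s i t) l 0 - H j l)).
  rewrite /infl score_dev mxE; apply: eq_bigr => j _; rewrite !mxE; congr (_ * (_ - _)).
  by apply: eq_bigr => l _; rewrite !mxE big_ord1 !mxE mulrC.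
have Is j : intg P (fun t => \sum_l beta l 0 * (z (s i t) j 0 * z (s i t) l 0 - H j l)).
  by apply: intg_sum => l; exact: intgZ.
rewrite (eq_Ex _ e) Ex_sum => [|j]; last by apply: intgZ; exact: intgB.
rewrite big1// => j _; rewrite ExZ; last exact: intgB.
rewrite ExB// Eu Ex_sum => [|l]; last exact: intgZ.
rewrite big1 ?subrr ?mulr0// => l _.
by rewrite ExZ// Ez mulr0.
Qed.

Lemma lin_stat_lindeberg f K : 0 <= K -> taylor2 K f ->
  `|Ex P (fun t => f (lin_stat t)) - rad (radseq ls m) f 0| <=
  K * (d%:R ^+ 2 * kappa + (Num.sqrt m%:R)^-1 *
    (1 + 8 * C ^+ 2 * (1 + C ^+ 2) * C + (\sum_(l <- ls) frobenius l) ^+ 3)).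
Proof.
move=> K0 tf.
have mi i k : measurable_fun [set: T] (fun t => infl (s i t) k 0).
  exact: measurableT_comp (coord_measurable_infl k) (rm_s model i).
have q0 : 0 <= 8 * C ^+ 2 * (1 + C ^+ 2).
  by rewrite !mulr_ge0 ?sqr_ge0// addr_ge0// sqr_ge0.
have Ig i : intg P (fun t => 8 * C ^+ 2 * (1 + C ^+ 2) * dev4 (s i t)).
  by apply: intgZ; exact: rm_I4 model i.
have I4 i : intg P (fun t => nsq (infl (s i t)) ^+ 2).
  apply: (intg_le _ (Ig i)) => [|t]; last by rewrite ger0_norm ?sqr_ge0// infl4_le.
  apply: measurable_funX; apply: (coord_borel_nsq (S := fun t => infl (s i t))).
  exact: mi.
have E4 i : Ex P (fun t => nsq (infl (s i t)) ^+ 2) <= 8 * C ^+ 2 * (1 + C ^+ 2) * C.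
  apply: (le_trans (Ex_le (I4 i) (Ig i) (fun t => infl4_le _))).
  rewrite ExZ; last exact: rm_I4 model i.
  by apply: ler_wpM2l => //; exact: rm_E4 model i.
have := lindeberg m0 (rm_s model) (rm_indep model) coord_measurable_infl I4 E4
  infl_mean (rm_cov model) K0 tf.
have -> : (fun t => f (psum s infl m t)) = (fun t => f (lin_stat t)).
  apply/funext => t; congr f; rewrite /psum /lin_stat; congr (_ *: _).
  by apply: eq_bigl => i; rewrite inE ltn_ord.
by [].
Qed.

Lemma est_stat_sub t : est_stat t - lin_stat t =
  invmx (avgH (fun i => z (s i t)) + lam%:M) *m ((H + lam%:M) *m lin_stat t) - lin_stat t.
Proof.
congr (_ - _); rewrite /est_stat ridge_est_sub//; last exact: rm_lam model.
rewrite scalemxAr; congr (_ *m _).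
have sm : Num.sqrt (m%:R : R) ^+ 2 = m%:R by rewrite sqr_sqrtr.
have sn0 : Num.sqrt (m%:R : R) != 0 by rewrite sqrtr_eq0 -ltNge ltr0n.
rewrite scalerA -{2}sm (_ : _ * _ = (Num.sqrt (m%:R : R))^-1); last by field.
rewrite /lin_stat -scalemxAr mulmx_sumr; congr (_ *: _); apply: eq_bigr => i _.
by rewrite /infl mulmxA mulmxV ?mul1mx//; exact: rm_unit model.
Qed.

Lemma coord_measurable_lin_stat : coord_measurable lin_stat.
Proof.
move=> k; have -> : (fun t => lin_stat t k 0) =
   (fun t => (Num.sqrt m%:R)^-1 * \sum_i infl (s i t) k 0).
  by apply/funext => t; rewrite mxE summxE.
apply: measurable_funM; first exact: measurable_cst.
apply: measurable_sum => i.
exact: measurableT_comp (coord_measurable_infl k) (rm_s model i).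
Qed.

Lemma measurable_le_bool dX (X : measurableType dX) (f h : X -> R) :
  measurable_fun [set: X] f -> measurable_fun [set: X] h ->
  measurable_fun [set: X] (fun x => f x <= h x).
Proof. by move=> mf mh; exact: measurable_fun_ler. Qed.

(** The indicator of the ball is trapped between [ball_step] at [t - 3 delta] and at [t]. The
    replacement moves both to Rademacher sums, where they are trapped between indicators again. *)
Lemma lin_stat_bounds (Ct K delta : R) (t : R) : 0 < delta -> 0 <= Ct -> t <= K ->
  (forall t, t <= K -> taylor2 Ct (@ball_step R d t delta)) ->
  forall err, err = Ct * (d%:R ^+ 2 * kappa + (Num.sqrt m%:R)^-1 *
    (1 + 8 * C ^+ 2 * (1 + C ^+ 2) * C + (\sum_(l <- ls) frobenius l) ^+ 3)) ->
  radF ls m (t - 3 * delta) - err <= Pr P (fun x => nsq (lin_stat x) <= t)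
    <= radF ls m (t + 3 * delta) + err.
Proof.
move=> d0 Ct0 tK tay err errE.
have mS := coord_measurable_lin_stat.
have mb a : measurable_fun [set: T] (fun x => nsq (lin_stat x) <= a).
  by apply: measurable_le_bool; [exact: coord_borel_nsq|exact: measurable_cst].
have If a : a <= K -> intg P (fun x => ball_step a delta (lin_stat x)).
  move=> /tay[b1 [b2 [[mf _ _] [bf _ _] _]]].
  by apply: intg_bounded (fun x => bf _); exact: mf.
have tK' : t - 3 * delta <= K by lra.
have := lin_stat_lindeberg Ct0 (tay _ tK); have := lin_stat_lindeberg Ct0 (tay _ tK').
rewrite -errE !ler_norml => /andP[a1 a2] /andP[b1 b2].
have A : Ex P (fun x => ball_step (t - 3 * delta) delta (lin_stat x)) <=
    Pr P (fun x => nsq (lin_stat x) <= t).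
  apply: Ex_Pr_le => [||x]; [exact: If|exact: mb|].
  by have := ball_step_le (t - 3 * delta) (lin_stat x) d0; rewrite subrK.
have A' : Pr P (fun x => nsq (lin_stat x) <= t) <= Ex P (fun x => ball_step t delta (lin_stat x)).
  apply: Ex_le => [||x]; [by apply: intg_bool; exact: mb|exact: If|exact: ball_step_ge].
have B : radF ls m (t - 3 * delta) <= rad (radseq ls m) (ball_step (t - 3 * delta) delta) 0.
  by apply: rad_le => x; exact: ball_step_ge.
have B' : rad (radseq ls m) (ball_step t delta) 0 <= radF ls m (t + 3 * delta).
  by apply: rad_le => x; exact: ball_step_le.
by apply/andP; split; lra.
Qed.

(** Unless the empirical Gram matrix is off by [r], the two statistics agree up to the relative
    error [th]; the exceptional event is bounded by Markov's inequality from [avgH_dev]. *)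
Lemma est_stat_bounds (th K delta r t : R) :
  measurable_fun [set: T] (fun x => nsq (est_stat x)) ->
  0 <= th -> th <= 6^-1 -> 0 <= K -> 6 * th * K <= delta -> t <= K ->
  0 < r -> 4 * C * r <= th ^+ 2 ->
  Pr P (fun x => nsq (lin_stat x) <= t - delta) - d%:R ^+ 2 * (1 + C) / m%:R / r <=
    Pr P (fun x => nsq (est_stat x) <= t) <=
  Pr P (fun x => nsq (lin_stat x) <= t + delta) + d%:R ^+ 2 * (1 + C) / m%:R / r.
Proof.
move=> mE t0 t6 K0 tK tle r0 Cr.
have Cr1 : 4 * C * r <= 1 by apply: (le_trans Cr); nra.
have mS := coord_measurable_lin_stat.
have mb a : measurable_fun [set: T] (fun x => nsq (lin_stat x) <= a).
  by apply: measurable_le_bool; [exact: coord_borel_nsq|exact: measurable_cst].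
have me a : measurable_fun [set: T] (fun x => nsq (est_stat x) <= a).
  by apply: measurable_le_bool => //; exact: measurable_cst.
have [ID ED] := avgH_dev.
pose bad x := r <= nsq (avgH (fun i => z (s i x)) - H).
have mbad : measurable_fun [set: T] bad.
  by apply: measurable_le_bool; [exact: measurable_cst|exact: intg_meas ID].
have Pbad : Pr P bad <= d%:R ^+ 2 * (1 + C) / m%:R / r.
  apply: (@le_trans _ _ (Ex P (fun t => nsq (avgH (fun i => z (s i t)) - H)) / r)).
    by apply: Pr_markov => // x; exact: nsq_ge0.
  by rewrite ler_pM2r// invr_gt0.
have key x : ~~ bad x ->
  (nsq (est_stat x) <= t -> nsq (lin_stat x) <= t + delta) /\
  (nsq (lin_stat x) <= t - delta -> nsq (est_stat x) <= t).
  rewrite -ltNge => /ltW nb; apply: (nsq_close_le t0 t6 K0 tK tle).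
  rewrite est_stat_sub; apply: (@le_trans _ _ (4 * C * r * nsq (lin_stat x))).
    apply: perturb_sub => //; [exact: rm_unit model| |exact: rm_A model|].
      exact: avg_unit (rm_lam model).
    by rewrite opprD addrACA subrr addr0.
  by apply: ler_wpM2r => //; exact: nsq_ge0.
apply/andP; split.
  have := Pr_or3 P (mb (t - delta)) (me t) mbad; rewrite lerBlDr => h.
  apply: le_trans (h _) _; last by rewrite lerD2l.
  move=> x hx; case: (boolP (bad x)) => [bx|nb]; first by apply/orP; right.
  by apply/orP; left; have [_ ->] := key x nb.
have := Pr_or3 P (me t) (mb (t + delta)) mbad => h.
apply: le_trans (h _) _; last by rewrite lerD2l.
move=> x hx; case: (boolP (bad x)) => [bx|nb]; first by apply/orP; right.
by apply/orP; left; have [->] := key x nb.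
Qed.

End model.
End one_sample.

(** * Measurability of matrix-valued maps *)

Section matrix_measurability.
Context (R : realType) dX (X : measurableType dX).

Definition mx_measurable p q (M : X -> 'M[R]_(p, q)) : Prop :=
  forall i j, measurable_fun [set: X] (fun x => M x i j).

Lemma eq_mx_measurable p q (M N : X -> 'M[R]_(p, q)) :
  M =1 N -> mx_measurable M -> mx_measurable N.
Proof. by move=> /funext ->. Qed.

Lemma mx_measurable_cst p q (M : 'M[R]_(p, q)) : mx_measurable (fun=> M).
Proof. by move=> i j; exact: measurable_cst. Qed.

Lemma mx_measurableD p q (M N : X -> 'M[R]_(p, q)) :
  mx_measurable M -> mx_measurable N -> mx_measurable (fun x => M x + N x).
Proof.
move=> mM mN i j; have -> : (fun x => (M x + N x) i j) = (fun x => M x i j + N x i j).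
  by apply/funext => x; rewrite mxE.
exact: measurable_funD.
Qed.

Lemma mx_measurableZ p q (a : X -> R) (M : X -> 'M[R]_(p, q)) :
  measurable_fun [set: X] a -> mx_measurable M -> mx_measurable (fun x => a x *: M x).
Proof.
move=> ma mM i j; have -> : (fun x => (a x *: M x) i j) = (fun x => a x * M x i j).
  by apply/funext => x; rewrite mxE.
exact: measurable_funM.
Qed.

Lemma mx_measurableN p q (M : X -> 'M[R]_(p, q)) :
  mx_measurable M -> mx_measurable (fun x => - M x).
Proof.
move=> mM; apply: eq_mx_measurable (mx_measurableZ (measurable_cst (-1 : R)) mM) => x.
by rewrite scaleN1r.
Qed.

Lemma mx_measurableB p q (M N : X -> 'M[R]_(p, q)) :
  mx_measurable M -> mx_measurable N -> mx_measurable (fun x => M x - N x).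
Proof. by move=> mM /mx_measurableN; exact: mx_measurableD. Qed.

Lemma mx_measurableM p q r (M : X -> 'M[R]_(p, q)) (N : X -> 'M[R]_(q, r)) :
  mx_measurable M -> mx_measurable N -> mx_measurable (fun x => M x *m N x).
Proof.
move=> mM mN i j.
have -> : (fun x => (M x *m N x) i j) = (fun x => \sum_k M x i k * N x k j).
  by apply/funext => x; rewrite mxE.
by apply: measurable_sum => k; exact: measurable_funM.
Qed.

Lemma mx_measurableT p q (M : X -> 'M[R]_(p, q)) :
  mx_measurable M -> mx_measurable (fun x => (M x)^T).
Proof.
move=> mM i j; have -> : (fun x => (M x)^T i j) = (fun x => M x j i).
  by apply/funext => x; rewrite mxE.
exact: mM.
Qed.

Lemma mx_measurable_sum p q (I : Type) (s : seq I) (M : I -> X -> 'M[R]_(p, q)) :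
  (forall i, mx_measurable (M i)) -> mx_measurable (fun x => \sum_(i <- s) M i x).
Proof.
move=> mM k l.
have -> : (fun x => (\sum_(i <- s) M i x) k l) = (fun x => \sum_(i <- s) M i x k l).
  by apply/funext => x; rewrite summxE.
by apply: measurable_sum => i; exact: mM.
Qed.

Lemma measurable_inv (f : X -> R) :
  measurable_fun [set: X] f -> measurable_fun [set: X] (fun x => (f x)^-1).
Proof.
(* The square makes the base of the real power nonnegative; at a zero of [f] both sides are 0. *)
move=> mf; have -> : (fun x => (f x)^-1) = (fun x => f x * (f x ^+ 2) `^ (-1)).
  apply/funext => x; rewrite powR_inv1 ?sqr_ge0//.
  have [->|f0] := eqVneq (f x) 0; first by rewrite invr0 mul0r.
  by field.
apply: measurable_funM => //.
exact: (measurableT_comp (measurable_powR (-1)) (measurable_funX 2 mf)).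
Qed.

Lemma measurable_det p (M : X -> 'M[R]_p) :
  mx_measurable M -> measurable_fun [set: X] (fun x => \det (M x)).
Proof.
move=> mM; rewrite /determinant; apply: measurable_sum => sg.
apply: measurable_funM; first exact: measurable_cst.
by apply: measurable_prod => i _; exact: mM.
Qed.

Lemma mx_measurable_inv p (M : X -> 'M[R]_p) : (forall x, M x \in unitmx) ->
  mx_measurable M -> mx_measurable (fun x => invmx (M x)).
Proof.
move=> uM mM.
apply: (@eq_mx_measurable _ _ (fun x => (\det (M x))^-1 *: \adj (M x))).
  by move=> x; rewrite /invmx uM.
apply: mx_measurableZ; first by apply: measurable_inv; exact: measurable_det.
move=> i j.
have -> : (fun x => (\adj (M x)) i j) =
    (fun x => (-1) ^+ (j + i) * \det (row' j (col' i (M x)))).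
  by apply/funext => x; rewrite mxE.
apply: measurable_funM; first exact: measurable_cst.
apply: measurable_det => k l.
have -> : (fun x => row' j (col' i (M x)) k l) = (fun x => M x (lift j k) (lift i l)).
  by apply/funext => x; rewrite !mxE.
exact: mM.
Qed.

Lemma measurable_nsq p q (M : X -> 'M[R]_(p, q)) :
  mx_measurable M -> measurable_fun [set: X] (fun x => nsq (M x)).
Proof.
by move=> mM; apply: measurable_sum => i; apply: measurable_sum => j; exact: measurable_funX.
Qed.

Lemma coord_mx_measurable p (v : X -> 'cV[R]_p) : coord_measurable v <-> mx_measurable v.
Proof. by split=> [mv i j|mv i]; rewrite ?ord1. Qed.

Lemma mx_measurable_ridge_est d m (lam : R) (z : X -> 'I_m -> 'cV[R]_d) (u : X -> 'I_m -> R) :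
  0 < lam -> (forall i, mx_measurable (z ^~ i)) ->
  (forall i, measurable_fun [set: X] (u ^~ i)) ->
  mx_measurable (fun x => ridge_est lam (z x) (u x)).
Proof.
move=> l0 mz mu.
have mH : mx_measurable (fun x => avgH (z x) + lam%:M).
  apply: mx_measurableD; last exact: mx_measurable_cst.
  apply: mx_measurableZ; first exact: measurable_cst.
  by apply: mx_measurable_sum => i; apply: mx_measurableM => //; exact: mx_measurableT.
apply: mx_measurableM.
  by apply: mx_measurable_inv => // x; exact: avg_unit.
apply: mx_measurableZ; first exact: measurable_cst.
by apply: mx_measurable_sum => i; exact: mx_measurableZ.
Qed.

End matrix_measurability.

Section one_sample_theorem.
Variable R : realType.

(* Everything is uniform over the model: it is applied to the sketch (whose
   population is P n) and to the bootstrap (whose population is the sketch). *)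
Lemma one_sample d (ls : seq 'cV[R]_d) (C K delta eta : R) :
  0 <= C -> 0 <= K -> 0 < delta -> 0 < eta ->
  exists2 kappa : R, 0 < kappa & exists2 M : nat, (0 < M)%N &
  forall m, (M <= m)%N ->
  forall dT (T : measurableType dT) (P : probability T R) d' (T' : measurableType d')
    (s : 'I_m -> T -> T') (z : T' -> 'cV[R]_d) (u : T' -> R) H g lam beta,
  ridge_model P s z u H g lam beta C kappa ls ->
  forall t, t <= K ->
  radF ls m (t - delta) - eta <= Pr P (fun x => nsq (lin_stat s z u H lam beta x) <= t)
    <= radF ls m (t + delta) + eta /\
  radF ls m (t - delta) - eta <= Pr P (fun x => nsq (est_stat s z u lam beta x) <= t)
    <= radF ls m (t + delta) + eta.
Proof.
move=> C0 K0 d0 e0.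
have d6 : 0 < delta / 6 by rewrite divr_gt0.
(* Smoothing loses [3 (delta / 6)], half of the window; the other half is for passing from
   [est_stat] to [lin_stat]. This passage evaluates at [t + delta / 2], whence [K + delta]. *)
have [Ct Ct0 tay] := @taylor2_ball_step R d (K + delta) (delta / 6) (addr_ge0 K0 (ltW d0)) d6.
pose G := 1 + 8 * C ^+ 2 * (1 + C ^+ 2) * C + (\sum_(l <- ls) frobenius l) ^+ 3.
have G0 : 0 <= G.
  have : 0 <= (\sum_(l <- ls) frobenius l) ^+ 3.
    by apply: exprn_ge0; apply: sumr_ge0 => *; exact: frobenius_ge0.
  have C2 : 0 <= C ^+ 2 by exact: sqr_ge0.
  have : 0 <= 8 * C ^+ 2 * (1 + C ^+ 2) * C.
    by apply: mulr_ge0 => //; apply: mulr_ge0; [exact: mulr_ge0|exact: addr_ge0].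
  by rewrite /G; lra.
have q0 : 0 <= Ct * d%:R ^+ 2 by rewrite mulr_ge0// sqr_ge0.
(* The covariance error costs [eta / 4]; [M1] bounds the moment term of the replacement by
   [eta / 4], and [M2] the Markov term. *)
pose kappa := eta / (4 * (Ct * d%:R ^+ 2 + 1)).
have k0 : 0 < kappa by rewrite divr_gt0// mulr_gt0//; lra.
have kE : Ct * (d%:R ^+ 2 * kappa) <= eta / 4.
  rewrite mulrA /kappa mulrA ler_pdivrMr ?mulr_gt0//; last lra.
  by nra.
(* The two demands of [nsq_close_le], for the window [delta / 2]; [r] below is then dictated by
   [4 C r <= th^2]. *)
pose th := Num.min 6^-1 (delta / (12 * (K + 1))).
have th0 : 0 < th by rewrite /th lt_min invr_gt0 ltr0n divr_gt0// mulr_gt0//; lra.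
have th6 : th <= 6^-1 by rewrite /th ge_min lexx.
have thK : 6 * th * K <= delta / 2.
  have : th <= delta / (12 * (K + 1)) by rewrite /th ge_min lexx orbT.
  rewrite ler_pdivlMr; last by rewrite mulr_gt0//; lra.
  have := ltW th0; nra.
pose r := th ^+ 2 / (4 * (C + 1)).
have r0 : 0 < r by rewrite divr_gt0 ?exprn_gt0// mulr_gt0//; lra.
have rC : 4 * C * r <= th ^+ 2.
  rewrite /r mulrA ler_pdivrMr; last by rewrite mulr_gt0//; lra.
  by have := sqr_ge0 th; nra.
have e4 : 0 < eta / 4 by rewrite divr_gt0.
have [M1 M10 hM1] := near_inv_sqrt (mulr_ge0 Ct0 G0) e4.
have D0 : 0 <= d%:R ^+ 2 * (1 + C) / r.
  by rewrite !mulr_ge0 ?sqr_ge0 ?invr_ge0 ?(ltW r0)//; lra.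
have [M2 M20 hM2] := near_inv D0 e4.
exists kappa => //; exists (maxn M1 M2); first by rewrite leq_max M10.
move=> m; rewrite geq_max => /andP[/[dup] M1m /hM1 m1 /hM2 m2].
move=> dT T P d' T' s z u H g lam beta mod.
have m0 : (0 < m)%N by apply: leq_trans M1m.
pose err := Ct * (d%:R ^+ 2 * kappa + (Num.sqrt m%:R)^-1 * G).
have errle : err <= eta / 2.
  rewrite /err mulrDr; have : Ct * ((Num.sqrt m%:R)^-1 * G) <= eta / 4 by rewrite mulrCA.
  lra.
have mE : measurable_fun [set: T] (fun x => nsq (est_stat s z u lam beta x)).
  apply: measurable_nsq; apply: mx_measurableZ; first exact: measurable_cst.
  apply: mx_measurableB; last exact: mx_measurable_cst.
  apply: (@mx_measurable_ridge_est R _ T d m lam (fun x i => z (s i x)) (fun x i => u (s i x))).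
  - exact: rm_lam mod.
  - move=> i; apply/coord_mx_measurable => k.
    exact: measurableT_comp (rm_z mod k) (rm_s mod i).
  - by move=> i; exact: measurableT_comp (rm_u mod) (rm_s mod i).
have L t : t <= K + delta ->
  radF ls m (t - delta / 2) - eta / 2 <=
    Pr P (fun x => nsq (lin_stat s z u H lam beta x) <= t)
    <= radF ls m (t + delta / 2) + eta / 2.
  move=> tK; have := lin_stat_bounds m0 mod d6 Ct0 tK tay (erefl _).
  rewrite -/G -/err (_ : 3 * (delta / 6) = delta / 2); last by field.
  by move=> /andP[h1 h2]; apply/andP; clear - h1 h2 errle; split; lra.
move=> t tK; split.
  have tK' : t <= K + delta by clear - tK d0; lra.
  have /andP[h1 h2] := L t tK'.
  have := @radF_le R d ls m (t - delta) (t - delta / 2).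
  have := @radF_le R d ls m (t + delta / 2) (t + delta).
  have -> : t - delta <= t - delta / 2 by clear - d0; lra.
  have -> : t + delta / 2 <= t + delta by clear - d0; lra.
  by move=> /(_ isT) h3 /(_ isT) h4; apply/andP; clear - h1 h2 h3 h4 e0; split; lra.
have := est_stat_bounds m0 mod mE (ltW th0) th6 K0 thK tK r0 rC.
have [t1 t2] : t - delta / 2 <= K + delta /\ t + delta / 2 <= K + delta.
  by clear - d0 tK; split; lra.
have /andP[h1 _] := L _ t1; have /andP[_ h2] := L _ t2.
rewrite (_ : t - delta / 2 - delta / 2 = t - delta) in h1; last by field.
rewrite (_ : t + delta / 2 + delta / 2 = t + delta) in h2; last by field.
have -> : d%:R ^+ 2 * (1 + C) / m%:R / r = d%:R ^+ 2 * (1 + C) / r / m%:R by rewrite mulrAC.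
by move=> /andP[h3 h4]; apply/andP; clear - h1 h2 h3 h4 m2 e0; split; lra.
Qed.

End one_sample_theorem.

(** * Uniform laws on finite types *)

Section average.
Variable R : realType.

Definition avg (X : finType) (f : X -> R) : R := #|X|%:R^-1 * \sum_x f x.

Lemma avg_cst (X : finType) (x0 : X) k : avg (fun=> k : R) (X := X) = k.
Proof.
rewrite /avg sumr_const -[k *+ _]mulr_natl mulrA mulVf ?mul1r// pnatr_eq0 -lt0n.
by apply/card_gt0P; exists x0.
Qed.

(** Distributivity of products over sums; in probabilistic terms, the values of a uniform random
    function are independent. *)
Lemma avg_ffun_prod (I Y : finType) (y0 : Y) (a : I -> Y -> R) :
  avg (fun f : {ffun I -> Y} => \prod_i a i (f i)) = \prod_i avg (a i).
Proof.
rewrite /avg -bigA_distr_bigA/= card_ffun natrX -exprVn big_split/=.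
by rewrite prodr_const.
Qed.

End average.

Section discrete_space.

(* The point is part of the type because g_sigma_algebraType needs a pointed
   carrier, and a finite type has no canonical one. *)
Definition pointed_at (X : choiceType) (x0 : X) : Type := X.

HB.instance Definition _ (X : choiceType) (x0 : X) := Choice.copy (pointed_at x0) X.
HB.instance Definition _ (X : choiceType) (x0 : X) := isPointed.Build (pointed_at x0) x0.

Definition discrete (X : choiceType) (x0 : X) :=
  g_sigma_algebraType [set: set (pointed_at x0)].

Lemma measurable_discrete (X : choiceType) (x0 : X) d' (U : measurableType d')
  (f : discrete x0 -> U) : measurable_fun [set: discrete x0] f.
Proof. by move=> _ A mA; exact: sub_sigma_algebra. Qed.

End discrete_space.

Section uniform.
Variables (R : realType) (X : finType) (x0 : X).

Let D := discrete x0.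

Let dirac_sum : {measure set D -> \bar R} :=
  msum (fun k => \d_(nth x0 (enum X) k : D)) #|X|.

(** The second argument of [mnormalize] is its value at total mass zero or infinity; the mass here
    is the positive number [#|X|]. *)
Definition unif : probability D R := mnormalize dirac_sum \d_(x0 : D).

Let card0 : (0 < #|X|)%N.
Proof. by apply/card_gt0P; exists x0. Qed.

Lemma dirac_sumE (A : set D) : dirac_sum A = (\sum_(x : X) (x \in A)%:R)%:E.
Proof.
have -> : \sum_(x : X) (x \in A)%:R = \sum_(x <- enum X) (x \in A)%:R :> R.
  by rewrite [RHS]big_enum; apply: eq_bigl => x; rewrite inE.
rewrite /dirac_sum /= /msum -sumEFin (big_nth x0) -cardE big_mkord.
by apply: eq_bigr => i _; exact: diracE.
Qed.

Lemma unifE (A : set D) : unif A = (avg (fun x : X => (x \in A)%:R : R))%:E.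
Proof.
have E := dirac_sumE; rewrite /unif /= /mnormalize /= !E.
have -> : \sum_(x : X) (x \in [set: D])%:R = #|X|%:R :> R.
  by rewrite (eq_bigr (fun=> 1)) ?sumr_const// => x _; rewrite in_setT.
rewrite eqe pnatr_eq0 -leqn0 leqNgt card0 /=. by rewrite E -EFinM mulrC.
Qed.

Lemma intg_unif (f : D -> R) : intg unif f.
Proof.
apply: (@intg_bounded _ _ _ _ _ (\sum_(x : X) `|f x|)); first exact: measurable_discrete.
by move=> t; rewrite (bigD1 (t : X))//= lerDl sumr_ge0.
Qed.

Lemma Ex_unif (f : D -> R) : Ex unif f = avg (f : X -> R).
Proof.
have -> : f = (fun t : D => \sum_(x : X) f x * (x == t :> X)%:R).
  apply/funext => t; rewrite (bigD1 (t : X))//= eqxx mulr1 big1 ?addr0// => x /negbTE ->.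
  by rewrite mulr0.
rewrite Ex_sum; last by move=> x; exact: intg_unif.
rewrite /avg mulr_sumr; apply: eq_bigr => x _.
rewrite ExZ; last exact: intg_unif.
have -> : Ex unif (fun t : D => (x == t :> X)%:R) = #|X|%:R^-1.
  apply/EFin_inj; rewrite -(@PrE _ _ _ unif (fun t : D => x == t :> X)); last exact: measurable_discrete.
  rewrite unifE /avg (bigD1 x)//= mem_set//= big1 ?addr0 ?mulr1// => y yx.
  by rewrite memNset//=; apply/negP; rewrite eq_sym.
rewrite mulrC; congr (_ * _); rewrite (bigD1 x)//= eqxx mulr1 big1 ?addr0// => y /negbTE ->.
by rewrite mulr0.
Qed.

End uniform.

Section uniform_product.
Variables (R : realType) (m : nat) (Y : finType) (y0 : Y).

Let x0 : {ffun 'I_m -> Y} := [ffun=> y0].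

Definition coordf (i : 'I_m) (f : discrete x0) : discrete y0 := (f : {ffun 'I_m -> Y}) i.

Lemma indep_coordf : indep_family (unif R x0) coordf.
Proof.
move=> J E mE; rewrite unifE.
transitivity ((\prod_(i in J) avg (fun y : Y => (y \in E i)%:R : R))%:E); last first.
  rewrite -prodEFin; apply: eq_bigr => i _; rewrite unifE; congr (_%:E).
  (* Equal to 1 off the index [i], so that the product over all coordinates is a function of one of
     them. *)
  pose a j (y : Y) : R := if j == i then (y \in E i)%:R else 1.
  have := avg_ffun_prod y0 a; rewrite (bigD1 i)//= [X in _ * X]big1 ?mulr1 => [|j /negbTE ji].
    rewrite /a eqxx => <-; rewrite /avg; congr (_ * _); apply: eq_bigr => f _.
    by rewrite (bigD1 i)//= eqxx big1 ?mulr1// => j /negbTE ->.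
  by rewrite /a ji -[RHS](avg_cst y0).
congr (_%:E); pose a j (y : Y) : R := if j \in J then (y \in E j)%:R else 1.
rewrite big_mkcond/=.
have -> : \prod_i (if i \in J then avg (fun y : Y => (y \in E i)%:R : R) else 1) =
    \prod_i avg (a i).
  by apply: eq_bigr => i _; rewrite /a; case: ifP => // _; rewrite (avg_cst y0).
rewrite -(avg_ffun_prod y0) /avg; congr (_ * _); apply: eq_bigr => f _.
have [h|h] := boolP ((f : discrete x0) \in \bigcap_(i in [set` J]) (coordf i @^-1` E i)).
  rewrite big1// => i _; rewrite /a; case: ifP => // iJ.
  by move: h; rewrite inE => /(_ i); rewrite /= iJ => /(_ isT) h; rewrite mem_set.
have [j jJ jE] : exists2 j, j \in J & ~ E j (f j).
  apply: contrapT => nex; move/negP: h; apply; rewrite inE => i /= iJ.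
  by apply: contrapT => nE; apply: nex; exists i.
by rewrite (bigD1 j)//= /a jJ memNset// mul0r.
Qed.

Lemma Ex_coordf (g : Y -> R) i : Ex (unif R x0) (fun f => g (coordf i f)) = avg g.
Proof.
rewrite Ex_unif.
pose a j (y : Y) : R := if j == i then g y else 1.
have := avg_ffun_prod y0 a; rewrite (bigD1 i)//= [X in _ * X]big1 ?mulr1 => [|j /negbTE ji].
  rewrite /a eqxx => <-; rewrite /avg; congr (_ * _); apply: eq_bigr => f _.
  by rewrite (bigD1 i)//= eqxx big1 ?mulr1// => j /negbTE ->.
by rewrite /a ji -[RHS](avg_cst y0).
Qed.

End uniform_product.

Section multinomial.
Variable R : realType.

(** Weights as occupation numbers of [N] draws: by [sumr_counts], weighted sums over the rows become
    plain sums over the draws. *)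
Definition counts N m (J : {ffun 'I_N -> 'I_m}) (i : 'I_m) : nat := (\sum_j (J j == i))%N.

Lemma sum_counts N m (J : {ffun 'I_N -> 'I_m}) : (\sum_i counts J i = N)%N.
Proof.
rewrite /counts exchange_big/= (eq_bigr (fun=> 1%N)) ?sum1_card ?card_ord// => j _.
by rewrite (bigD1 (J j))//= eqxx big1// => i /negbTE; rewrite eq_sym => ->.
Qed.

Lemma sumr_counts N m (J : {ffun 'I_N -> 'I_m}) (V : lmodType R) (v : 'I_m -> V) :
  \sum_i (counts J i)%:R *: v i = \sum_j v (J j).
Proof.
rewrite (eq_bigr (fun i => \sum_j (J j == i)%:R *: v i)) => [|i _]; last first.
  by rewrite /counts natr_sum scaler_suml.
rewrite exchange_big/=; apply: eq_bigr => j _.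
rewrite (bigD1 (J j))//= eqxx scale1r big1 ?addr0// => i /negbTE; rewrite eq_sym => ->.
by rewrite scale0r.
Qed.

Lemma big_ffunS (Y : finType) N (F : {ffun 'I_N.+1 -> Y} -> R) :
  \sum_J F J = \sum_(y : Y) \sum_(f : {ffun 'I_N -> Y})
    F [ffun i => if unlift ord0 i is Some j then f j else y].
Proof.
rewrite pair_bigA/=.
pose h (p : Y * {ffun 'I_N -> Y}) : {ffun 'I_N.+1 -> Y} :=
  [ffun i => if unlift ord0 i is Some j then p.2 j else p.1].
rewrite (reindex h)//; exists (fun J : {ffun 'I_N.+1 -> Y} => (J ord0, [ffun j : 'I_N => J (lift ord0 j)])).
  move=> [y f] _; rewrite /h /= ffunE unlift_none; congr (_, _).
  by apply/ffunP => j; rewrite !ffunE liftK.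
move=> J _; apply/ffunP => i; rewrite /h ffunE; case: unliftP => [j ->|->] //=.
by rewrite ffunE.
Qed.

(** Split according to the first draw [y]: the remaining draws have the counts [k] lowered by 1 at
    [y], which by induction gives [k y] times the common value [W]. Summing over [y] turns [N!] into
    [(N + 1)!]. *)
Lemma sum_counts_eq N m (k : 'I_m -> nat) :
  \sum_(J : {ffun 'I_N -> 'I_m}) [forall i, counts J i == k i]%:R =
  (if (\sum_i k i == N)%N then N`!%:R * \prod_i ((k i)`!%:R)^-1 else 0) :> R.
Proof.
elim: N k => [|N IH] k.
  pose J0 : {ffun 'I_0 -> 'I_m} := [ffun i => match i with Ordinal _ H => False_rect _ (elimF idP (ltn0 _) H) end].
  rewrite (bigD1 J0)//= big1 ?addr0; last first.
    by move=> J /eqP nJ; case: nJ; apply/ffunP => -[].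
  have c0 i : counts J0 i = 0%N by rewrite /counts big_ord0.
  rewrite sum_nat_eq0; case: ifP => [/forallP h|/negbT].
    rewrite (_ : [forall _, _] = true); last first.
      by apply/forallP => i; rewrite c0 eq_sym; exact: h.
    by rewrite big1 ?mulr1// => i _; rewrite (eqP (h i)) invr1.
  rewrite negb_forall => /existsP[i ki]; rewrite (_ : [forall _, _] = false)//.
  by apply/negbTE; rewrite negb_forall; apply/existsP; exists i; rewrite c0 eq_sym.
rewrite big_ffunS.
pose W : R := if (\sum_i k i == N.+1)%N then N`!%:R * \prod_i ((k i)`!%:R)^-1 else 0.
have key y : \sum_(f : {ffun 'I_N -> 'I_m}) [forall i, counts
    [ffun i => if unlift ord0 i is Some j then f j else y] i == k i]%:R = (k y)%:R * W.
  have cE (f : {ffun 'I_N -> 'I_m}) i : counts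
      [ffun i => if unlift ord0 i is Some j then f j else y] i = ((y == i) + counts f i)%N.
    rewrite /counts big_ord_recl ffunE unlift_none; congr addn.
    by apply: eq_bigr => j _; rewrite ffunE liftK.
  (* Truncated subtraction makes [k'] below faithful only for positive [k y]; if [k y = 0] no
     sequence starts with [y]. *)
  have [ky0|ky0] := eqVneq (k y) 0%N.
    rewrite ky0 mul0r big1// => f _; rewrite (_ : [forall _, _] = false)//.
    by apply/negbTE; rewrite negb_forall; apply/existsP; exists y; rewrite cE eqxx ky0.
  pose k' i := (k i - (y == i))%N.
  have kk' i : k i = ((y == i) + k' i)%N.
    by rewrite /k'; have [<-|_] := eqVneq y i; rewrite /= ?subn0//; lia.
  have sk : (\sum_i k i = (\sum_i k' i).+1)%N.
    rewrite (eq_bigr _ (fun i _ => kk' i)) big_split/= (bigD1 y)//= eqxx.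
    by rewrite big1 ?add1n// => i /negbTE; rewrite eq_sym => ->.
  rewrite (eq_bigr (fun f : {ffun 'I_N -> 'I_m} => [forall i, counts f i == k' i]%:R)) => [|f _]; last first.
    by congr (_%:R); congr nat_of_bool; apply: eq_forallb => i; rewrite cE (kk' i) eqn_add2l.
  rewrite IH /W sk eqSS; case: ifP => _; last by rewrite mulr0.
  rewrite mulrCA; congr (_ * _).
  rewrite (bigD1 y)//= [in RHS](bigD1 y)//= mulrA; congr (_ * _).
    rewrite (kk' y) eqxx add1n factS natrM invfM mulrA mulfV ?mul1r//.
  by apply: eq_bigr => i /negbTE; rewrite eq_sym (kk' i) => ->.
rewrite (eq_bigr _ (fun y _ => key y)) -mulr_suml /W; case: ifP => [/eqP h|_]; last by rewrite mulr0.
by rewrite -natr_sum h factS natrM mulrA.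
Qed.

Lemma multinomial_pmf_counts m (k : 'I_m -> nat) :
  multinomial_pmf m (fun _ : 'I_m => m%:R^-1 : R) k =
  avg (fun J : {ffun 'I_m -> 'I_m} => [forall i, counts J i == k i]%:R).
Proof.
rewrite /multinomial_pmf /avg sum_counts_eq card_ffun card_ord.
case: ifP => [/eqP h|_]; last by rewrite mulr0.
rewrite big_split/= prodrXr h natrX exprVn; ring.
Qed.

End multinomial.

(** * The sketch as a bootstrap population *)

Section matrix_wlln.
Context d (T : measurableType d) (R : realType) (P : probability T R).
Context d' (T' : measurableType d') (m : nat) (m0 : (0 < m)%N).
Variable s : 'I_m -> T -> T'.
Hypothesis ms : forall i, measurable_fun [set: T] (s i).
Hypothesis si : indep_family P s.

Lemma mx_wlln p q (F : T' -> 'M[R]_(p, q)) (M : 'M[R]_(p, q)) (C : R) :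
  mx_measurable F ->
  (forall i, intg P (fun t => nsq (F (s i t) - M))) ->
  (forall i, Ex P (fun t => nsq (F (s i t) - M)) <= C) ->
  (forall i k l, Ex P (fun t => F (s i t) k l) = M k l) ->
  intg P (fun t => nsq (m%:R^-1 *: (\sum_i F (s i t)) - M)) /\
  Ex P (fun t => nsq (m%:R^-1 *: (\sum_i F (s i t)) - M)) <= (p%:R * q%:R) * C / m%:R.
Proof.
move=> mF IF EC EM.
have mFs i k l : measurable_fun [set: T] (fun t => F (s i t) k l).
  exact: measurableT_comp (mF k l) (ms i).
have I2 i k l : intg P (fun t => (F (s i t) k l - M k l) ^+ 2).
  apply: (intg_le _ (IF i)) => [|t].
    by apply: measurable_funX; apply: measurable_funB => //; exact: measurable_cst.
  by rewrite ger0_norm ?sqr_ge0//; have := nsq_entry (F (s i t) - M) k l; rewrite !mxE.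
have E2 i k l : Ex P (fun t => (F (s i t) k l - M k l) ^+ 2) <= C.
  apply: le_trans (EC i); apply: Ex_le => // t.
  by have := nsq_entry (F (s i t) - M) k l; rewrite !mxE.
have I2' i k l : intg P (fun t => F (s i t) k l ^+ 2).
  apply: (intg_le (g := fun t => 2 * (F (s i t) k l - M k l) ^+ 2 + 2 * M k l ^+ 2)) => [||t].
  - exact: measurable_funX.
  - by apply: intgD; [exact: intgZ|exact: intg_cst].
  by rewrite ger0_norm ?sqr_ge0//; have := sqr_ge0 (F (s i t) k l - 2 * M k l); nra.
have W k l := @wlln _ T R P _ T' m s ms si (fun x => F x k l) (M k l) C m0 (mF k l)
  (fun i => I2' i k l) (fun i => EM i k l) (fun i => E2 i k l).
have e t : nsq (m%:R^-1 *: (\sum_i F (s i t)) - M) =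
    \sum_k \sum_l (m%:R^-1 * (\sum_i F (s i t) k l) - M k l) ^+ 2.
  by apply: eq_bigr => k _; apply: eq_bigr => l _; rewrite !mxE summxE.
have I : intg P (fun t => \sum_k \sum_l (m%:R^-1 * (\sum_i F (s i t) k l) - M k l) ^+ 2).
  by apply: intg_sum => k; apply: intg_sum => l; have [] := W k l.
split; first by apply: eq_intg I => t; rewrite e.
rewrite (eq_Ex _ e) Ex_sum; last by move=> k; apply: intg_sum => l; have [] := W k l.
have -> : p%:R * q%:R * C / m%:R = \sum_(k < p) \sum_(l < q) C / m%:R.
  rewrite !sumr_const !card_ord -(mulr_natl (C / m%:R)) -(mulr_natl (_ * (C / m%:R))).
  by ring.
apply: ler_sum => k _; rewrite Ex_sum; last by move=> l; have [] := W k l.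
by apply: ler_sum => l _; have [] := W k l.
Qed.

End matrix_wlln.

Section good_sketch.
Variable R : realType.
Variables (d m : nat) (dT : measure_display) (T : measurableType dT) (P : probability T R).
Variables (d' : measure_display) (T' : measurableType d').
Variables (s : 'I_m -> T -> T') (z : T' -> 'cV[R]_d) (u : T' -> R).
Variables (H : 'M[R]_d) (g : 'cV[R]_d) (lam : R) (beta : 'cV[R]_d).
Variables (C kappa : R) (ls : seq 'cV[R]_d) (Om : 'M[R]_d).

Definition mean_dev4 t : R := m%:R^-1 * \sum_i dev4 z u H g (s i t).

Definition moment_dev t : R :=
  nsq (avgH (fun i => z (s i t)) - H) + nsq (avgg (fun i => z (s i t)) (fun i => u (s i t)) - g)
  + nsq (m%:R^-1 *: (\sum_i infl z u H lam beta (s i t) *m (infl z u H lam beta (s i t))^T) - Om).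

(** Two kinds of control: second-order quantities are within [r] of their population values by the
    law of large numbers, while the fourth moments are only bounded, by a large [C1]. *)
Definition good (C1 r : R) t := (mean_dev4 t <= C1) && (moment_dev t <= r).

Hypothesis (m0 : (0 < m)%N) (model : ridge_model P s z u H g lam beta C kappa ls).
Hypothesis cov : forall i k l, Ex P (fun t => infl z u H lam beta (s i t) k 0 *
   infl z u H lam beta (s i t) l 0) = Om k l.

Let D := dev4 z u H g.
Let psi := infl z u H lam beta.
Let c8 := 8 * C ^+ 2 * (1 + C ^+ 2).

Let mz i k : measurable_fun [set: T] (fun t => z (s i t) k 0).
Proof. exact: measurableT_comp (rm_z model k) (rm_s model i). Qed.

Let mu i : measurable_fun [set: T] (fun t => u (s i t)).
Proof. exact: measurableT_comp (rm_u model) (rm_s model i). Qed.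

Lemma outer_measurable dX (X : measurableType dX) (v : X -> 'cV[R]_d) :
  coord_measurable v -> mx_measurable (fun x => v x *m (v x)^T).
Proof.
move=> /coord_mx_measurable mv; apply: mx_measurableM => //; exact: mx_measurableT.
Qed.

Lemma intg_mean_dev4 : intg P mean_dev4 /\ Ex P mean_dev4 <= C.
Proof.
have I : intg P (fun t => \sum_i D (s i t)) by apply: intg_sum => i; exact: rm_I4 model i.
split; first exact: intgZ.
rewrite ExZ// Ex_sum; last by move=> i; exact: rm_I4 model i.
rewrite mulrC ler_pdivrMr ?ltr0n//.
apply: (le_trans (ler_sum _ (fun i _ => rm_E4 model i))).
by rewrite sumr_const card_ord mulr_natr.
Qed.

Lemma intg_moment_dev : intg P moment_dev /\
  Ex P moment_dev <= (d%:R ^+ 2 * (1 + C) + d%:R * (1 + C)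
    + d%:R ^+ 2 * (d%:R ^+ 2 * (c8 * C))) / m%:R.
Proof.
have Dle t : 0 <= D t by exact: dev4_ge0.
have ID i : intg P (fun t => 1 + D (s i t)).
  by apply: intgD; [exact: intg_cst|exact: rm_I4 model i].
have ED i : Ex P (fun t => 1 + D (s i t)) <= 1 + C.
  by rewrite ExD; [rewrite Ex_cst lerD2l; exact: rm_E4 model i|exact: intg_cst|exact: rm_I4 model i].
have sq (x y : R) : 0 <= y -> x <= 1 + (x ^+ 2 + y) by move=> y0; have := sqr_ge0 (x - 1); nra.
have [I1 E1] := avgH_dev m0 model.
have [I2 E2] : intg P (fun t => nsq (avgg (fun i => z (s i t)) (fun i => u (s i t)) - g)) /\
   Ex P (fun t => nsq (avgg (fun i => z (s i t)) (fun i => u (s i t)) - g)) <=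
   d%:R * 1%:R * (1 + C) / m%:R.
  have nle i t : nsq (u (s i t) *: z (s i t) - g) <= 1 + D (s i t).
    by rewrite /D /dev4 [X in 1 + X]addrC; apply: sq; exact: sqr_ge0.
  have mg : mx_measurable (fun x => u x *: z x).
    by apply: mx_measurableZ; [exact: rm_u model|apply/coord_mx_measurable; exact: rm_z model].
  have I i : intg P (fun t => nsq (u (s i t) *: z (s i t) - g)).
    apply: (intg_le _ (ID i)) => [|t]; last by rewrite ger0_norm ?nsq_ge0.
    apply: measurable_nsq; apply: mx_measurableB; last exact: mx_measurable_cst.
    by apply: mx_measurableZ => //; apply/coord_mx_measurable.
  apply: (mx_wlln m0 (rm_s model) (rm_indep model) (F := fun x => u x *: z x)) => //.
  - by move=> i; apply: le_trans (ED i); exact: Ex_le.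
  - move=> i k l; rewrite ord1 -(rm_Eg model i); apply: eq_Ex => t.
    by rewrite mxE.
have mpsi := coord_measurable_infl model.
have mpsis i k : measurable_fun [set: T] (fun t => psi (s i t) k 0).
  exact: measurableT_comp (mpsi k) (rm_s model i).
have Iq i : intg P (fun t => c8 * D (s i t)) by apply: intgZ; exact: rm_I4 model i.
have C0 : 0 <= C by exact: le_trans (nsq_ge0 _) (rm_beta model).
have c80 : 0 <= c8.
  have C2 : 0 <= C ^+ 2 by exact: sqr_ge0.
  by apply: mulr_ge0; [exact: mulr_ge0|exact: addr_ge0].
have I4 i k l : intg P (fun t => (psi (s i t) k 0 * psi (s i t) l 0) ^+ 2) /\
    Ex P (fun t => (psi (s i t) k 0 * psi (s i t) l 0) ^+ 2) <= c8 * C.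
  have le t : (psi (s i t) k 0 * psi (s i t) l 0) ^+ 2 <= c8 * D (s i t).
    apply: le_trans (infl4_le model (s i t)); rewrite exprMn expr2.
    apply: ler_pM; rewrite ?sqr_ge0//; exact: nsq_entry.
  have I : intg P (fun t => (psi (s i t) k 0 * psi (s i t) l 0) ^+ 2).
    apply: (intg_le _ (Iq i)) => [|t]; last by rewrite ger0_norm ?sqr_ge0.
    by apply: measurable_funX; exact: measurable_funM.
  split => //; apply: (le_trans (Ex_le I (Iq i) le)).
  rewrite ExZ; last exact: rm_I4 model i.
  by apply: ler_wpM2l => //; exact: rm_E4 model i.
have I5 i k l := intg_infl2 model i k l.
have [I3 E3] : intg P (fun t => nsq (m%:R^-1 *: (\sum_i psi (s i t) *m (psi (s i t))^T) - Om)) /\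
   Ex P (fun t => nsq (m%:R^-1 *: (\sum_i psi (s i t) *m (psi (s i t))^T) - Om)) <=
   d%:R * d%:R * (d%:R ^+ 2 * (c8 * C)) / m%:R.
  have ne i t : nsq (psi (s i t) *m (psi (s i t))^T - Om) =
      \sum_k \sum_l (psi (s i t) k 0 * psi (s i t) l 0 - Om k l) ^+ 2.
    apply: eq_bigr => k _; apply: eq_bigr => l _; congr (_ ^+ 2).
    by rewrite [LHS]mxE [X in X + _]mxE [X in _ + X]mxE big_ord1 [X in _ * X]mxE.
  have Ie i k l : intg P (fun t => (psi (s i t) k 0 * psi (s i t) l 0 - Om k l) ^+ 2) /\
      Ex P (fun t => (psi (s i t) k 0 * psi (s i t) l 0 - Om k l) ^+ 2) <= c8 * C.
    have [J1 J2] := I4 i k l.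
    have e t : (psi (s i t) k 0 * psi (s i t) l 0 - Om k l) ^+ 2 =
      ((psi (s i t) k 0 * psi (s i t) l 0) ^+ 2 - 2 * Om k l * (psi (s i t) k 0 * psi (s i t) l 0))
      + Om k l ^+ 2 by ring.
    have J3 : intg P (fun t => 2 * Om k l * (psi (s i t) k 0 * psi (s i t) l 0)) by exact: intgZ.
    split.
      by apply: eq_intg (intgD (intgB J1 J3) (intg_cst P (Om k l ^+ 2))) => t; rewrite e.
    rewrite (eq_Ex _ e) (ExD (intgB J1 J3) (intg_cst P _)) (ExB J1 J3) ExZ// Ex_cst cov.
    by have := sqr_ge0 (Om k l); lra.
  have I i : intg P (fun t => nsq (psi (s i t) *m (psi (s i t))^T - Om)).
    apply: eq_intg (fun t => esym (ne i t)) _.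
    by apply: intg_sum => k; apply: intg_sum => l; have [] := Ie i k l.
  apply: (mx_wlln m0 (rm_s model) (rm_indep model) (F := fun x => psi x *m (psi x)^T)) => //.
  - exact: outer_measurable mpsi.
  - move=> i; rewrite (eq_Ex _ (ne i)) Ex_sum; last first.
      by move=> k; apply: intg_sum => l; have [] := Ie i k l.
    have -> : d%:R ^+ 2 * (c8 * C) = \sum_(k < d) \sum_(l < d) c8 * C.
      by rewrite !sumr_const !card_ord -(mulr_natl (c8 * C)) -(mulr_natl (_ * (c8 * C))); ring.
    apply: ler_sum => k _; rewrite Ex_sum; last by move=> l; have [] := Ie i k l.
    by apply: ler_sum => l _; have [] := Ie i k l.
  - move=> i k l; rewrite -(cov i); apply: eq_Ex => t.
    by rewrite mxE big_ord1 [X in _ * X]mxE.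
split; first by apply: intgD => //; exact: intgD.
rewrite /moment_dev (ExD (intgD I1 I2) I3) (ExD I1 I2).
lra.
Qed.

Lemma good_prob (C1 r : R) : 0 < C1 -> 0 < r ->
  measurable_fun [set: T] (good C1 r) /\
  Pr P (fun t => ~~ good C1 r t) <= C / C1 +
    (d%:R ^+ 2 * (1 + C) + d%:R * (1 + C) + d%:R ^+ 2 * (d%:R ^+ 2 * (c8 * C))) / m%:R / r.
Proof.
move=> C10 r0; have [I1 E1] := intg_mean_dev4; have [I2 E2] := intg_moment_dev.
have m1 : measurable_fun [set: T] (fun t => mean_dev4 t <= C1).
  by apply: measurable_fun_ler; [exact: intg_meas I1|exact: measurable_cst].
have m2 : measurable_fun [set: T] (fun t => moment_dev t <= r).
  by apply: measurable_fun_ler; [exact: intg_meas I2|exact: measurable_cst].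
have mG : measurable_fun [set: T] (good C1 r) by exact: measurable_and.
split => //.
apply: (le_trans (@Pr_or3 _ _ _ P (fun t => ~~ good C1 r t) (fun t => ~~ (mean_dev4 t <= C1))
  (fun t => ~~ (moment_dev t <= r)) _ _ _ _)).
- exact: measurable_neg.
- exact: measurable_neg.
- exact: measurable_neg.
- by move=> t; rewrite /good negb_and.
apply: lerD.
  apply: (@le_trans _ _ (Ex P mean_dev4 / C1)); last by rewrite ler_pM2r// invr_gt0.
  apply: Pr_markov => // [|t|t]; first exact: measurable_neg.
    by rewrite mulr_ge0 ?invr_ge0// sumr_ge0// => i _; exact: dev4_ge0.
  by rewrite -ltNge => /ltW.
apply: (@le_trans _ _ (Ex P moment_dev / r)); last by rewrite ler_pM2r// invr_gt0.
apply: Pr_markov => // [|t|t]; first exact: measurable_neg.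
  by rewrite /moment_dev !addr_ge0// nsq_ge0.
by rewrite -ltNge => /ltW.
Qed.

End good_sketch.

Section bootstrap_population.
Variable R : realType.

Lemma cross_le (x y tau : R) : 0 < tau -> `|x * y| <= (x ^+ 2 / tau + tau * y ^+ 2) / 2.
Proof.
move=> t0.
have e1 : x ^+ 2 / tau + tau * y ^+ 2 - 2 * (x * y) = (x - tau * y) ^+ 2 / tau.
  by field; rewrite gt_eqF.
have e2 : x ^+ 2 / tau + tau * y ^+ 2 + 2 * (x * y) = (x + tau * y) ^+ 2 / tau.
  by field; rewrite gt_eqF.
have p1 : 0 <= (x - tau * y) ^+ 2 / tau by rewrite divr_ge0 ?sqr_ge0// ltW.
have p2 : 0 <= (x + tau * y) ^+ 2 / tau by rewrite divr_ge0 ?sqr_ge0// ltW.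
by rewrite ler_norml; apply/andP; split; lra.
Qed.

(** Young's inequality with weight [tau]: [nsq p] is merely bounded on average and receives a small
    coefficient, [nsq (q - p)] is small on average and may receive a large one. *)
Lemma outer_diff_le d (p q : 'cV[R]_d) k l (tau : R) : 0 < tau ->
  `|q k 0 * q l 0 - p k 0 * p l 0| <= nsq (q - p) * (1 + tau^-1) + tau * nsq p.
Proof.
move=> t0; set D := q - p.
have e j : q j 0 = p j 0 + D j 0 by rewrite /D !mxE; ring.
have Dk := nsq_entry D k 0; have Dl := nsq_entry D l 0.
have pk := nsq_entry p k 0; have pl := nsq_entry p l 0.
have c1 := cross_le (D k 0) (D l 0) (ltr01 : 0 < 1 :> R).
have c2 := cross_le (D k 0) (p l 0) t0; have c3 := cross_le (D l 0) (p k 0) t0.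
have ti : 0 < tau^-1 by rewrite invr_gt0.
have h1 := ler_wpM2r (ltW ti) Dk; have h2 := ler_wpM2r (ltW ti) Dl.
have h3 := ler_wpM2l (ltW t0) pk; have h4 := ler_wpM2l (ltW t0) pl.
rewrite !e (_ : _ - _ = D k 0 * D l 0 + D k 0 * p l 0 + D l 0 * p k 0); last by ring.
apply: (le_trans (ler_normD _ _)); apply: (le_trans (lerD (ler_normD _ _) (lexx _))).
rewrite divr1 mul1r in c1; lra.
Qed.

Lemma mean_affine m (x y : 'I_m -> R) (r a b c : R) : (0 < m)%N ->
  m%:R^-1 * \sum_i (r * (a * x i + b * y i + c)) =
  r * (a * (m%:R^-1 * \sum_i x i) + b * (m%:R^-1 * \sum_i y i) + c).
Proof.
move=> m0; rewrite -mulr_sumr !big_split/= -!mulr_sumr sumr_const card_ord -(mulr_natl c).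
by field; rewrite pnatr_eq0 -lt0n.
Qed.

(** The summands bound, in this order, the squared norm of the inverse matrix, that of the sketched
    estimator, and the mean [dev4] of the bootstrap population. *)
Definition boot_const (C C1 : R) : R :=
  4 * C + (2 * C + 16 * C * (1 + C)) + (8 * C1 + 16).

(** The covariance is the delicate field: the influence vectors of the bootstrap population involve
    sketched quantities, and are compared on average over the rows with the original ones, whose
    empirical covariance is close to [Om] on a good sketch. *)
Lemma boot_model d (ls : seq 'cV[R]_d) (C C1 kappa : R) :
  0 <= C -> 0 <= C1 -> 0 < kappa -> exists2 r : R, 0 < r &
  forall m (m0 : (0 < m)%N) dT (T : measurableType dT) (P : probability T R)
    d' (T' : measurableType d') (s : 'I_m -> T -> T') (z : T' -> 'cV[R]_d) (u : T' -> R)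
    H g lam beta kappa0 (Om : 'M[R]_d) (j0 : 'I_m) t,
  ridge_model P s z u H g lam beta C kappa0 ls ->
  (forall k l, `|Om k l - (\sum_(v <- ls) v *m v^T) k l| <= kappa / 2) ->
  good s z u H g lam beta Om C1 r t ->
  ridge_model (unif R ([ffun=> j0] : {ffun 'I_m -> 'I_m})) (coordf (m := m) (y0 := j0))
    (fun j : discrete j0 => z (s j t)) (fun j : discrete j0 => u (s j t))
    (avgH (fun i => z (s i t))) (avgg (fun i => z (s i t)) (fun i => u (s i t))) lam
    (ridge_est lam (fun i => z (s i t)) (fun i => u (s i t)))
    (boot_const C C1) kappa ls.
Proof.
move=> C0 C10 k0.
have CC : 0 <= C * (1 + C) by rewrite mulr_ge0 ?addr_ge0.
pose c8 := 8 * C ^+ 2 * (1 + C ^+ 2).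
have c80 : 0 <= c8.
  have C2 : 0 <= C ^+ 2 by exact: sqr_ge0.
  by apply: mulr_ge0; [exact: mulr_ge0|exact: addr_ge0].
(* [W] bounds the mean of [nsq psi] over the rows, [b r] the squared distance of [bh] and [beta],
   and [r Q] the mean of [nsq (psih - psi)]. *)
pose W := 1 + c8 * C1.
have W0 : 0 < W by have := mulr_ge0 c80 C10; rewrite /W; lra.
pose b := 8 * C * (1 + C).
have b0 : 0 <= b by apply: mulr_ge0; [exact: mulr_ge0|exact: addr_ge0].
pose Q := 12 * C * W + 12 * C * b * (17 + 8 * C1) + 3 * b.
have Q0 : 0 <= Q.
  have q1 : 0 <= C * W by apply: mulr_ge0 => //; exact: ltW.
  have q2 : 0 <= C * b * (17 + 8 * C1) by apply: mulr_ge0; [exact: mulr_ge0|lra].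
  by rewrite /Q; lra.
(* Budget: [tau W] and [r V] cost [kappa / 8] each for the change of influence vectors, the
   empirical covariance costs [kappa / 4], and [kappa / 2] is reserved for [Om] against [ls]. *)
pose tau := kappa / (8 * W).
have tau0 : 0 < tau by rewrite divr_gt0// mulr_gt0.
have tauW : tau * W = kappa / 8 by rewrite /tau; field; rewrite gt_eqF.
pose V := Q * (1 + tau^-1) + 1.
have V0 : 0 < V.
  have : 0 <= Q * (1 + tau^-1).
    by apply: mulr_ge0 => //; have := invr_gt0 tau; rewrite tau0; lra.
  by rewrite /V; lra.
(* In this order: crude bounds, the absorption in [invmx_perturb], the term [r V], and
   [nsq cv <= (kappa / 4)^2]. *)
pose r := Num.min (Num.min 1 (4 * (C + 1))^-1) (Num.min (kappa / (8 * V)) ((kappa / 4) ^+ 2)).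
have r0 : 0 < r.
  rewrite /r !lt_min; apply/andP; split; apply/andP; split.
  - exact: ltr01.
  - by rewrite invr_gt0; apply: mulr_gt0 => //; lra.
  - by apply: divr_gt0 => //; exact: mulr_gt0.
  - by apply: exprn_gt0; exact: divr_gt0.
have [r1 r2 r3 r4] : [/\ r <= 1, r <= (4 * (C + 1))^-1, r <= kappa / (8 * V) & r <= (kappa / 4) ^+ 2].
  by rewrite /r !ge_min !lexx !orbT.
have rC : 4 * C * r <= 1.
  have : r * (4 * (C + 1)) <= 1 by rewrite -ler_pdivlMr ?mul1r//; lra.
  by have := ltW r0; nra.
have rV : r * V <= kappa / 8.
  have : r * (8 * V) <= kappa by rewrite -ler_pdivlMr// mulr_gt0.
  by lra.
exists r => // m m0 dT T P d' T' s z u H g lam beta kappa0 Om j0 t model covO.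
rewrite /good /mean_dev4 /moment_dev => /andP[hD hM].
pose zz i := z (s i t); pose uu i := u (s i t).
pose Hh := avgH zz; pose gh := avgg zz uu; pose bh := ridge_est lam zz uu.
pose Ah := invmx (Hh + lam%:M).
rewrite -/zz -/uu in hM *; rewrite -/Hh -/gh -/bh in hM *.
have lam0 := rm_lam model; have uM := rm_unit model.
have uN : Hh + lam%:M \in unitmx by exact: avg_unit.
have n1 := nsq_ge0 (Hh - H); have n2 := nsq_ge0 (gh - g).
set psi := infl z u H lam beta in hM.
set cv := m%:R^-1 *: _ - Om in hM.
have n3 := nsq_ge0 cv.
have [hH hg hcv] : [/\ nsq (Hh - H) <= r, nsq (gh - g) <= r & nsq cv <= r].
  by clear - n1 n2 n3 hM; split; lra.
have hMN : nsq (Hh + lam%:M - (H + lam%:M)) <= r by rewrite opprD addrACA subrr addr0.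
have hA : nsq Ah <= 4 * C by exact: (invmx_perturb uM uN (rm_A model) hMN rC).
have A0 := nsq_ge0 Ah.
have bb : nsq (bh - beta) <= b * r.
  have -> : bh - beta = Ah *m ((gh - g) - (Hh - H) *m beta).
    have -> : gh - g - (Hh - H) *m beta = gh - (Hh + lam%:M) *m beta.
      rewrite -(rm_g model) !mulmxDl mulNmx; apply/matrixP => i j; rewrite !mxE; ring.
    by rewrite mulmxBr mulmxA mulVmx// mul1mx.
  apply: (le_trans (nsqM _ _)).
  have h1 : nsq (gh - g - (Hh - H) *m beta) <= 2 * r + 2 * (r * C).
    apply: (le_trans (nsqB_le _ _)); apply: lerD; first by rewrite ler_pM2l.
    rewrite ler_pM2l//; apply: (le_trans (nsqM _ _)).
    by apply: ler_pM => //; [exact: nsq_ge0|exact: rm_beta model].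
  apply: (@le_trans _ _ (4 * C * (2 * r + 2 * (r * C)))).
    by apply: ler_pM => //; exact: nsq_ge0.
  by rewrite /b; clear; lra.
have bbh : nsq bh <= 2 * C + 16 * C * (1 + C).
  rewrite -[bh](subrK beta); apply: (le_trans (nsqD_le _ _)).
  have := rm_beta model; have : b * r <= b by rewrite ler_piMr.
  by rewrite /b; rewrite /b in bb; move: bb; clear; lra.
have dle i : dev4 z u Hh gh (s i t) <= 8 * dev4 z u H g (s i t) + 16.
  rewrite /dev4 -/(zz i) -/(uu i).
  have aux p q (F G G' : 'M[R]_(p, q)) : nsq (G' - G) <= r ->
      nsq (F - G') ^+ 2 <= 8 * nsq (F - G) ^+ 2 + 8.
    move=> hG; have e : F - G' = (F - G) - (G' - G) by rewrite opprB addrA subrK.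
    have := nsqB_le (F - G) (G' - G); rewrite -e => h.
    have p0 := nsq_ge0 (F - G'); have p1 := nsq_ge0 (F - G).
    have h' : nsq (F - G') <= 2 * nsq (F - G) + 2 by clear - h hG r1; lra.
    apply: (@le_trans _ _ ((2 * nsq (F - G) + 2) ^+ 2)).
      by rewrite ler_sqr ?nnegrE//; clear - p1; lra.
    have := sqr_ge0 (nsq (F - G) - 1); clear; nra.
  have := aux _ _ (zz i *m (zz i)^T) H Hh hH; have := aux _ _ (uu i *: zz i) g gh hg.
  by clear; lra.
have mi0 : 0 < (m%:R : R)^-1 by rewrite invr_gt0 ltr0n.
have avgc (c : R) : m%:R^-1 * \sum_(i < m) c = c.
  by rewrite sumr_const card_ord -[c *+ m]mulr_natl mulrA mulVf ?mul1r// pnatr_eq0 -lt0n.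
have hDh : m%:R^-1 * \sum_i dev4 z u Hh gh (s i t) <= 8 * C1 + 16.
  apply: (@le_trans _ _ (m%:R^-1 * \sum_i (8 * dev4 z u H g (s i t) + 16))).
    by rewrite ler_pM2l//; apply: ler_sum.
  by rewrite big_split/= -mulr_sumr mulrDr avgc mulrCA; clear - hD; lra.
pose psih i := Ah *m score lam bh (zz i) (uu i).
(* Exact expansion: the first term comes from the change of inverse matrix, the other two from the
   change of [beta] in the score, the last one simplified because [Ah] inverts [Hh + lam]. *)
have psiE i : psih i - psi (s i t) = Ah *m ((H - Hh) *m psi (s i t))
    - Ah *m ((zz i *m (zz i)^T - Hh) *m (bh - beta)) - (bh - beta).
  have e1 : score lam bh (zz i) (uu i) = score lam beta (zz i) (uu i)
      - (zz i *m (zz i)^T - Hh) *m (bh - beta) - (Hh + lam%:M) *m (bh - beta).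
    rewrite /score !mulmxBl !mulmxBr !mulmxDl !outer_mulmx !mul_scalar_mx.
    by apply/matrixP => k l; rewrite !mxE; ring.
  have e2 : psih i = Ah *m score lam beta (zz i) (uu i)
      - Ah *m ((zz i *m (zz i)^T - Hh) *m (bh - beta)) - (bh - beta).
    rewrite /psih e1 (mulmxBr Ah (_ - _)) (mulmxBr Ah (score _ _ _ _)).
    by rewrite (mulmxA Ah (Hh + _)) mulVmx// mul1mx.
  have e3 : Ah *m score lam beta (zz i) (uu i) - psi (s i t) = Ah *m ((H - Hh) *m psi (s i t)).
    have -> : H - Hh = (H + lam%:M) - (Hh + lam%:M) by rewrite opprD addrACA subrr addr0.
    rewrite (mulmxBl (H + _)) (mulmxBr Ah (_ *m _)) (mulmxA Ah (Hh + _)) mulVmx// mul1mx.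
    by rewrite /psi /infl (mulmxA (H + _) (invmx _)) mulmxV// mul1mx.
  by rewrite e2 -e3; apply/matrixP => k l; rewrite !mxE; ring.
have nD i : nsq (psih i - psi (s i t)) <=
    r * (12 * C * nsq (psi (s i t)) + 12 * C * b * nsq (zz i *m (zz i)^T - Hh) + 3 * b).
  have tri (x y w : 'cV[R]_d) : nsq (x - y - w) <= 3 * nsq x + 3 * nsq y + 3 * nsq w.
    rewrite !nsq_cVE !mulr_sumr -!big_split/=; apply: ler_sum => k _; rewrite !mxE.
    have := sqr_ge0 (x k 0 + y k 0); have := sqr_ge0 (x k 0 + w k 0).
    by have := sqr_ge0 (y k 0 - w k 0); clear; nra.
  rewrite psiE; apply: (le_trans (tri _ _ _)).
  have p0 := nsq_ge0 (psi (s i t)); have p1 := nsq_ge0 (zz i *m (zz i)^T - Hh).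
  have t1 : nsq (Ah *m ((H - Hh) *m psi (s i t))) <= 4 * C * (r * nsq (psi (s i t))).
    apply: (le_trans (nsqM _ _)); apply: ler_pM => //; first exact: nsq_ge0.
    by apply: (le_trans (nsqM _ _)); apply: ler_wpM2r => //; rewrite nsqC.
  have t2 : nsq (Ah *m ((zz i *m (zz i)^T - Hh) *m (bh - beta))) <=
      4 * C * (nsq (zz i *m (zz i)^T - Hh) * (b * r)).
    apply: (le_trans (nsqM _ _)); apply: ler_pM => //; first exact: nsq_ge0.
    by apply: (le_trans (nsqM _ _)); exact: ler_wpM2l.
  by move: t1 t2 bb; clear; lra.
have psi1 i : nsq (psi (s i t)) <= 1 + c8 * dev4 z u H g (s i t).
  have := infl4_le model (s i t); rewrite -/psi -/c8.
  by have := sqr_ge0 (nsq (psi (s i t)) - 1); have := nsq_ge0 (psi (s i t)); clear; nra.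
have zz1 i : nsq (zz i *m (zz i)^T - Hh) <= 1 + (8 * dev4 z u H g (s i t) + 16).
  apply: le_trans (lerD (lexx 1) (dle i)); rewrite /dev4 -/(zz i) -/(uu i).
  have := sqr_ge0 (nsq (zz i *m (zz i)^T - Hh) - 1); have := nsq_ge0 (zz i *m (zz i)^T - Hh).
  by have := sqr_ge0 (nsq (uu i *: zz i - gh)); clear; nra.
have avpsi : m%:R^-1 * \sum_i nsq (psi (s i t)) <= W.
  apply: (@le_trans _ _ (m%:R^-1 * \sum_i (1 + c8 * dev4 z u H g (s i t)))).
    by rewrite ler_pM2l//; apply: ler_sum.
  rewrite big_split/= -mulr_sumr mulrDr avgc mulrCA /W lerD2l.
  exact: ler_wpM2l.
have avzz : m%:R^-1 * \sum_i nsq (zz i *m (zz i)^T - Hh) <= 17 + 8 * C1.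
  apply: (@le_trans _ _ (m%:R^-1 * \sum_i (1 + (8 * dev4 z u H g (s i t) + 16)))).
    by rewrite ler_pM2l//; apply: ler_sum.
  by rewrite !big_split/= -mulr_sumr !mulrDr !avgc mulrCA; clear - hD; lra.
have avD : m%:R^-1 * \sum_i nsq (psih i - psi (s i t)) <= r * Q.
  apply: (@le_trans _ _ (m%:R^-1 * \sum_i
     (r * (12 * C * nsq (psi (s i t)) + 12 * C * b * nsq (zz i *m (zz i)^T - Hh) + 3 * b)))).
    by rewrite ler_pM2l//; apply: ler_sum.
  rewrite mean_affine//.
  rewrite ler_pM2l//.
  have q1 : 12 * C * (m%:R^-1 * \sum_i nsq (psi (s i t))) <= 12 * C * W.
    by apply: ler_wpM2l => //; exact: mulr_ge0.
  have q2 : 12 * C * b * (m%:R^-1 * \sum_i nsq (zz i *m (zz i)^T - Hh)) <=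
      12 * C * b * (17 + 8 * C1).
    by apply: ler_wpM2l => //; apply: mulr_ge0 => //; exact: mulr_ge0.
  by rewrite /Q; clear - q1 q2; lra.
have EQ (f : discrete j0 -> R) i : Ex (unif R ([ffun=> j0] : {ffun 'I_m -> 'I_m})) (fun x => f (coordf (m := m) i x)) =
    m%:R^-1 * \sum_j f j.
  by rewrite Ex_coordf /avg card_ord.
split.
- by move=> i; exact: measurable_discrete.
- exact: indep_coordf.
- by move=> k; exact: measurable_discrete.
- exact: measurable_discrete.
- exact: lam0.
- exact: uN.
- by apply: (le_trans hA); rewrite /boot_const; clear - CC C0 C10; lra.
- by apply: (le_trans bbh); rewrite /boot_const; clear - C0 C10; lra.
- by rewrite /bh /ridge_est mulmxA mulmxV// mul1mx.
- move=> i k l; rewrite (EQ (fun j => zz j k 0 * zz j l 0)) /Hh /avgH mxE summxE.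
  by congr (_ * _); apply: eq_bigr => j _; rewrite mxE big_ord1 mxE.
- move=> i k; rewrite (EQ (fun j => uu j * zz j k 0)) /gh /avgg mxE summxE.
  by congr (_ * _); apply: eq_bigr => j _; rewrite mxE.
- by move=> i; exact: intg_unif.
- move=> i; rewrite (EQ (fun j => dev4 z u Hh gh (s j t))).
  by apply: (le_trans hDh); rewrite /boot_const; clear - CC C0; lra.
move=> i k l; rewrite (EQ (fun j => psih j k 0 * psih j l 0)).
have c1 : `|m%:R^-1 * (\sum_j psih j k 0 * psih j l 0) -
    m%:R^-1 * (\sum_j psi (s j t) k 0 * psi (s j t) l 0)| <= kappa / 4.
  rewrite -mulrBr -sumrB normrM (ger0_norm (ltW mi0)).
  apply: (@le_trans _ _ (m%:R^-1 * \sum_j (nsq (psih j - psi (s j t)) * (1 + tau^-1)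
     + tau * nsq (psi (s j t))))).
    rewrite ler_pM2l//; apply: (le_trans (ler_norm_sum _ _ _)); apply: ler_sum => j _.
    exact: outer_diff_le.
  rewrite big_split/= -mulr_suml -mulr_sumr mulrDr mulrA [X in _ + X]mulrCA.
  have t1 : tau * (m%:R^-1 * \sum_j nsq (psi (s j t))) <= tau * W by rewrite ler_pM2l.
  have ti : 0 <= 1 + tau^-1 by rewrite addr_ge0 ?invr_ge0// ltW.
  have t2 := ler_wpM2r ti avD.
  have t3 : r * Q * (1 + tau^-1) <= r * V.
    by rewrite -mulrA ler_pM2l// /V lerDl.
  by move: t1 t2 t3 rV tauW; clear; lra.
have c2 : `|m%:R^-1 * (\sum_j psi (s j t) k 0 * psi (s j t) l 0) - Om k l| <= kappa / 4.
  have e : cv k l = m%:R^-1 * (\sum_j psi (s j t) k 0 * psi (s j t) l 0) - Om k l.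
    rewrite /cv [LHS]mxE [X in X + _]mxE [X in _ + X]mxE summxE.
    congr (_ * _ - _); apply: eq_bigr => j _.
    by rewrite [LHS]mxE big_ord1 [X in _ * X]mxE.
  rewrite -e -ler_sqr ?nnegrE ?divr_ge0 ?(ltW k0)// real_normK ?num_real//.
  by apply: le_trans (nsq_entry cv k l) _; apply: le_trans hcv _.
have := covO k l; move: c1 c2; clear; rewrite !ler_norml.
by move=> /andP[a1 a2] /andP[a3 a4] /andP[a5 a6]; apply/andP; split; lra.
Qed.

End bootstrap_population.

(** * Empirical quantiles and multinomial weights *)

Section empirical_quantile.
Variable R : realType.

Lemma emp_quantile_le B (e : 'I_B -> R) (alpha tau : R) : 0 <= tau ->
  1 - alpha <= B%:R^-1 * \sum_(b < B) (e b <= tau)%R%:R -> emp_quantile e alpha <= tau.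
Proof.
move=> t0 h; apply: ge_inf; last by split.
by exists 0 => t [].
Qed.

Lemma emp_quantile_ge B (e : 'I_B -> R) (alpha tau : R) : (0 < B)%N -> 0 <= alpha ->
  (forall t, 0 <= t -> 1 - alpha <= B%:R^-1 * \sum_(b < B) (e b <= t)%R%:R -> tau <= t) ->
  tau <= emp_quantile e alpha.
Proof.
move=> B0 a0 h; apply: lb_le_inf => [|t [t0 ht]]; last exact: h.
have s0 : 0 <= \sum_b `|e b| by exact: sumr_ge0.
(* The infimum of an empty set is 0, so a member is exhibited: this sum dominates every [e b], and
   the fraction there is 1. *)
exists (\sum_b `|e b|); split => //.
rewrite (eq_bigr (fun=> 1)) => [|b _].
  by rewrite sumr_const card_ord mulVf ?pnatr_eq0 -?lt0n//; lra.
rewrite (_ : (_ <= _) = true)// (le_trans (ler_norm _))// (bigD1 b)//= lerDl.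
exact: sumr_ge0.
Qed.

(** No [e b] below [x] already collects the mass [1 - alpha]. This is a finite expression in the
    errors, so the event [x <= quantile] is measurable without reference to the infimum. *)
Definition quantile_test B (e : 'I_B -> R) (alpha x : R) : bool :=
  \sum_b (e b < x)%R%:R * (1 - alpha <= B%:R^-1 * \sum_(c < B) (e c <= e b)%R%:R)%R%:R <= 0 :> R.

Lemma quantile_testE B (e : 'I_B -> R) (alpha x : R) : (0 < B)%N -> 0 < alpha < 1 ->
  (forall b, 0 <= e b) -> (x <= emp_quantile e alpha) = quantile_test e alpha x.
Proof.
move=> B0 /andP[a0 a1] e0; apply/idP/idP => h.
  rewrite /quantile_test big1// => b _.
  have [eb|_] := ltP (e b) x; last by rewrite mul0r.
  have [hb|_] := leP (1 - alpha) (B%:R^-1 * \sum_(c < B) (e c <= e b)%R%:R); last by rewrite mulr0.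
  by have := le_lt_trans (le_trans h (emp_quantile_le (e0 b) hb)) eb; rewrite ltxx.
apply: emp_quantile_ge => //; first exact: ltW.
move=> t t0 ht; rewrite leNgt; apply/negP => tx.
have [b0 eb0] : exists b, e b <= t.
  apply: contrapT => ne; move: ht; rewrite big1 ?mulr0; first by lra.
  by move=> b _; case: leP => // eb; exfalso; apply: ne; exists b.
(* An admissible level [t] may be lowered to the largest [e b] below it without changing the count;
   one exists because [1 - alpha > 0]. *)
case: (@arg_maxP _ _ _ b0 (fun b => e b <= t) e eb0) => b eb bmax.
have cnt : \sum_(c < B) (e c <= e b)%R%:R = \sum_(c < B) (e c <= t)%R%:R :> R.
  apply: eq_bigr => c _; congr (_%:R); congr nat_of_bool; apply/idP/idP => hc.
    exact: le_trans hc eb.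
  exact: bmax.
have : 1 <= \sum_c (e c < x)%R%:R *
    (1 - alpha <= B%:R^-1 * \sum_(c' < B) (e c' <= e c)%R%:R)%R%:R :> R.
  rewrite (bigD1 b)//= (le_lt_trans eb tx) cnt ht mul1r lerDl.
  by apply: sumr_ge0 => c _; exact: mulr_ge0.
by have := h; rewrite /quantile_test => h1 h2; have := le_trans h2 h1; rewrite ler10.
Qed.

Lemma measurable_quantile_test dX (X : measurableType dX) B (e : X -> 'I_B -> R)
    (x : X -> R) alpha :
  (forall b, measurable_fun [set: X] (e ^~ b)) -> measurable_fun [set: X] x ->
  measurable_fun [set: X] (fun t => quantile_test (e t) alpha (x t)).
Proof.
move=> me mx; apply: measurable_fun_ler; last exact: measurable_cst.
apply: measurable_sum => b; apply: measurable_funM; apply: measurable_boolR.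
  exact: measurable_fun_ltr.
apply: measurable_fun_ler; first exact: measurable_cst.
apply: measurable_funM; first exact: measurable_cst.
by apply: measurable_sum => c; apply: measurable_boolR; exact: measurable_fun_ler.
Qed.

End empirical_quantile.

Section average_lemmas.
Variable R : realType.

Lemma avg_le (X : finType) (f h : X -> R) : (forall x, f x <= h x) -> avg f <= avg h.
Proof.
by move=> fh; apply: ler_wpM2l; [rewrite invr_ge0|apply: ler_sum].
Qed.

Lemma avg_ge0 (X : finType) (f : X -> R) : (forall x, 0 <= f x) -> 0 <= avg f.
Proof. by move=> f0; rewrite mulr_ge0 ?invr_ge0// sumr_ge0. Qed.

Lemma avg_sum (X : finType) (I : Type) (s : seq I) (F : I -> X -> R) :
  avg (fun x => \sum_(i <- s) F i x) = \sum_(i <- s) avg (F i).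
Proof. by rewrite /avg exchange_big mulr_sumr. Qed.

Lemma avgZ (X : finType) (k : R) (f : X -> R) : avg (fun x => k * f x) = k * avg f.
Proof. by rewrite /avg -mulr_sumr mulrCA. Qed.

Lemma avgB (X : finType) (f h : X -> R) : avg (fun x => f x - h x) = avg f - avg h.
Proof. by rewrite /avg sumrB mulrBr. Qed.

Lemma eq_avg (X : finType) (f h : X -> R) : f =1 h -> avg f = avg h.
Proof. by move=> /funext ->. Qed.

Lemma Ex_avg dT (T : measurableType dT) (P : probability T R) (X : finType) (f : X -> T -> R) :
  (forall x, intg P (f x)) ->
  intg P (fun t => avg (f^~ t)) /\ Ex P (fun t => avg (f^~ t)) = avg (fun x => Ex P (f x)).
Proof.
move=> If; split; first by apply: intgZ; exact: intg_sum.
by rewrite /avg ExZ ?Ex_sum//; exact: intg_sum.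
Qed.

(** Chebyshev's inequality for [B] independent uniform draws from [X], with the variance of an
    indicator bounded by 1. *)
Lemma chebyshev_avg (X : finType) (x0 : X) B (a : X -> bool) (e : R) : (0 < B)%N -> 0 < e ->
  avg (fun f : {ffun 'I_B -> X} =>
    (e <= `|B%:R^-1 * (\sum_b (a (f b))%:R) - avg (fun x => (a x)%:R)|)%R%:R : R)
  <= (B%:R * e ^+ 2)^-1.
Proof.
move=> B0 e0; set p := avg (fun x => (a x)%:R : R).
have p0 : 0 <= p by exact: avg_ge0.
have p1 : p <= 1 by rewrite -[X in _ <= X](avg_cst x0 1); apply: avg_le => x; case: (a x).
have E1 i : Ex (unif R ([ffun=> x0] : {ffun 'I_B -> X}))
    (fun t => ((a (coordf (m := B) (y0 := x0) i t))%:R - p) ^+ 2) <= 1.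
  rewrite (Ex_coordf (m := B) x0 (fun x => ((a x)%:R - p) ^+ 2) i).
  rewrite -[X in _ <= X](avg_cst x0 1); apply: avg_le => x.
  by case: (a x) => /=; nra.
have [_ W2] := @wlln _ (discrete [ffun=> x0]) R (unif R ([ffun=> x0] : {ffun 'I_B -> X}))
  _ (discrete x0) B (coordf (y0 := x0)) (fun i => measurable_discrete _) (@indep_coordf R B X x0)
  (fun x => (a x)%:R) p 1 B0 (measurable_discrete _) (fun i => intg_unif _)
  (fun i => Ex_coordf (m := B) x0 (fun x => (a x)%:R : R) i) E1.
pose P := unif R ([ffun=> x0] : {ffun 'I_B -> X}).
pose dev (f : {ffun 'I_B -> X}) : R := B%:R^-1 * (\sum_b (a (f b))%:R) - p.
rewrite -(@Ex_unif R _ ([ffun=> x0] : {ffun 'I_B -> X}) (fun f => (e <= `|dev f|)%R%:R)).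
rewrite -/(Pr P (fun f => e <= `|dev f|)).
have e2 : 0 < e ^+ 2 by exact: exprn_gt0.
apply: (@le_trans _ _ (Ex P (fun f => dev f ^+ 2) / e ^+ 2)).
  apply: Pr_markov => //.
  - exact: measurable_discrete.
  - exact: intg_unif.
  - by move=> f; exact: sqr_ge0.
  move=> f h; rewrite -[dev f ^+ 2]real_normK ?num_real//.
  by rewrite ler_sqr ?nnegrE// ltW.
rewrite (invfM B%:R) ler_pM2r ?invr_gt0// -[X in _ <= X]mul1r; exact: W2.
Qed.

End average_lemmas.

Lemma bigsetU_ord (U : Type) m (F : 'I_m -> set U) :
  \big[setU/set0]_(i < m) F i = [set x | exists i, F i x].
Proof.
apply/seteqP; split => [|x [i Fx]]; last by rewrite (bigD1 i)//=; left.
apply: (big_ind (fun A => A `<=` [set x | exists i, F i x])) => //.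
  by move=> A A' hA hA' x [/hA|/hA'].
by move=> i _ x Fx; exists i.
Qed.

(** * The multinomial weights given the sketch *)

Section bootstrap_law.
Context dT (T : measurableType dT) (R : realType) (P : probability T R).

Lemma measurable_forall (I : finType) (c : I -> T -> bool) :
  (forall i, measurable_fun [set: T] (c i)) ->
  measurable_fun [set: T] (fun t => [forall i, c i t]).
Proof.
move=> mc; have -> : (fun t => [forall i, c i t]) = (fun t => \big[andb/true]_(i : I) c i t).
  by apply/funext => t; rewrite big_andE.
elim: (index_enum I) => [|i r IH].
  by apply: eq_measurable_fun (measurable_cst true) => t _; rewrite big_nil.
by apply: eq_measurable_fun (measurable_and (mc i) IH) => t _; rewrite big_cons.
Qed.

Context d' (T' : measurableType d') (m B : nat).
Variables (S : 'I_m -> {RV P >-> T'}) (w : 'I_B -> 'I_m -> {RV P >-> nat}).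
Hypothesis w_law : multinomial_draws_given S w.

Let sT := g_sigma_algebraType (\big[setU/set0]_(i < m)
  preimage_set_system setT (S i : T -> T') measurable).

Lemma sigma_sketch_measurable (A : set T) :
  g_sigma_preimage (fun i => S i : T -> T') A -> measurable A.
Proof.
apply: smallest_sub; first exact: sigma_algebra_measurable.
rewrite bigsetU_ord => _ [i [E mE <-]].
by rewrite setTI; exact: measurable_funPTI.
Qed.

Lemma measurable_sketch i : measurable_fun [set: sT] (S i : sT -> T').
Proof.
move=> _ E mE; apply: sub_sigma_algebra.
by rewrite bigsetU_ord; exists i; exists E => //; rewrite setTI.
Qed.

Lemma measurable_sketchW d2 (U : measurableType d2) (f : T -> U) :
  measurable_fun [set: sT] (f : sT -> U) -> measurable_fun [set: T] f.
Proof. by move=> mf _ A mA; have := mf measurableT A mA; exact: sigma_sketch_measurable. Qed.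

Let counts_of (f : {ffun 'I_B -> {ffun 'I_m -> 'I_m}}) : 'I_B -> 'I_m -> nat :=
  fun b i => counts (f b) i.

(** Counts of [m] draws are at most [m], so this finite grid carries the whole law of the weights
    and total probability is a finite sum. *)
Let K := {ffun 'I_B -> {ffun 'I_m -> 'I_m.+1}}.
Let val_of (k : K) : 'I_B -> 'I_m -> nat := fun b i => k b i.

Let weight (k : K) : R :=
  \prod_(b < B) multinomial_pmf m (fun _ : 'I_m => m%:R^-1) (val_of k b).

Lemma sum_weight (phi : ('I_B -> 'I_m -> nat) -> R) :
  \sum_(k : K) phi (val_of k) * weight k = avg (fun f => phi (counts_of f)).
Proof.
pose ind (k : K) (f : {ffun 'I_B -> {ffun 'I_m -> 'I_m}}) : R :=
  \prod_b [forall i, counts (f b) i == val_of k b i]%:R.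
have wE k : weight k = avg (ind k).
  rewrite /ind (avg_ffun_prod [ffun i => i]
    (fun b (J : {ffun 'I_m -> 'I_m}) => [forall i, counts J i == val_of k b i]%:R)).
  by apply: eq_bigr => b _; exact: multinomial_pmf_counts.
under eq_bigr do rewrite wE -avgZ.
rewrite -avg_sum; apply: eq_avg => f.
pose k0 : K := [ffun b => [ffun i => inord (counts (f b) i)]].
have k0E b i : val_of k0 b i = counts (f b) i.
  rewrite /val_of !ffunE inordK// ltnS -[X in (_ <= X)%N](sum_counts (f b)).
  by rewrite (bigD1 i)//= leq_addr.
rewrite (bigD1 k0)//= [X in _ + X]big1 ?addr0 => [|k kk0].
  rewrite /ind big1 ?mulr1 => [|b _].
    by congr phi; apply/funext => b; apply/funext => i; rewrite k0E.
  by rewrite (_ : [forall _, _] = true)//; apply/forallP => i; rewrite k0E.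
have [b /forallPn[i bi]] : exists b, ~~ [forall i, counts (f b) i == val_of k b i].
  apply/existsP; rewrite -negb_forall; apply: contra kk0 => /forallP h.
  apply/eqP/ffunP => b; apply/ffunP => i; apply: val_inj.
  by have /forallP/(_ i)/eqP := h b; rewrite -k0E => /esym.
rewrite /ind (bigD1 b)//= (_ : [forall _, _] = false) ?mul0r ?mulr0//.
by apply/negbTE/forallPn; exists i.
Qed.

(** Total probability over the values of the weights: with the weights frozen, the event belongs to
    the sigma-algebra of the sketch, so [w_law] factors its probability; the weights are then
    rewritten as counts of uniform draws. *)
Lemma boot_law (ev : T -> ('I_B -> 'I_m -> nat) -> bool) :
  (forall k, measurable_fun [set: sT] (ev ^~ k : sT -> bool)) ->
  measurable_fun [set: T] (fun t => ev t (fun b i => w b i t)) ->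
  Pr P (fun t => ev t (fun b i => w b i t)) = avg (fun f => Pr P (ev ^~ (counts_of f))).
Proof.
move=> mev mevw.
pose W (k : K) t := [forall b, [forall i, w b i t == val_of k b i]].
have mW k : measurable_fun [set: T] (W k).
  apply: measurable_forall => b; apply: measurable_forall => i.
  by apply: measurable_fun_eqn => //; exact: measurable_cst.
have mevT k : measurable_fun [set: T] (ev ^~ k) by exact: measurable_sketchW (mev k).
have mAW k : measurable_fun [set: T] (fun t => ev t (val_of k) && W k t).
  exact: measurable_and.
have WE k : [set t | W k t] = [set t | forall b i, w b i t = val_of k b i].
  apply/seteqP; split => t /=.
    by move=> /forallP h b i; have /forallP/(_ i)/eqP := h b.
  by move=> h; apply/forallP => b; apply/forallP => i; rewrite h.
have PAW k : Pr P (fun t => ev t (val_of k) && W k t) = Pr P (ev ^~ (val_of k)) * weight k.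
  apply: EFin_inj; rewrite -(PrE P (mAW k)).
  have -> : [set t | ev t (val_of k) && W k t] = [set t | ev t (val_of k)] `&`
      [set t | forall b i, w b i t = val_of k b i].
    by rewrite -WE; apply/seteqP; split => t /= => [/andP[]|[-> ->]].
  rewrite w_law; first by rewrite EFinM -(PrE P (mevT (val_of k))).
  exact: measurable_set_bool (mev (val_of k)).
have PW k : Pr P (W k) = weight k.
  apply: EFin_inj; rewrite -(PrE P (mW k)) WE.
  rewrite -[X in P X]setTI w_law ?probability_setT ?mul1e//.
  exact: (@measurableT _ sT).
(* [h] indicates that the weights take values in the grid. It has mean 1, so the part of the event
   where [h = 0] is negligible; the weights are not bounded pointwise. *)
pose h t : R := \sum_k (W k t)%:R.
have IW k : intg P (fun t => (W k t)%:R) by exact: intg_bool.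
have Ih : intg P h by exact: intg_sum.
have Eh : Ex P h = 1.
  rewrite Ex_sum//; under eq_bigr do rewrite -/(Pr P (W _)) PW -[weight _]mul1r.
  rewrite (sum_weight (fun=> 1)).
  exact: (avg_cst [ffun=> [ffun i => i]]).
have h01 t : h t = 0 \/ h t = 1 /\ exists2 k, W k t & val_of k = (fun b i => w b i t).
  have [[k Wk]|nW] := pselect (exists k, W k t); last first.
    by left; apply: big1 => k _; case: (boolP (W k t)) => // Wk; case: nW; exists k.
  have e k' : W k' t -> val_of k' = (fun b i => w b i t).
    move=> /forallP hk; apply/funext => b; apply/funext => i.
    by have /forallP/(_ i)/eqP := hk b.
  right; split; last by exists k => //; exact: e.
  rewrite /h (bigD1 k)//= Wk big1 ?addr0// => k' kk'.
  case: (boolP (W k' t)) => // Wk'; case/eqP: kk'.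
  apply/ffunP => b; apply/ffunP => i; apply: val_inj.
  have := e _ Wk; rewrite -(e _ Wk') => /funeqP/(_ b)/funeqP/(_ i).
  by rewrite /val_of.
pose evs t : R := \sum_k (ev t (val_of k) && W k t)%:R.
have Is : intg P evs by apply: intg_sum => k; exact: intg_bool.
have Ie := intg_bool P mevw.
have lo t : evs t <= (ev t (fun b i => w b i t))%:R.
  have [ht|[ht [k Wk e]]] := h01 t.
    rewrite /evs big1// => k _; case: (boolP (W k t)) => Wk; last by rewrite andbF.
    have : (W k t)%:R <= h t by rewrite /h (bigD1 k)//= lerDl sumr_ge0.
    by rewrite ht Wk ler10.
  case: (boolP (ev t (fun b i => w b i t))) => hev.
    rewrite -ht; apply: ler_sum => k' _; rewrite ler_nat.
    by case: (W k' t); rewrite ?andbF// andbT leq_b1.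
  rewrite /evs big1// => k' _; case: (boolP (W k' t)) => Wk'; last by rewrite andbF.
  have -> : val_of k' = (fun b i => w b i t).
    move/forallP: Wk' => hk; apply/funext => b; apply/funext => i.
    by have /forallP/(_ i)/eqP := hk b.
  by rewrite (negbTE hev).
have hi t : (ev t (fun b i => w b i t))%:R <= evs t + (1 - h t).
  have [ht|[ht [k Wk e]]] := h01 t.
    rewrite ht subr0; apply: (@le_trans _ _ 1); first by case: (ev _ _).
    by rewrite lerDr; apply: sumr_ge0.
  rewrite ht subrr addr0 /evs (bigD1 k)//= Wk andbT e lerDl.
  exact: sumr_ge0.
transitivity (Ex P evs).
  apply/eqP; rewrite eq_le; apply/andP; split; last exact: Ex_le.
  apply: (@le_trans _ _ (Ex P (fun t => evs t + (1 - h t)))).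
    by apply: Ex_le => //; apply: intgD => //; apply: intgB => //; exact: intg_cst.
  rewrite ExD//; last by apply: intgB => //; exact: intg_cst.
  by rewrite (ExB (intg_cst P 1) Ih) Ex_cst Eh subrr addr0.
rewrite Ex_sum; last by move=> k; exact: intg_bool.
under eq_bigr do rewrite -/(Pr P _) PAW.
exact: (sum_weight (fun k => Pr P (ev ^~ k))).
Qed.

End bootstrap_law.

(** * From the bootstrap law to the coverage probability *)

Section coverage.
Context dT (T : measurableType dT) (R : realType) (P : probability T R).
Context d' (T' : measurableType d') (m B : nat) (B0 : (0 < B)%N).
Variables (S : 'I_m -> {RV P >-> T'}) (w : 'I_B -> 'I_m -> {RV P >-> nat}).
Hypothesis w_law : multinomial_draws_given S w.

Let sT := g_sigma_algebraType (\big[setU/set0]_(i < m)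
  preimage_set_system setT (S i : T -> T') measurable).

Variables (err : T -> ('I_m -> nat) -> R) (x : T -> R) (G : T -> bool).
Variables (alpha tau1 tau2 e : R).
Hypothesis alpha01 : 0 < alpha < 1.
Hypothesis e0 : 0 < e.
Hypothesis tau2_ge0 : 0 <= tau2.
Hypothesis err_ge0 : forall t k, 0 <= err t k.
Hypothesis merr : forall k, measurable_fun [set: sT] (err ^~ k : sT -> R).
Hypothesis mx : measurable_fun [set: sT] (x : sT -> R).
Hypothesis merrw : forall b, measurable_fun [set: T] (fun t => err t (fun i => w b i t)).
Hypothesis mG : measurable_fun [set: T] G.

Let boot t tau : R :=
  avg (fun J : {ffun 'I_m -> 'I_m} => (err t (counts J) <= tau)%R%:R).

Hypothesis boot1 : forall t, G t -> boot t tau1 <= 1 - alpha - e.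
Hypothesis boot2 : forall t, G t -> 1 - alpha + e <= boot t tau2.

Let q t (f : {ffun 'I_B -> {ffun 'I_m -> 'I_m}}) : R :=
  emp_quantile (fun b => err t (counts (f b))) alpha.

Let inv_e : R := (B%:R * e ^+ 2)^-1.

Let J0 : {ffun 'I_m -> 'I_m} := [ffun i => i].

Let cheb t tau : avg (fun f : {ffun 'I_B -> {ffun 'I_m -> 'I_m}} =>
    (e <= `|B%:R^-1 * (\sum_b (err t (counts (f b)) <= tau)%R%:R) - boot t tau|)%R%:R)
  <= inv_e.
Proof. exact: (chebyshev_avg J0 (fun J => err t (counts J) <= tau) B0 e0). Qed.

(** The sketch is fixed and only the draws are averaged. If [tau2 < x <= quantile], the empirical
    fraction at [tau2] is below [1 - alpha], although the bootstrap law gives [1 - alpha + e]: a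
    deviation of [e]. [cover_ge] is symmetric, at [tau1]. *)
Lemma cover_le t : avg (fun f => (x t <= q t f)%R%:R) <=
  (x t <= tau2)%R%:R + (~~ G t)%:R + inv_e.
Proof.
have a1 : avg (fun f => (x t <= q t f)%R%:R) <= 1 :> R.
  rewrite -[X in _ <= X](avg_cst ([ffun=> J0] : {ffun 'I_B -> {ffun 'I_m -> 'I_m}})).
  by apply: avg_le => f; case: (x t <= q t f).
have i0 : 0 <= inv_e.
  by rewrite /inv_e invr_ge0; apply: mulr_ge0 => //; exact: sqr_ge0.
have [xt|xt] := leP (x t) tau2.
  by rewrite -addrA ler_wpDr// addr_ge0.
case: (boolP (G t)) => Gt /=; last by rewrite add0r ler_wpDr.
rewrite !add0r; apply: le_trans (cheb t tau2); apply: avg_le => f; rewrite ler_nat.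
case: leP => //= xq; rewrite lt0b.
have h : B%:R^-1 * (\sum_b (err t (counts (f b)) <= tau2)%R%:R) < 1 - alpha.
  rewrite ltNge; apply/negP => /(emp_quantile_le tau2_ge0) h.
  by have := lt_le_trans xt (le_trans xq h); rewrite ltxx.
rewrite -normrN opprB; apply: le_trans (ler_norm _); rewrite lerBrDr.
by apply: le_trans (boot2 Gt); rewrite addrC lerD2r; exact: ltW h.
Qed.

Lemma cover_ge t : (x t <= tau1)%R%:R - (~~ G t)%:R - inv_e <=
  avg (fun f => (x t <= q t f)%R%:R).
Proof.
have a0 : 0 <= avg (fun f => (x t <= q t f)%R%:R) :> R by exact: avg_ge0.
have i0 : 0 <= inv_e.
  by rewrite /inv_e invr_ge0; apply: mulr_ge0 => //; exact: sqr_ge0.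
have [xt|xt] := leP (x t) tau1; last first.
  by apply: le_trans a0; rewrite sub0r; have := ler0n R (~~ G t); lra.
case: (boolP (G t)) => Gt /=; last by apply: le_trans a0; rewrite subrr sub0r oppr_le0.
rewrite subr0 lerBlDr addrC -lerBlDr.
rewrite -[X in X - _](avg_cst ([ffun=> J0] : {ffun 'I_B -> {ffun 'I_m -> 'I_m}})) -avgB.
apply: le_trans (cheb t tau1); apply: avg_le => f.
case: (leP (x t) (q t f)) => xq /=; first by rewrite subrr ler0n.
rewrite subr0 ler1n lt0b.
have /andP[al0 al1] := alpha01.
have h : 1 - alpha <= B%:R^-1 * (\sum_b (err t (counts (f b)) <= tau1)%R%:R).
  rewrite leNgt; apply/negP => h; have : tau1 <= q t f.
    apply: emp_quantile_ge => // [|s s0 hs]; first exact: ltW.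
    rewrite leNgt; apply/negP => st; have := lt_le_trans h hs.
    rewrite ltNge => /negP; apply; apply: ler_wpM2l; first by rewrite invr_ge0.
    apply: ler_sum => b _; rewrite ler_nat.
    by case: (leP (err t (counts (f b))) s) => // h1; rewrite (le_trans h1 (ltW st)).
  by move=> h1; have := le_lt_trans (le_trans xt h1) xq; rewrite ltxx.
apply: le_trans (ler_norm _); rewrite lerBrDr; apply: le_trans h.
have := boot1 Gt; rewrite -(lerD2l e).
by rewrite (_ : e + (1 - alpha - e) = 1 - alpha)//; ring.
Qed.

(** As [tau1] and [tau2] are constants, integrating the bounds for a fixed sketch leaves only the
    law of [x]; its dependence on the quantile has disappeared. *)
Lemma coverage : exists2 p : R,
  P [set t | x t <= emp_quantile (fun b => err t (fun i => w b i t)) alpha] = p%:E &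
  Pr P (fun t => x t <= tau1) - Pr P (fun t => ~~ G t) - inv_e <= p <=
  Pr P (fun t => x t <= tau2) + Pr P (fun t => ~~ G t) + inv_e.
Proof.
pose ev t (k : 'I_B -> 'I_m -> nat) := quantile_test (fun b => err t (k b)) alpha (x t).
have evE t k : (x t <= emp_quantile (fun b => err t (k b)) alpha) = ev t k.
  by apply: quantile_testE.
have mxT : measurable_fun [set: T] x by exact: (measurable_sketchW (S := S) mx).
have mev k : measurable_fun [set: sT] (ev ^~ k : sT -> bool).
  by apply: measurable_quantile_test => // b; exact: merr.
have mevT k : measurable_fun [set: T] (ev ^~ k).
  exact: (measurable_sketchW (S := S) (mev k)).
have mevw : measurable_fun [set: T] (fun t => ev t (fun b i => w b i t)).
  by apply: measurable_quantile_test.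
exists (Pr P (fun t => ev t (fun b i => w b i t))).
  rewrite -(PrE P mevw); congr (P _); apply/seteqP.
  by split => t /=; rewrite (evE t (fun b i => w b i t)).
rewrite (boot_law w_law mev mevw).
have [If Ef] := Ex_avg (P := P)
  (f := fun (f : {ffun 'I_B -> {ffun 'I_m -> 'I_m}}) t => (ev t (fun b i => counts (f b) i))%:R)
  (fun f => intg_bool P (mevT _)).
rewrite -Ef.
have E t : avg (fun f : {ffun 'I_B -> {ffun 'I_m -> 'I_m}} =>
    (ev t (fun b i => counts (f b) i))%:R) = avg (fun f => (x t <= q t f)%R%:R) :> R.
  by apply: eq_avg => f; rewrite -(evE t (fun b i => counts (f b) i)).
have mle tau : measurable_fun [set: T] (fun t => x t <= tau).
  by apply: measurable_fun_ler => //; exact: measurable_cst.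
have mnG : measurable_fun [set: T] (fun t => ~~ G t) by exact: measurable_neg.
have Ile tau : intg P (fun t => (x t <= tau)%R%:R) by exact: intg_bool.
have InG : intg P (fun t => (~~ G t)%:R) by exact: intg_bool.
have Ii c : intg P (fun=> c : R) by exact: intg_cst.
apply/andP; split.
  rewrite -[inv_e](Ex_cst P) /Pr -(ExB (Ile tau1) InG) -ExB//; last exact: intgB.
  by apply: Ex_le => // [|t]; [apply: intgB => //; exact: intgB|rewrite E; exact: cover_ge].
rewrite -[inv_e](Ex_cst P) /Pr -(ExD (Ile tau2) InG) -ExD//; last exact: intgD.
by apply: Ex_le => // [|t]; [apply: intgD => //; exact: intgD|rewrite E; exact: cover_le].
Qed.

End coverage.

(** * The sketched estimator *)

Section frozen_measurability.
Variable R : realType.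

Lemma measurable_sqrtr dX (X : measurableType dX) (f : X -> R) :
  measurable_fun [set: X] f -> measurable_fun [set: X] (fun x => Num.sqrt (f x)).
Proof.
move=> mf; apply: (measurableT_comp _ mf).
by apply: continuous_measurable_fun; exact: sqrt_continuous.
Qed.

Lemma measurable_borel_cV n i : measurable_fun [set: borel_cV R n] (fun s : 'cV[R]_n => s i 0).
Proof.
apply: (measurability _ (RGenOpens.measurableE R)) => _ [_ [a [b ->] <-]].
rewrite setTI; apply: sub_sigma_algebra.
have /continuousP := @coord_continuous R n 1 i 0; apply; exact: interval_open.
Qed.

Section data.
Variables (n d : nat) (X : 'M[R]_(n, d)) (y : 'cV[R]_n) (lam : R).
Context dZ (Z : measurableType dZ).

Lemma mx_measurable_zvec (s : Z -> 'cV[R]_n) :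
  mx_measurable s -> mx_measurable (fun t => zvec X (s t)).
Proof.
move=> ms; apply: mx_measurableZ; first exact: measurable_cst.
by apply: mx_measurableM => //; exact: mx_measurable_cst.
Qed.

Lemma measurable_uval (s : Z -> 'cV[R]_n) :
  mx_measurable s -> measurable_fun [set: Z] (fun t => uval y (s t)).
Proof.
move=> ms; apply: measurable_funM; first exact: measurable_cst.
by apply: (mx_measurableM (M := fun=> y^T)) => //; exact: mx_measurable_cst.
Qed.

Variables (m : nat) (lam_gt0 : 0 < lam).

Lemma bootH_unit (S : 'I_m -> 'cV[R]_n) (w : 'I_m -> nat) : bootH X S w + lam%:M \in unitmx.
Proof.
apply: psd_addr_unit => //; split.
  rewrite /bootH linearZ/= linear_sum/=; congr (_ *: _); apply: eq_bigr => i _.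
  by rewrite linearZ/= trmx_mul trmxK.
move=> x; rewrite /bootH /qf -scalemxAr -scalemxAl mxE mulr_ge0 ?invr_ge0//.
rewrite mulmx_sumr mulmx_suml summxE; apply: sumr_ge0 => i _.
rewrite -scalemxAr -scalemxAl mxE; apply: mulr_ge0 => //.
by rewrite -/(qf _ _ _) qf_outer sqr_ge0.
Qed.

Variables (S : Z -> 'I_m -> 'cV[R]_n) (w : Z -> 'I_m -> nat).
Hypothesis mS : forall i, mx_measurable (S ^~ i).
Hypothesis mw : forall i, measurable_fun [set: Z] (w ^~ i).

Lemma mx_measurable_sketchH : mx_measurable (fun t => sketchH X (S t)).
Proof.
apply: mx_measurableZ; first exact: measurable_cst.
apply: mx_measurable_sum => i; apply: mx_measurableM; first exact: mx_measurable_zvec.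
by apply: mx_measurableT; exact: mx_measurable_zvec.
Qed.

Lemma mx_measurable_sketchg : mx_measurable (fun t => sketchg X y (S t)).
Proof.
apply: mx_measurableZ; first exact: measurable_cst.
apply: mx_measurable_sum => i; apply: mx_measurableZ; first exact: measurable_uval.
exact: mx_measurable_zvec.
Qed.

Lemma mx_measurable_sketchA : mx_measurable (fun t => sketchA X lam (S t)).
Proof.
apply: mx_measurable_inv => [t|]; first exact: avg_unit.
by apply: mx_measurableD; [exact: mx_measurable_sketchH|exact: mx_measurable_cst].
Qed.

Lemma mx_measurable_sketch_beta : mx_measurable (fun t => sketch_beta X y lam (S t)).
Proof.
by apply: mx_measurableM; [exact: mx_measurable_sketchA|exact: mx_measurable_sketchg].
Qed.

Let mwR i : measurable_fun [set: Z] (fun t => (w t i)%:R : R).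
Proof. exact: (measurableT_comp (f := fun k : nat => k%:R : R)). Qed.

Lemma mx_measurable_bootH : mx_measurable (fun t => bootH X (S t) (w t)).
Proof.
apply: mx_measurableZ; first exact: measurable_cst.
apply: mx_measurable_sum => i; apply: mx_measurableZ => //.
apply: mx_measurableM; first exact: mx_measurable_zvec.
by apply: mx_measurableT; exact: mx_measurable_zvec.
Qed.

Lemma mx_measurable_bootg : mx_measurable (fun t => bootg X y (S t) (w t)).
Proof.
apply: mx_measurableZ; first exact: measurable_cst.
apply: mx_measurable_sum => i; apply: mx_measurableZ => //.
apply: mx_measurableZ; first exact: measurable_uval.
exact: mx_measurable_zvec.
Qed.

Lemma measurable_frobenius p q (M : Z -> 'M[R]_(p, q)) :
  mx_measurable M -> measurable_fun [set: Z] (fun t => frobenius (M t)).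
Proof. by move=> mM; apply: measurable_sqrtr; exact: measurable_nsq. Qed.

Lemma measurable_boot_err : measurable_fun [set: Z] (fun t => boot_err X y lam (S t) (w t)).
Proof.
apply: measurable_frobenius; apply: mx_measurableB; last exact: mx_measurable_sketch_beta.
apply: mx_measurableM; last exact: mx_measurable_bootg.
apply: mx_measurable_inv => [t|]; first exact: bootH_unit.
by apply: mx_measurableD; [exact: mx_measurable_bootH|exact: mx_measurable_cst].
Qed.

Lemma measurable_lin_boot_err :
  measurable_fun [set: Z] (fun t => lin_boot_err X y lam (S t) (w t)).
Proof.
apply: measurable_frobenius; apply: mx_measurableM; first exact: mx_measurable_sketchA.
apply: mx_measurableB.
  by apply: mx_measurableB; [exact: mx_measurable_bootg|exact: mx_measurable_sketchg].
apply: mx_measurableM; last exact: mx_measurable_sketch_beta.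
by apply: mx_measurableB; [exact: mx_measurable_bootH|exact: mx_measurable_sketchH].
Qed.

End data.

(** Converts thresholds for errors, of order [1 / sqrt m], to those for squared norms of normalized
    statistics. *)
Lemma frobenius_le_sqrt p q (M : 'M[R]_(p, q)) m (t : R) : (0 < m)%N -> 0 <= t ->
  (frobenius M <= Num.sqrt (t / m%:R)) = (nsq (Num.sqrt m%:R *: M) <= t).
Proof.
move=> m0 t0; rewrite -ler_sqr ?nnegrE ?frobenius_ge0 ?sqrtr_ge0//.
rewrite frobenius_sqr sqr_sqrtr ?divr_ge0// nsqZ sqr_sqrtr//.
by rewrite ler_pdivlMr ?ltr0n// mulrC.
Qed.

Section bootstrap_identities.
Variables (n d m : nat) (X : 'M[R]_(n, d)) (y : 'cV[R]_n) (lam : R).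
Variables (S : 'I_m -> 'cV[R]_n) (J : {ffun 'I_m -> 'I_m}).
Hypotheses (m0 : (0 < m)%N) (lam_gt0 : 0 < lam).

Lemma bootH_counts : bootH X S (counts J) = avgH (fun j => zvec X (S (J j))).
Proof.
by rewrite /bootH /avgH (sumr_counts J (fun i => zvec X (S i) *m (zvec X (S i))^T)).
Qed.

Lemma bootg_counts :
  bootg X y S (counts J) = avgg (fun j => zvec X (S (J j))) (fun j => uval y (S (J j))).
Proof. by rewrite /bootg /avgg (sumr_counts J (fun i => uval y (S i) *: zvec X (S i))). Qed.

Lemma boot_beta_counts : boot_beta X y lam S (counts J) =
  ridge_est lam (fun j => zvec X (S (J j))) (fun j => uval y (S (J j))).
Proof. by rewrite /boot_beta bootH_counts bootg_counts. Qed.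

(** The sketched estimator solves the normal equations of the sketch, so the terms not resampled
    cancel and the linearized error is the [lin_stat] of the bootstrap population. *)
Lemma lin_boot_delta_counts :
  Num.sqrt m%:R *: lin_boot_delta X y lam S (counts J) =
  (Num.sqrt m%:R)^-1 *: \sum_j sketchA X lam S *m
    score lam (sketch_beta X y lam S) (zvec X (S (J j))) (uval y (S (J j))).
Proof.
set b := sketch_beta X y lam S.
have gE : sketchg X y S = (sketchH X S + lam%:M) *m b.
  by rewrite /b /sketch_beta mulmxA mulmxV ?mul1mx//; exact: avg_unit.
have e : bootg X y S (counts J) - sketchg X y S -
    (bootH X S (counts J) - sketchH X S) *m b =
    m%:R^-1 *: \sum_j score lam b (zvec X (S (J j))) (uval y (S (J j))).
  rewrite -mean_score// -bootH_counts -bootg_counts gE !mulmxDl mulNmx.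
  by apply/matrixP => i j; rewrite !mxE; ring.
rewrite /lin_boot_delta -/b e -scalemxAr scalerA mulmx_sumr; congr (_ *: _).
have sm : Num.sqrt (m%:R : R) ^+ 2 = m%:R by rewrite sqr_sqrtr.
have sn0 : Num.sqrt (m%:R : R) != 0 by rewrite sqrtr_eq0 -ltNge ltr0n.
by rewrite -{2}sm; field.
Qed.

End bootstrap_identities.
End frozen_measurability.

(** * The sketch rows as a ridge population *)

Section population_model.
Context dT (T : measurableType dT) (R : realType) (P : probability T R).

Section identical.
Context d' (T' : measurableType d') (Y1 Y2 : {RV P >-> T'}) (f : T' -> R).
Hypothesis D : forall E, measurable E -> distribution P Y1 E = distribution P Y2 E.
Hypothesis mf : measurable_fun [set: T'] f.

Lemma ge0_integral_ident (h : T' -> \bar R) : measurable_fun [set: T'] h ->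
  (forall x, 0 <= h x)%E -> (\int[P]_t h (Y1 t) = \int[P]_t h (Y2 t))%E.
Proof.
move=> mh h0.
have := ge0_integral_distribution Y1 mh h0; have := ge0_integral_distribution Y2 mh h0.
move=> <- <-; by apply: eq_measure_integral => A mA _; exact: D.
Qed.

Lemma Ex_ident : Ex P (fun t => f (Y1 t)) = Ex P (fun t => f (Y2 t)).
Proof.
have mfe : measurable_fun [set: T'] (EFin \o f) by exact/measurable_EFinP.
have pc (Y : T -> T') : (fun t => (f (Y t))%:E)^\+%E = (fun t => (EFin \o f)^\+%E (Y t)).
  by apply/funext => t; rewrite !funeposE.
have nc (Y : T -> T') : (fun t => (f (Y t))%:E)^\-%E = (fun t => (EFin \o f)^\-%E (Y t)).
  by apply/funext => t; rewrite !funenegE.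
rewrite /Ex /Rintegral; congr fine; rewrite integralE [RHS]integralE !pc !nc.
congr (_ - _)%E.
  exact: ge0_integral_ident (measurable_funepos mfe) (fun x => funepos_ge0 _ x).
exact: ge0_integral_ident (measurable_funeneg mfe) (fun x => funeneg_ge0 _ x).
Qed.

Lemma intg_ident : intg P (fun t => f (Y1 t)) -> intg P (fun t => f (Y2 t)).
Proof.
move=> /integrableP[_ I1]; apply/integrableP; split.
  by apply/measurable_EFinP; exact: measurableT_comp.
have mfa : measurable_fun [set: T'] (fun x => `|f x|%:E).
  by apply/measurable_EFinP; exact: measurableT_comp.
by rewrite -(ge0_integral_ident mfa) // => x; rewrite lee_fin.
Qed.

End identical.

Variables (n d m : nat) (X : 'M[R]_(n, d)) (y : 'cV[R]_n) (lam : R).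
Variables (s : 'I_m -> {RV P >-> borel_cV R n}) (i0 : 'I_m).
Hypotheses (lam_gt0 : 0 < lam) (s_indep : mutually_independent s)
  (s_ident : identically_distributed s).
Let s1 t : 'cV[R]_n := s i0 t.
Hypothesis s_isotropic : Emx P (fun t => s1 t *m (s1 t)^T) = map_mx EFin 1%:M.

Let ms i a : measurable_fun [set: T] (fun t => (s i t : 'cV[R]_n) a 0).
Proof. exact: (measurableT_comp (measurable_borel_cV a)). Qed.

Let iso a b : ('E_P[(fun t => s1 t a 0 * s1 t b 0)%R])%E = ((a == b)%:R)%:E.
Proof.
have /matrixP/(_ a b) := s_isotropic; rewrite !mxE => <-.
by congr expectation; apply/funext => t; rewrite mxE big_ord1 mxE.
Qed.

(** Square integrability of the rows is read off the diagonal of the isotropy equation, where the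
    integrands are nonnegative and the integrals finite. *)
Let intg_sq a : intg P (fun t => s1 t a 0 ^+ 2).
Proof.
apply/integrableP; split.
  by apply/measurable_EFinP; apply: measurable_funX; exact: ms.
have := iso a a; rewrite eqxx unlock.
rewrite (eq_integral (fun t => `|(s1 t a 0 ^+ 2)%:E|%E)); last first.
  by move=> t _; rewrite gee0_abs ?lee_fin ?sqr_ge0// expr2.
by move=> ->; rewrite ltry.
Qed.

Let intg_prod a b : intg P (fun t => s1 t a 0 * s1 t b 0).
Proof.
apply: (intg_le _ (intgD (intg_sq a) (intg_sq b))) => [|t].
  by apply: measurable_funM; exact: ms.
rewrite ler_norml; have := sqr_ge0 (s1 t a 0 - s1 t b 0).
have := sqr_ge0 (s1 t a 0 + s1 t b 0) => p1 p2.
by apply/andP; split; nra.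
Qed.

Lemma Ex_prod i a b : intg P (fun t => (s i t : 'cV[R]_n) a 0 * (s i t : 'cV[R]_n) b 0) /\
  Ex P (fun t => (s i t : 'cV[R]_n) a 0 * (s i t : 'cV[R]_n) b 0) = (a == b)%:R.
Proof.
have mf : measurable_fun [set: borel_cV R n] (fun x : 'cV[R]_n => x a 0 * x b 0).
  by apply: measurable_funM; exact: measurable_borel_cV.
have D E (mE : measurable E) := s_ident i0 i mE.
split; first exact: intg_ident D mf (intg_prod a b).
rewrite -(Ex_ident D mf) /Ex /Rintegral; have := iso a b; rewrite unlock => h.
exact: (congr1 fine h).
Qed.

Lemma Ex_bilinear i (p q : 'I_n -> R) :
  Ex P (fun t => (\sum_a p a * (s i t : 'cV[R]_n) a 0) * (\sum_b q b * (s i t : 'cV[R]_n) b 0)) =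
  \sum_a p a * q a.
Proof.
have e t : (\sum_a p a * (s i t : 'cV[R]_n) a 0) * (\sum_b q b * (s i t : 'cV[R]_n) b 0) =
   \sum_a \sum_b p a * q b * ((s i t : 'cV[R]_n) a 0 * (s i t : 'cV[R]_n) b 0).
  by rewrite big_distrlr/=; apply: eq_bigr => a _; apply: eq_bigr => b _; ring.
have I a b : intg P (fun t => p a * q b * ((s i t : 'cV[R]_n) a 0 * (s i t : 'cV[R]_n) b 0)).
  by apply: intgZ; have [] := Ex_prod i a b.
rewrite (eq_Ex P e) Ex_sum; last by move=> a; exact: intg_sum.
apply: eq_bigr => a _; rewrite Ex_sum// (bigD1 a)//= big1 ?addr0 => [|b /negbTE ba].
  by have [Ia Ea] := Ex_prod i a a; rewrite ExZ// Ea eqxx mulr1.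
by have [Ia Ea] := Ex_prod i a b; rewrite ExZ// Ea eq_sym ba mulr0.
Qed.

Let sn2 : (Num.sqrt (n%:R : R))^-1 ^+ 2 = n%:R^-1.
Proof. by rewrite exprVn sqr_sqrtr. Qed.

Let zvecE x k : zvec X x k 0 = \sum_a ((Num.sqrt n%:R)^-1 * X a k) * x a 0.
Proof. by rewrite /zvec !mxE mulr_sumr; apply: eq_bigr => a _; rewrite !mxE mulrA. Qed.

Let uvalE x : uval y x = \sum_a ((Num.sqrt n%:R)^-1 * y a 0) * x a 0.
Proof. by rewrite /uval !mxE mulr_sumr; apply: eq_bigr => a _; rewrite !mxE mulrA. Qed.

Lemma Ex_zz i k l :
  Ex P (fun t => zvec X (s i t) k 0 * zvec X (s i t) l 0) = gramH X k l.
Proof.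
under eq_Ex do rewrite !zvecE.
rewrite Ex_bilinear /gramH !mxE mulr_sumr; apply: eq_bigr => a _.
by rewrite !mxE -sn2; ring.
Qed.

Lemma Ex_uz i k :
  Ex P (fun t => uval y (s i t) * zvec X (s i t) k 0) = gramg X y k 0.
Proof.
under eq_Ex do rewrite uvalE zvecE.
rewrite Ex_bilinear /gramg !mxE mulr_sumr; apply: eq_bigr => a _.
by rewrite !mxE -sn2; ring.
Qed.

Variables (C kappa : R) (ls : seq 'cV[R]_d) (Om : 'M[R]_d).
Hypothesis unitA : gramH X + lam%:M \in unitmx.
Hypothesis boundA : nsq (ridgeA X lam) <= C.
Hypothesis bound_beta : nsq (ridge_beta X y lam) <= C.
Hypothesis moment4 : ('E_P[fun t =>
   (frobenius (zvec X (s1 t) *m (zvec X (s1 t))^T - gramH X) ^+ 4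
    + frobenius (uval y (s1 t) *: zvec X (s1 t) - gramg X y) ^+ 4)%R] <= C%:E)%E.
Hypothesis OmE : forall k l,
  fine (Emx P (fun t => influence X y lam (s1 t) *m (influence X y lam (s1 t))^T) k l) = Om k l.
Hypothesis Om_close : forall k l, `|Om k l - (\sum_(v <- ls) v *m v^T) k l| <= kappa.

Let z : borel_cV R n -> 'cV[R]_d := fun x => zvec X x.
Let u : borel_cV R n -> R := fun x => uval y x.
Let beta := ridge_beta X y lam.
Let psi := infl z u (gramH X) lam beta.

Let mid : mx_measurable (fun x : borel_cV R n => x : 'cV[R]_n).
Proof. by apply/coord_mx_measurable => i; exact: measurable_borel_cV. Qed.

Let mz : coord_measurable z.
Proof. by apply/coord_mx_measurable; exact: mx_measurable_zvec. Qed.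

Let mu : measurable_fun [set: borel_cV R n] u.
Proof. exact: measurable_uval. Qed.

Lemma measurable_dev4 :
  measurable_fun [set: borel_cV R n] (dev4 z u (gramH X) (gramg X y)).
Proof.
have mzm : mx_measurable z by apply/coord_mx_measurable.
apply: measurable_funD; apply: measurable_funX; apply: measurable_nsq;
  apply: mx_measurableB; try exact: mx_measurable_cst.
  by apply: mx_measurableM => //; exact: mx_measurableT.
exact: mx_measurableZ.
Qed.

Lemma Ex_dev4 i : intg P (fun t => dev4 z u (gramH X) (gramg X y) (s i t)) /\
  Ex P (fun t => dev4 z u (gramH X) (gramg X y) (s i t)) <= C.
Proof.
pose D := dev4 z u (gramH X) (gramg X y).
have D0 x : 0 <= D x by exact: dev4_ge0.
have E1 : (\int[P]_t (D (s i0 t))%:E <= C%:E)%E.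
  have := moment4; rewrite unlock; congr (_ <= _)%E; apply: eq_integral => t _.
  by congr (_%:E); rewrite /D /dev4 !(exprM _ 2 2) !frobenius_sqr.
have I1 : intg P (fun t => D (s i0 t)).
  apply/integrableP; split.
    by apply/measurable_EFinP; apply: measurableT_comp => //; exact: measurable_dev4.
  rewrite (eq_integral (fun t => (D (s i0 t))%:E)); last by move=> t _; rewrite gee0_abs ?lee_fin.
  by apply: (le_lt_trans E1); rewrite ltry.
have Di E (mE : measurable E) := s_ident i0 i mE.
split; first exact: intg_ident Di measurable_dev4 I1.
rewrite -(Ex_ident Di measurable_dev4) -lee_fin /Ex /Rintegral fineK//.
exact: integrable_fin_num.
Qed.

Lemma gram_beta : (gramH X + lam%:M) *m beta = gramg X y.
Proof. by rewrite /beta /ridge_beta /ridgeA mulmxA mulmxV// mul1mx. Qed.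

Let mpsi : coord_measurable psi.
Proof.
rewrite /psi /infl => k.
apply: (@coord_measurable_mulmx _ _ _ _ _ (fun x => score lam beta (z x) (u x))) => j.
have -> : (fun x => score lam beta (z x) (u x) j 0) =
  (fun x => (u x - ((z x)^T *m beta) 0 0) * z x j 0 - lam * beta j 0).
  by apply/funext => x; rewrite !mxE.
apply: measurable_funB; last exact: measurable_cst.
apply: measurable_funM; last exact: mz.
by apply: measurable_funB => //; exact: measurable_dot.
Qed.

Lemma population_cov i k l :
  Ex P (fun t => psi (s i t) k 0 * psi (s i t) l 0) = Om k l.
Proof.
have D E (mE : measurable E) := s_ident i0 i mE.
have mf : measurable_fun [set: borel_cV R n] (fun x => psi x k 0 * psi x l 0).
  by apply: measurable_funM; exact: mpsi.
rewrite -(Ex_ident D mf) -OmE mxE unlock /Ex /Rintegral; congr fine; apply: eq_integral => t _.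
congr (_%:E); symmetry; rewrite [LHS]mxE big_ord1; congr (_ * _); exact: mxE.
Qed.

Lemma population_model : ridge_model P (fun i => s i : T -> borel_cV R n) z u
  (gramH X) (gramg X y) lam beta C kappa ls.
Proof.
split.
- by move=> i; exact: measurable_funPT.
- exact: s_indep.
- exact: mz.
- exact: mu.
- exact: lam_gt0.
- exact: unitA.
- exact: boundA.
- exact: bound_beta.
- exact: gram_beta.
- exact: Ex_zz.
- exact: Ex_uz.
- by move=> i; have [] := Ex_dev4 i.
- by move=> i; have [] := Ex_dev4 i.
- by move=> i k l; rewrite population_cov.
Qed.

End population_model.

Section coverage_at_n.
Context dT (T : measurableType dT) (R : realType) (P : probability T R).
Variables (n d m B : nat) (X : 'M[R]_(n, d)) (y : 'cV[R]_n) (lam : R).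
Variables (s : 'I_m -> {RV P >-> borel_cV R n}) (w : 'I_B -> 'I_m -> {RV P >-> nat}).
Variables (i0 : 'I_m) (B0 : (0 < B)%N).
Hypothesis w_law : multinomial_draws_given s w.

Let m0 : (0 < m)%N. Proof. exact: leq_ltn_trans (ltn_ord i0). Qed.

Let S t (i : 'I_m) : 'cV[R]_n := s i t.
Let z : borel_cV R n -> 'cV[R]_d := fun x => zvec X x.
Let u : borel_cV R n -> R := fun x => uval y x.

(** The flag lets one argument serve both error bounds. *)
Definition sketch_boot_err (lin : bool) (X : 'M[R]_(n, d)) y lam S (k : 'I_m -> nat) : R :=
  if lin then lin_boot_err X y lam S k else boot_err X y lam S k.

Variables (alpha e delta K : R) (C C' C1 r kappaA kappaB : R).
Variables (ls : seq 'cV[R]_d) (Om : 'M[R]_d).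
Let beta := ridge_beta X y lam.
Let H := gramH X.
Let g := gramg X y.
Let goodn t := good (fun i => s i : T -> borel_cV R n) z u H g lam beta Om C1 r t.

Hypotheses (alpha01 : 0 < alpha < 1) (e0 : 0 < e) (C10 : 0 < C1) (r0 : 0 < r).
Hypothesis model : ridge_model P (fun i => s i : T -> borel_cV R n) z u H g lam beta C kappaA ls.
Hypothesis cov : forall i k l, Ex P (fun t => infl z u H lam beta (s i t) k 0 *
   infl z u H lam beta (s i t) l 0) = Om k l.
Hypothesis anti : forall t, radF ls m (t + delta) <= radF ls m t + e / 4.
Hypothesis sampleA : forall t, t <= K ->
  radF ls m (t - delta) - e / 4 <=
    Pr P (fun x => nsq (est_stat (fun i => s i : T -> borel_cV R n) z u lam beta x) <= t)
    <= radF ls m (t + delta) + e / 4.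

Let zb (j0 : 'I_m) t : discrete j0 -> 'cV[R]_d := fun j => z (s j t).
Let ub (j0 : 'I_m) t : discrete j0 -> R := fun j => u (s j t).
Arguments zb : clear implicits.
Arguments ub : clear implicits.

Hypothesis sampleB : forall t q, goodn t -> q <= K ->
  let Pu := unif R ([ffun=> i0] : {ffun 'I_m -> 'I_m}) in
  let bhat := ridge_est lam (fun i => z (s i t)) (fun i => u (s i t)) in
  let Hhat := avgH (fun i => z (s i t)) in
  radF ls m (q - delta) - e / 4 <=
    Pr Pu (fun x => nsq (lin_stat (coordf (m := m) (y0 := i0)) (zb i0 t) (ub i0 t) Hhat lam bhat x) <= q)
    <= radF ls m (q + delta) + e / 4 /\
  radF ls m (q - delta) - e / 4 <=
    Pr Pu (fun x => nsq (est_stat (coordf (m := m) (y0 := i0)) (zb i0 t) (ub i0 t) lam bhat x) <= q)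
    <= radF ls m (q + delta) + e / 4.

Variables (t1 t2 : R).
Hypotheses (t10 : 0 <= t1) (t1K : t1 <= K) (t20 : 0 <= t2) (t2K : t2 <= K).
Hypothesis F1 : 1 - alpha - 3 * e <= radF ls m t1 <= 1 - alpha - 3 * e + e / 4.
Hypothesis F2 : 1 - alpha + 2 * e <= radF ls m t2 <= 1 - alpha + 2 * e + e / 4.

Let lam0 : 0 < lam. Proof. exact: rm_lam model. Qed.

Let sT := g_sigma_algebraType (\big[setU/set0]_(i < m)
  preimage_set_system setT (s i : T -> borel_cV R n) measurable).

Let mx_s dX (Z : measurableType dX) (f : Z -> borel_cV R n) :
  measurable_fun [set: Z] f -> mx_measurable (f : Z -> 'cV[R]_n).
Proof.
move=> mf; apply/coord_mx_measurable => k.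
exact: measurableT_comp (measurable_borel_cV k) mf.
Qed.

Let mS i : mx_measurable (fun t : T => S t i).
Proof. by apply: mx_s; exact: measurable_funPT. Qed.

Let mS' i : mx_measurable (fun t : sT => S t i).
Proof. by apply: mx_s; exact: measurable_sketch. Qed.

Let boot_avg lin t q : 0 <= q ->
  avg (fun J : {ffun 'I_m -> 'I_m} =>
    (sketch_boot_err lin X y lam (S t) (counts J) <= Num.sqrt (q / m%:R))%R%:R) =
  Pr (unif R ([ffun=> i0] : {ffun 'I_m -> 'I_m})) (fun J => nsq ((if lin then
    lin_stat (coordf (m := m) (y0 := i0)) (zb i0 t) (ub i0 t) (avgH (fun i => z (s i t))) lam
      (ridge_est lam (fun i => z (s i t)) (fun i => u (s i t))) J else
    est_stat (coordf (m := m) (y0 := i0)) (zb i0 t) (ub i0 t) lam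
      (ridge_est lam (fun i => z (s i t)) (fun i => u (s i t))) J) : 'cV[R]_d) <= q).
Proof.
move=> q0; rewrite /Pr Ex_unif; apply: eq_avg => J; congr (_%:R).
rewrite /sketch_boot_err; case: lin; rewrite (frobenius_le_sqrt _ m0 q0).
  by rewrite lin_boot_delta_counts.
by rewrite boot_beta_counts.
Qed.

(** The window and the comparison cost [e / 4] each, and the level is attained up to [e / 4]. The
    reference levels [1 - alpha - 3 e] and [1 - alpha + 2 e] therefore keep the bootstrap law at
    distance [e] from [1 - alpha], as [coverage] demands, and the law of the error within [4 e] of
    it. *)
Lemma coverage_at_n lin : exists2 p : R,
  P [set t | frobenius (sketch_beta X y lam (S t) - beta) <=
     emp_quantile (fun b => sketch_boot_err lin X y lam (S t) (fun i => w b i t)) alpha] = p%:E &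
  `|p - (1 - alpha)| <= 4 * e + Pr P (fun t => ~~ goodn t) + (B%:R * e ^+ 2)^-1.
Proof.
have [mG _] := good_prob m0 model cov C10 r0.
have A := anti (t1 - delta); have A' := anti t1; have A2 := anti (t2 - delta).
have A2' := anti t2; rewrite !subrK in A A2.
have x_le q : 0 <= q -> Pr P (fun t => frobenius (sketch_beta X y lam (S t) - beta) <=
    Num.sqrt (q / m%:R)) =
    Pr P (fun x => nsq (est_stat (fun i => s i : T -> borel_cV R n) z u lam beta x) <= q).
  by move=> q0; apply: eq_Ex => t; congr (_%:R); rewrite frobenius_le_sqrt.
have [||||||t gt|t gt|p pE pb] := @coverage _ _ _ P _ _ m B B0 s w w_law
  (fun t => sketch_boot_err lin X y lam (S t))
  (fun t => frobenius (sketch_beta X y lam (S t) - beta)) goodn alpha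
  (Num.sqrt (t1 / m%:R)) (Num.sqrt (t2 / m%:R)) e alpha01 e0.
- exact: sqrtr_ge0.
- by move=> t k; rewrite /sketch_boot_err; case: lin; exact: frobenius_ge0.
- move=> k; rewrite /sketch_boot_err; case: lin.
    exact: (@measurable_lin_boot_err R n d X y lam _ sT m lam0 S (fun=> k) mS'
      (fun i => measurable_cst _)).
  exact: (@measurable_boot_err R n d X y lam _ sT m lam0 S (fun=> k) mS'
    (fun i => measurable_cst _)).
- apply: measurable_frobenius; apply: mx_measurableB; last exact: mx_measurable_cst.
  exact: (@mx_measurable_sketch_beta R n d X y lam _ sT m lam0 S).
- move=> b; rewrite /sketch_boot_err; case: lin.
    exact: (@measurable_lin_boot_err R n d X y lam _ T m lam0 S (fun t i => w b i t) mS).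
  exact: (@measurable_boot_err R n d X y lam _ T m lam0 S (fun t i => w b i t) mS).
- exact: mG.
- rewrite boot_avg//; have [/andP[_ b1] /andP[_ b2]] := sampleB gt t1K.
  have f : radF ls m (t1 + delta) + e / 4 <= 1 - alpha - e.
    by move: F1 e0 => /andP[_]; lra.
  by case: lin; [exact: le_trans b1 f|exact: le_trans b2 f].
- rewrite boot_avg//; have [/andP[b1 _] /andP[b2 _]] := sampleB gt t2K.
  have f : 1 - alpha + e <= radF ls m (t2 - delta) - e / 4 by move: F2 e0 => /andP[+ _]; lra.
  by case: lin; [exact: le_trans f b1|exact: le_trans f b2].
exists p => //; move: pb; rewrite !x_le//.
have /andP[a1 _] := sampleA t1K; have /andP[_ a2] := sampleA t2K.
move: F1 F2 e0 => /andP[f1 _] /andP[_ f2] e_gt0 /andP[p1 p2].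
by rewrite ler_norml; apply/andP; split; lra.
Qed.

End coverage_at_n.

(** * Coverage in the limit *)

Lemma near_all (I : finType) (Q : I -> nat -> Prop) :
  (forall i, \forall n \near \oo, Q i n) -> \forall n \near \oo, forall i, Q i n.
Proof.
move=> h; have /choice[N NQ] : forall i, exists N, forall n, (N <= n)%N -> Q i n.
  by move=> i; have [N _ NQ] := h i; exists N.
exists (\max_i N i)%N => // n /= le i; apply: NQ; apply: leq_trans le.
exact: leq_bigmax.
Qed.

Lemma cvg_EFin_close (R : realType) (f : nat -> \bar R) (l : R) :
  (forall e : R, 0 < e -> \forall n \near \oo, exists2 p, f n = p%:E & `|p - l| <= e) ->
  f @ \oo --> l%:E.
Proof.
move=> h; apply/fine_cvgP; split.
  by apply: filterS (h 1 ltr01) => n [p -> _].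
apply/cvgrPdist_le => e e0; apply: filterS (h e e0) => n [p pE pl].
by rewrite /= pE /= distrC.
Qed.

Section limit_covariance.
Variable R : realType.

Lemma psd_close d (N : 'M[R]_d) :
  (forall e : R, 0 < e -> exists2 M, psd M & forall k l, `|M k l - N k l| <= e) -> psd N.
Proof.
move=> h; split.
  apply/matrixP => k l; rewrite mxE; apply/eqP; rewrite -subr_eq0 -normr_le0.
  apply/ler_addgt0Pr => e e0; rewrite add0r.
  have [|M [sM _] MN] := h (e / 2); first by rewrite divr_gt0.
  have sMkl : M l k = M k l by rewrite -{1}sM mxE.
  have -> : N l k - N k l = (M k l - N k l) - (M l k - N l k) by rewrite sMkl; ring.
  by apply: (le_trans (ler_normB _ _)); have := MN k l; have := MN l k; lra.
move=> x; apply/ler_addgt0Pr => e e0.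
pose W := \sum_k \sum_l `|x k 0| * `|x l 0| + 1.
have W0 : 0 < W.
  by rewrite ltr_wpDl// sumr_ge0// => k _; rewrite sumr_ge0// => l _; rewrite mulr_ge0.
have [M [_ pM] MN] := h (e / W) (divr_gt0 e0 W0).
have qfE (A : 'M[R]_d) : qf A x x = \sum_k \sum_l x l 0 * A l k * x k 0.
  by rewrite /qf mxE; apply: eq_bigr => k _; rewrite mxE mulr_suml; apply: eq_bigr => l _; rewrite !mxE.
apply: (le_trans (pM x)); rewrite -lerBlDl !qfE -sumrB.
under eq_bigr do rewrite -sumrB.
apply: (@le_trans _ _ (\sum_k \sum_l e / W * (`|x k 0| * `|x l 0|))).
  apply: ler_sum => k _; apply: ler_sum => l _.
  have -> : x l 0 * M l k * x k 0 - x l 0 * N l k * x k 0 =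
    (M l k - N l k) * (x k 0 * x l 0) by ring.
  apply: (le_trans (ler_norm _)); rewrite !normrM; exact: ler_wpM2r.
under eq_bigr do rewrite -mulr_sumr.
rewrite -mulr_sumr mulrAC ler_pdivrMr// ler_pM2l//.
by rewrite /W lerDl.
Qed.

Section cov_psd.
Variables (d m : nat) (dT : measure_display) (T : measurableType dT) (P : probability T R).
Variables (d' : measure_display) (T' : measurableType d').
Variables (s : 'I_m -> T -> T') (z : T' -> 'cV[R]_d) (u : T' -> R).
Variables (H : 'M[R]_d) (g : 'cV[R]_d) (lam : R) (beta : 'cV[R]_d).
Variables (C kappa : R) (ls : seq 'cV[R]_d) (Om : 'M[R]_d) (i : 'I_m).
Hypothesis model : ridge_model P s z u H g lam beta C kappa ls.
Let psi := infl z u H lam beta.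
Hypothesis cov : forall k l, Ex P (fun t => psi (s i t) k 0 * psi (s i t) l 0) = Om k l.

Lemma cov_psd : psd Om.
Proof.
split; first by apply/matrixP => k l; rewrite mxE -!cov; apply: eq_Ex => t; rewrite mulrC.
move=> x.
have -> : qf Om x x = Ex P (fun t => (\sum_k x k 0 * psi (s i t) k 0) ^+ 2).
  rewrite (eq_Ex P (g := fun t => \sum_k \sum_l x k 0 * x l 0 *
     (psi (s i t) k 0 * psi (s i t) l 0))); last first.
    move=> t; rewrite expr2 big_distrlr/=; apply: eq_bigr => k _; apply: eq_bigr => l _; ring.
  rewrite Ex_sum => [|k]; last by apply: intg_sum => l; apply: intgZ; exact: intg_infl2 model i _ _.
  rewrite /qf mxE; under eq_bigr do rewrite mxE mulr_suml.
  rewrite exchange_big/=; apply: eq_bigr => k _.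
  rewrite Ex_sum => [|l]; last by apply: intgZ; exact: intg_infl2 model i _ _.
  apply: eq_bigr => l _; rewrite ExZ; last exact: intg_infl2 model i _ _.
  by rewrite cov !mxE; ring.
by apply: Ex_ge0 => t; exact: sqr_ge0.
Qed.

End cov_psd.
End limit_covariance.

Lemma gramH_sym (R : realType) n d (X : 'M[R]_(n, d)) (c : R) :
  (gramH X + c%:M)^T = gramH X + c%:M.
Proof. by rewrite linearD/= tr_scalar_mx /gramH linearZ/= trmx_mul trmxK. Qed.

Lemma boot_const_ge0 (R : realType) (C C1 : R) : 0 <= C -> 0 <= C1 -> 0 <= boot_const C C1.
Proof. by move=> C0 C10; rewrite /boot_const !addr_ge0 ?mulr_ge0 ?addr_ge0. Qed.

Section sketched_ridge.
Variables (R : realType) (d : nat) (d_gt0 : (0 < d)%N)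
  (m B : nat -> nat) (m_gt0 : forall n, (0 < m n)%N)
  (m_infty : m @ \oo --> \oo) (B_infty : B @ \oo --> \oo)
  (X : forall n, 'M[R]_(n, d)) (y : forall n, 'cV[R]_n)
  (lam : nat -> R) (lam_gt0 : forall n, 0 < lam n)
  (disp : nat -> measure_display) (T : forall n, measurableType (disp n))
  (P : forall n, probability (T n) R)
  (s : forall n, 'I_(m n) -> {RV (P n) >-> borel_cV R n})
  (w : forall n, 'I_(B n) -> 'I_(m n) -> {RV (P n) >-> nat}).

Let i0 n : 'I_(m n) := Ordinal (m_gt0 n).
Let s1 n (t : T n) : 'cV[R]_n := s (i0 n) t.
Let z1 n (t : T n) := zvec (X n) (s1 t).
Let u1 n (t : T n) := uval (y n) (s1 t).
Let psi1 n (t : T n) := influence (X n) (y n) (lam n) (s1 t).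

Variables (g : 'cV[R]_d) (g_cvg : gramg (X n) (y n) @[n --> \oo] --> g)
  (c0 : R) (c0_gt0 : 0 < c0)
  (lambda_min_ge : \forall n \near \oo,
     c0 <= lambda_min (gramH (X n) + (lam n)%:M))
  (s_indep : forall n, mutually_independent (@s n))
  (s_ident : forall n, identically_distributed (@s n))
  (s_isotropic : forall n,
     Emx (P n) (fun t => s1 t *m (s1 t)^T) = map_mx EFin 1%:M)
  (moment4 : (ereal_sup (range (fun n =>
     'E_(P n)[fun t =>
        (frobenius (z1 t *m (z1 t)^T - gramH (X n)) ^+ 4
         + frobenius (u1 t *: z1 t - gramg (X n) (y n)) ^+ 4)%R])) < +oo)%E)
  (Omega : 'M[R]_d)
  (Omega_cvg : forall i j,
     Emx (P n) (fun t => psi1 t *m (psi1 t)^T) i j @[n --> \oo]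
       --> (Omega i j)%:E)
  (Omega_rank : (1 <= \rank Omega)%N)
  (w_law : forall n, multinomial_draws_given (@s n) (@w n)).

Let Om n : 'M[R]_d := \matrix_(k, l) fine (Emx (P n) (fun t => psi1 t *m (psi1 t)^T) k l).

Let beta n := ridge_beta (X n) (y n) (lam n).
Let z n : borel_cV R n -> 'cV[R]_d := fun x => zvec (X n) x.
Let u n : borel_cV R n -> R := fun x => uval (y n) x.

Let model C kappa ls n := ridge_model (P n) (fun i => @s n i : T n -> borel_cV R n) (@z n) (@u n)
  (gramH (X n)) (gramg (X n) (y n)) (lam n) (beta n) C kappa ls.

Let moment4_le : exists2 M : R, 0 <= M & forall n, ('E_(P n)[fun t =>
    (frobenius (z1 t *m (z1 t)^T - gramH (X n)) ^+ 4
      + frobenius (u1 t *: z1 t - gramg (X n) (y n)) ^+ 4)%R] <= M%:E)%E.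
Proof.
move: moment4; set E := (X in ereal_sup X); move=> ltE.
have le n : ('E_(P n)[fun t => (frobenius (z1 t *m (z1 t)^T - gramH (X n)) ^+ 4
      + frobenius (u1 t *: z1 t - gramg (X n) (y n)) ^+ 4)%R] <= ereal_sup E)%E.
  by apply: ereal_sup_ubound; exists n.
move: ltE le; case: (ereal_sup E) => [r _ le||le'] //.
  exists `|r| => // n; apply: (le_trans (le n)); rewrite lee_fin; exact: ler_norm.
by exists 0 => // n; apply: (le_trans (le n)); exact: leNye.
Qed.

(** [kappa] and [ls] are quantified after [C]: the model is used with an empty list before [Omega]
    is factored, and with its factors afterwards. *)
Let population : exists2 C : R, 0 <= C & \forall n \near \oo, forall kappa ls,
  (forall k l, `|Om n k l - (\sum_(v <- ls) v *m v^T) k l| <= kappa) -> model C kappa ls n.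
Proof.
have [M M0 EM] := moment4_le.
pose cA : R := d%:R / c0 ^+ 2.
have cA0 : 0 <= cA by rewrite divr_ge0// sqr_ge0.
(* A bound for [nsq (gramg _ _)] once its entries are within 1 of their limits. *)
pose G : R := \sum_(i < d) \sum_(j < 1) (2 * g i j ^+ 2 + 2).
have G0 : 0 <= G by apply: sumr_ge0 => i _; apply: sumr_ge0 => j _; have := sqr_ge0 (g i j); lra.
have gb : \forall n \near \oo, forall i, `|g i 0 - gramg (X n) (y n) i 0| <= 1.
  apply: near_all => i.
  have gi : gramg (X n) (y n) i 0 @[n --> \oo] --> g i 0.
    exact: (cvg_comp _ _ g_cvg (@coord_continuous R d 1 i 0 g)).
  by move/cvgrPdist_le : gi => /(_ 1 ltr01).
exists (cA + cA * G + M); first by rewrite !addr_ge0// mulr_ge0.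
apply: filterS2 gb lambda_min_ge => n gn ln kappa ls close.
have [uA bA] := nsq_invmx_le (lambda_min_psd d_gt0 (gramH_sym (X n) (lam n)) ln) c0_gt0.
have bg : nsq (gramg (X n) (y n)) <= G.
  apply: ler_sum => i _; apply: ler_sum => j _; rewrite (ord1 j).
  have := gn i; rewrite ler_norml => /andP[]; move: (g i 0) (gramg _ _ i 0) => a b a1 a2.
  have : (a - b) ^+ 2 <= 1 by nra.
  have := sqr_ge0 (2 * a - b); nra.
have bb : nsq (beta n) <= cA * G.
  by apply: (le_trans (nsqM _ _)); apply: ler_pM => //; exact: nsq_ge0.
have cG0 := mulr_ge0 cA0 G0.
apply: (@population_model _ _ _ (P n) n d (m n) (X n) (y n) (lam n) (@s n) (i0 n)
  (lam_gt0 n) (@s_indep n) (@s_ident n) (s_isotropic n) _ _ _ (Om n)) => //.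
- by apply: (le_trans bA); rewrite -/cA; lra.
- by apply: (le_trans bb); lra.
- by apply: (le_trans (EM n)); rewrite lee_fin; lra.
- by move=> k l; rewrite [RHS]mxE.
Qed.

Let Om_cov n i k l : Ex (P n) (fun t =>
  infl (@z n) (@u n) (gramH (X n)) (lam n) (beta n) (@s n i t) k 0 *
  infl (@z n) (@u n) (gramH (X n)) (lam n) (beta n) (@s n i t) l 0) = Om n k l.
Proof.
apply: (population_cov (i0 := i0 n) (@s_ident n)) => k' l'.
by rewrite [RHS]mxE.
Qed.

Let Om_close (e : R) : 0 < e -> \forall n \near \oo, forall k l, `|Om n k l - Omega k l| <= e.
Proof.
move=> e0; apply: near_all => k; apply: near_all => l.
have /fine_cvgP[_ /cvgrPdist_le/(_ e e0)] := @Omega_cvg k l.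
by apply: filterS => n; rewrite distrC /= [Om n k l]mxE.
Qed.

(** The covariance matrices [Om n] are semidefinite and so is their limit; a positive rank excludes
    that all factors vanish. *)
Let Omega_outer : exists ls : seq 'cV[R]_d, exists2 l, l \in ls &
  l != 0 /\ Omega = \sum_(v <- ls) v *m v^T.
Proof.
have [C C0 mod] := population.
have psdO : psd Omega.
  apply: psd_close => e e0.
  have [n [close md]] : exists n, (forall k l, `|Om n k l - Omega k l| <= e) /\
      (forall kappa ls, (forall k l, `|Om n k l - (\sum_(v <- ls) v *m v^T) k l| <= kappa) ->
         model C kappa ls n).
    have [N _ NQ] := filterI (Om_close e0) mod.
    by exists N; apply: NQ => /=.
  exists (Om n) => //.
  (* No factors are known yet: against the empty list, a [kappa] as large as the entries of [Om n]
     will do. *)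
  have md0 : model C (\sum_k \sum_l `|Om n k l|) [::] n.
    apply: md => k l; rewrite big_nil [X in _ - X]mxE subr0 (bigD1 k)//= (bigD1 l)//= -addrA lerDl.
    by rewrite addr_ge0// sumr_ge0// => *; rewrite sumr_ge0.
  exact: (cov_psd md0 (Om_cov (i0 n))).
have [ls OE] := psd_sum_outer psdO.
exists ls.
have [/hasP[l lin l0]|/hasPn h] := boolP (has (fun l => l != 0) ls); first by exists l.
have O0 : Omega = 0.
  rewrite OE big_seq big1// => v /h; rewrite negbK => /eqP ->.
  by rewrite mul0mx.
by move: Omega_rank; rewrite O0 mxrank0.
Qed.

Lemma sketch_coverage lin alpha : 0 < alpha < 1 ->
  P n [set t | frobenius (sketch_beta (X n) (y n) (lam n) (fun i => @s n i t) - beta n) <=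
     emp_quantile (fun b => sketch_boot_err lin (X n) (y n) (lam n) (fun i => @s n i t)
       (fun i => @w n b i t)) alpha] @[n --> \oo] --> (1 - alpha)%:E.
Proof.
move=> alpha01; have /andP[alpha0 alpha1] := alpha01.
apply: cvg_EFin_close => eps eps0.
(* The errors add up to [7 e]: [4 e] from [coverage_at_n], [2 e] from bad sketches and [e] from the
   draws. The other two bounds keep both shifted levels strictly between 0 and 1. *)
have [e e0 [ee ea ea1]] : exists2 e : R, 0 < e & [/\ 8 * e <= eps, 8 * e <= alpha & 8 * e <= 1 - alpha].
  exists (Num.min eps (Num.min alpha (1 - alpha)) / 8).
    by rewrite divr_gt0// !lt_min eps0 alpha0 subr_gt0.
  rewrite mulrC divfK//; split; first by rewrite ge_min lexx.
    by rewrite !ge_min lexx orbT.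
  by rewrite !ge_min lexx !orbT.
have e4 : 0 < e / 4 by rewrite divr_gt0.
have [ls [l lin_ls [l0 OE]]] := Omega_outer.
have [C C0 mod] := population.
have p1 : 0 < 1 - alpha - 3 * e < 1 by apply/andP; split; lra.
have p2 : 0 < 1 - alpha + 2 * e < 1 by apply/andP; split; lra.
have [K1 [D1 [M1 [K10 D10 M10 anti1 quant1]]]] := radF_quantile lin_ls l0 p1 e4.
(* The window [D1] serves both levels, as anti-concentration does not refer to the level. *)
have [K2 [D2 [M2 [K20 D20 M20 _ quant2]]]] := radF_quantile lin_ls l0 p2 e4.
pose K := Num.max K1 K2.
have K0 : 0 <= K by rewrite le_max (ltW K10).
have [K1K K2K] : K1 <= K /\ K2 <= K by rewrite !le_max !lexx orbT.
(* With [C1 = C / e + 1], Markov's bound [C / C1] for the fourth moments is at most [e]. *)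
have C10 : 0 < C / e + 1 by rewrite ltr_wpDl// divr_ge0// ltW.
have CB0 : 0 <= boot_const C (C / e + 1) by exact: boot_const_ge0 C0 (ltW C10).
have [kA kA0 [MA MA0 sampleA]] := one_sample ls C0 K0 D10 e4.
have [kB kB0 [MB MB0 sampleB]] := one_sample ls CB0 K0 D10 e4.
(* Order of the choices: the covariance tolerance [kB] for the bootstrap comes first, the radius [r]
   of good sketches depends on it, and the sample size that makes such sketches likely depends on
   [r]. *)
have [r r0 boot] := boot_model ls C0 (ltW C10) kB0.
pose k := Num.min kA (kB / 2).
have k0 : 0 < k by rewrite lt_min kA0 divr_gt0.
have [kkA kkB] : k <= kA /\ k <= kB / 2 by rewrite !ge_min !lexx orbT.
pose W := d%:R ^+ 2 * (1 + C) + d%:R * (1 + C) +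
  d%:R ^+ 2 * (d%:R ^+ 2 * (8 * C ^+ 2 * (1 + C ^+ 2) * C)).
have W0 : 0 <= W / r.
  rewrite divr_ge0 ?(ltW r0)// /W; have C1_ge0 : 0 <= 1 + C by rewrite addr_ge0.
  by do ?[exact: sqr_ge0|exact: ler0n|exact: C0|apply: addr_ge0|apply: mulr_ge0].
have [MW MW0 Wle] := near_inv W0 e0.
have ie0 : 0 <= e ^- 2 by rewrite invr_ge0 sqr_ge0.
have [MQ MQ0 Qle] := near_inv ie0 e0.
have m_large : \forall n \near \oo, (maxn (maxn M1 M2) (maxn (maxn MA MB) MW) <= m n)%N.
  by move/cvgnyPge : m_infty; exact.
have B_large : \forall n \near \oo, (MQ <= B n)%N by move/cvgnyPge : B_infty; exact.
have close := Om_close k0.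
apply: filterS (filterI (filterI m_large B_large) (filterI close mod)) => n [[mn Bn] [cn md]].
move: mn; rewrite !geq_max => /andP[/andP[m1 m2] /andP[/andP[mA mB] mW]].
have B0 : (0 < B n)%N := leq_trans MQ0 Bn.
have clA kk ll : `|Om n kk ll - (\sum_(v <- ls) v *m v^T) kk ll| <= kA.
  by rewrite -OE; exact: le_trans (cn kk ll) kkA.
have clB kk ll : `|Om n kk ll - (\sum_(v <- ls) v *m v^T) kk ll| <= kB / 2.
  by rewrite -OE; exact: le_trans (cn kk ll) kkB.
have mA' := md _ _ clA.
have [t1 [t10 t1K F1]] := quant1 _ m1; have [t2 [t20 t2K F2]] := quant2 _ m2.
have [|t q gt qK|p pE pb] := @coverage_at_n _ _ _ (P n) n d (m n) (B n) (X n) (y n) (lam n) (@s n) (@w n)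
  (i0 n) B0 (@w_law n) alpha e D1 K C (C / e + 1) r kA ls (Om n) alpha01 e0 C10 r0 mA' (@Om_cov n)
  (fun t => anti1 (m n) t m1) _ _ t1 t2 t10 (le_trans t1K K1K) t20 (le_trans t2K K2K) F1 F2 lin.
- by move=> t tK; have [] := sampleA _ mA _ _ _ _ _ _ _ _ _ _ _ _ mA' t tK.
- have bm := boot (m n) (m_gt0 n) _ _ _ _ _ _ _ _ _ _ _ _ _ _ (i0 n) t mA' clB gt.
  exact: (sampleB (m n) mB _ _ _ _ _ _ _ _ _ _ _ _ bm q qK).
exists p => //; apply: (le_trans pb).
have [_ gp] := good_prob (m_gt0 n) mA' (@Om_cov n) C10 r0.
have h1 : C / (C / e + 1) <= e.
  rewrite ler_pdivrMr// mulrDr mulr1 mulrCA divff ?gt_eqF// mulr1.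
  by rewrite lerDl ltW.
have h2 : W / (m n)%:R / r <= e by rewrite mulrAC; exact: Wle.
have h3 : ((B n)%:R * e ^+ 2)^-1 <= e by rewrite (invfM (B n)%:R) mulrC; exact: Qle.
have h4 := le_trans gp (lerD h1 h2).
apply: le_trans ee; apply: (le_trans (lerD (lerD (lexx _) h4) h3)).
by rewrite (_ : 8 * e = 4 * e + (e + e) + e + e) ?lerDl ?(ltW e0)//; ring.
Qed.

End sketched_ridge.

Theorem theorem2 (R : realType) (d : nat) (d_gt0 : (0 < d)%N)
  (m B : nat -> nat) (m_gt0 : forall n, (0 < m n)%N)
  (m_infty : m @ \oo --> \oo) (B_infty : B @ \oo --> \oo)
  (X : forall n, 'M[R]_(n, d)) (y : forall n, 'cV[R]_n)
  (lam : nat -> R) (lam_gt0 : forall n, 0 < lam n)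
  (disp : nat -> measure_display) (T : forall n, measurableType (disp n))
  (P : forall n, probability (T n) R)
  (s : forall n, 'I_(m n) -> {RV (P n) >-> borel_cV R n})
  (w : forall n, 'I_(B n) -> 'I_(m n) -> {RV (P n) >-> nat})
  (s1 := fun n (t : T n) => s n (Ordinal (m_gt0 n)) t : 'cV[R]_n)
  (z1 := fun n (t : T n) => zvec (X n) (s1 n t))
  (u1 := fun n (t : T n) => uval (y n) (s1 n t))
  (psi1 := fun n (t : T n) => influence (X n) (y n) (lam n) (s1 n t))
  (* (i) *)
  (laminf : R) (laminf_ge0 : 0 <= laminf) (lam_cvg : lam @ \oo --> laminf)
  (H : 'M[R]_d) (H_cvg : gramH (X n) @[n --> \oo] --> H)
  (g : 'cV[R]_d) (g_cvg : gramg (X n) (y n) @[n --> \oo] --> g)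
  (c0 : R) (c0_gt0 : 0 < c0)
  (lambda_min_ge : \forall n \near \oo,
     c0 <= lambda_min (gramH (X n) + (lam n)%:M))
  (* (ii) *)
  (s_indep : forall n, mutually_independent (s n))
  (s_ident : forall n, identically_distributed (s n))
  (s_isotropic : forall n,
     Emx (P n) (fun t => s1 n t *m (s1 n t)^T) = map_mx EFin 1%:M)
  (moment4 : (ereal_sup (range (fun n =>
     'E_(P n)[fun t =>
        (frobenius (z1 n t *m (z1 n t)^T - gramH (X n)) ^+ 4
         + frobenius (u1 n t *: z1 n t - gramg (X n) (y n)) ^+ 4)%R])) < +oo)%E)
  (Omega : 'M[R]_d)
  (Omega_cvg : forall i j,
     Emx (P n) (fun t => psi1 n t *m (psi1 n t)^T) i j @[n --> \oo]
       --> (Omega i j)%:E)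
  (* (iii) *)
  (Omega_rank : (1 <= \rank Omega)%N)
  (* the bootstrap weights *)
  (w_law : forall n, multinomial_draws_given (s n) (w n)) :
  forall alpha : R, 0 < alpha < 1 ->
    (P n [set t | frobenius (sketch_beta (X n) (y n) (lam n) (fun i => s n i t)
                             - ridge_beta (X n) (y n) (lam n))
                  <= boot_bound (X n) (y n) (lam n) (fun i => s n i t)
                       (fun b i => w n b i t) alpha]
       @[n --> \oo] --> (1 - alpha)%:E) /\
    (P n [set t | frobenius (sketch_beta (X n) (y n) (lam n) (fun i => s n i t)
                             - ridge_beta (X n) (y n) (lam n))
                  <= lin_boot_bound (X n) (y n) (lam n) (fun i => s n i t)
                       (fun b i => w n b i t) alpha]
       @[n --> \oo] --> (1 - alpha)%:E).
Proof.
move=> alpha alpha01.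
have cov lin := @sketch_coverage R d d_gt0 m B m_gt0 m_infty B_infty X y lam lam_gt0 disp T P
  s w g g_cvg c0 c0_gt0 lambda_min_ge s_indep s_ident s_isotropic moment4 Omega Omega_cvg
  Omega_rank w_law lin _ alpha01.
by split; [exact: (cov false)|exact: (cov true)].
Qed.
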